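(* Let $\mathcal X$ be a finite set, let $G$ be a set of bijective maps $\delta:\mathcal X\to\mathcal X$ such that $\delta^{-1}\in G$ for every $\delta\in G$, and let $c:\mathcal X\times G\to[0,\infty)$. Assume that the Markov chain on $\mathcal X$ with generator $$L\psi(x)=\sum_{\delta\in G}\big(\psi(\delta x)-\psi(x)\big)c(x,\delta)$$ is irreducible and that $\pi$ is its (unique) reversible probability measure, satisfying $c(x,\delta)\pi(x)=c(\delta x,\delta^{-1})\pi(\delta x)$ for all $x\in\mathcal X$, $\delta\in G$. Set $q(x,\delta,\eta)=c(x,\delta)c(x,\eta)\pi(x)$ and $$q_*(x,\delta,\eta)=\min\big\{q(x,\delta,\eta),\,q(\delta x,\delta^{-1},\eta),\,q(\eta x,\delta,\eta^{-1}),\,q(\delta\eta x,\delta^{-1},\eta^{-1})\big\}.$$ Assume that $\delta\eta x=\eta\delta x$ for all $x\in\mathcal X$ and $\delta,\eta\in G$, and that $$\lambda:=\min_{x\in\mathcal X,\ \delta\in G,\ c(x,\delta)>0}\left[c(x,\delta)-\mathbf 1_{\{\delta\neq\delta^{-1}\}}\,c(\delta x,\delta)-\sum_{\eta\in G:\ \eta\neq\delta,\delta^{-1}}\frac{(q-q_* )(\delta x,\delta^{-1},\eta)}{c(x,\delta)\pi(x)}\right]\ \geq\ 0.$$ Then the entropic Ricci curvature of the chain is bounded below by $2\lambda$, i.e. $\mathrm{Ric}(\mathcal X,Q,\pi)\ge 2\lambda$, where $Q(x,y)=\sum_{\delta\in G:\,\delta x=y}c(x,\delta)$ for $y\ne x$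 and $Q(x,x)=0$.
   Context: Entropic Ricci curvature. Let $\mathcal X$ be a finite set, $Q:\mathcal X\times\mathcal X\to[0,\infty)$ irreducible transition rates with $Q(x,x)=0$, reversible with respect to the strictly positive probability measure $\pi$: $Q(x,y)\pi(x)=Q(y,x)\pi(y)$. Let $\mathscr P(\mathcal X)=\{\rho\in[0,\infty)^{\mathcal X}:\sum_x\rho(x)\pi(x)=1\}$ be the set of probability densities w.r.t. $\pi$, and let $\theta(s,t)=\int_0^1 s^\alpha t^{1-\alpha}\,d\alpha$ be the logarithmic mean. For $\rho_0,\rho_1\in\mathscr P(\mathcal X)$ define $$\mathcal W(\rho_0,\rho_1)^2=\inf_{\rho,\psi}\ \frac12\int_0^1\sum_{x,y\in\mathcal X}(\psi_t(x)-\psi_t(y))^2\,\theta(\rho_t(x),\rho_t(y))\,Q(x,y)\pi(x)\,dt,$$ the infimum running over all sufficiently regular curves (say $\rho$ piecewise $C^1$, $\psi$ measurable) $\rho:[0,1]\to\mathscr P(\mathcal X)$, $\psi:[0,1]\to\mathbb R^{\mathcal X}$ with $\frac{d}{dt}\rho_t(x)+\sum_{y}(\psi_t(y)-\psi_t(x))\theta(\rho_t(x),\rho_t(y))Q(x,y)=0$ for all $x$, and with $\rho|_{t=0}=\rho_0$, $\rho|_{t=1}=\rho_1$. This is a distance. The entropy is $\mathcal H(\rho)=\sum_x\pi(x)\rho(x)\log\rho(x)$. A constant speed geodesic is a curve $(\rho_t)_{t\in[0,1]}$ in $\mathscr P(\mathcal X)$ with $\mathcal W(\rho_s,\rho_t)=|s-t|\mathcal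 W(\rho_0,\rho_1)$ for all $s,t\in[0,1]$. One says that $(\mathcal X,Q,\pi)$ has (entropic) Ricci curvature bounded below by $\kappa\in\mathbb R$, written $\mathrm{Ric}(\mathcal X,Q,\pi)\ge\kappa$, if for every constant speed geodesic $(\rho_t)_{t\in[0,1]}$ in $(\mathscr P(\mathcal X),\mathcal W)$ and all $t\in[0,1]$, $$\mathcal H(\rho_t)\le(1-t)\mathcal H(\rho_0)+t\mathcal H(\rho_1)-\frac\kappa2t(1-t)\mathcal W(\rho_0,\rho_1)^2.$$ *)

(* Defs.v *)
From HB Require Import structures.
From mathcomp Require Export all_boot all_order all_algebra fingroup perm.
From mathcomp Require Export all_classical all_reals all_analysis.

Set Implicit Arguments.
Unset Strict Implicit.
Unset Printing Implicit Defensive.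

Import Order.TTheory GRing.Theory Num.Theory.
Import numFieldNormedType.Exports.

Local Open Scope classical_set_scope.
Local Open Scope ring_scope.

Section Chains.
Variables (R : realType) (X : finType).
Implicit Types (Q : X -> X -> R) (pi : X -> R).

Definition irreducible_rates Q : Prop :=
  forall x y : X, connect (fun u v => 0 < Q u v) x y.

Definition probability_measure_on pi : Prop :=
  (forall x, 0 <= pi x) /\ \sum_x pi x = 1.

Definition reversible Q pi : Prop :=
  forall x y, Q x y * pi x = Q y x * pi y.

Definition density pi (rho : X -> R) : Prop :=
  (forall x, 0 <= rho x) /\ \sum_x rho x * pi x = 1.

(* [ln 0 = 0] in the library, so [0 log 0] is read as [0]. *)
Definition entropy pi (rho : X -> R) : R := \sum_x pi x * (rho x * ln (rho x)).

Definition logmean (s t : R) : R :=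
  \int[lebesgue_measure]_(a in `[0, 1]) (s `^ a * t `^ (1 - a)).

Definition C1_line (f : R -> R) : Prop :=
  (forall t, derivable f t 1) /\ continuous (derive1 f).

(* Each piece is [C^1] up to its end points, which is expressed by agreement
   on the closed piece with a [C^1] function on the line; since consecutive
   pieces share an end point, such a curve is continuous on [0, 1]. *)
Definition piecewise_C1 (rho : R -> X -> R) : Prop :=
  exists (n : nat) (s : nat -> R),
    [/\ s 0%N = 0, s n = 1, (forall i, (i < n)%N -> s i < s i.+1) &
        forall i, (i < n)%N -> exists g : R -> X -> R,
          (forall x, C1_line (fun t => g t x)) /\
          (forall t : R, t \in `[s i, s i.+1] -> rho t = g t)].

(* The continuity equation is required at almost every time only: [rho] need
   not be differentiable at the break points. *)
Definition admissible Q pi (rho0 rho1 : X -> R) (rho psi : R -> X -> R)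
  : Prop :=
  [/\ piecewise_C1 rho,
      (forall t : R, t \in `[0, 1] -> density pi (rho t)),
      (forall x, measurable_fun (`[0, 1] : set R) (fun t => psi t x)),
      rho 0 = rho0 /\ rho 1 = rho1 &
      {ae @lebesgue_measure R, forall t : R, t \in `]0, 1[ -> forall x,
        derive1 (fun s => rho s x) t
        + \sum_y (psi t y - psi t x) * logmean (rho t x) (rho t y) * Q x y
        = 0}].

Definition action Q pi (rho psi : R -> X -> R) : \bar R :=
  let energy t := \sum_x \sum_y
    (psi t x - psi t y) ^+ 2 * logmean (rho t x) (rho t y) * Q x y * pi x in
  (2^-1%:E * \int[@lebesgue_measure R]_(t in `[0%R, 1%R]) (energy t)%:E)%E.

(* Extended-real valued, so that no default value is needed for an empty or
   infinite infimum. *)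
Definition W Q pi (rho0 rho1 : X -> R) : \bar R :=
  sqrte (ereal_inf
    [set a | exists rho psi : R -> X -> R,
       admissible Q pi rho0 rho1 rho psi /\ a = action Q pi rho psi]).

Definition constant_speed_geodesic Q pi (rho : R -> X -> R) : Prop :=
  (forall t : R, t \in `[0, 1] -> density pi (rho t)) /\
  (forall s t : R, s \in `[0, 1] -> t \in `[0, 1] ->
     W Q pi (rho s) (rho t) = (`|s - t|%:E * W Q pi (rho 0%R) (rho 1%R))%E).

Definition Ric_ge Q pi (kappa : R) : Prop :=
  forall rho, constant_speed_geodesic Q pi rho ->
  forall t : R, t \in `[0, 1] ->
    ((entropy pi (rho t))%:E <=
     ((1 - t) * entropy pi (rho 0) + t * entropy pi (rho 1))%:E
     - (kappa / 2 * t * (1 - t))%:E * W Q pi (rho 0%R) (rho 1%R) ^+ 2)%E.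

End Chains.

Section MappingRepresentation.
(* [c] is only ever evaluated at moves in [G] when [G] is closed under
   inverses and the arguments are in [G]. *)
Variables (R : realType) (X : finType) (G : {set {perm X}}).
Variable c : X -> {perm X} -> R.

Definition generator (psi : X -> R) (x : X) : R :=
  \sum_(d in G) (psi (d x) - psi x) * c x d.

Definition rates (x y : X) : R :=
  if y == x then 0 else \sum_(d in G | d x == y) c x d.

Lemma generatorE (psi : X -> R) (x : X) :
  generator psi x = \sum_y rates x y * (psi y - psi x).
Proof.
rewrite /generator (partition_big (fun d : {perm X} => d x) xpredT) //=.
apply: eq_bigr => y _; rewrite /rates; case: eqP => [->|_].
  by rewrite mul0r big1// => d /andP[_ /eqP ->]; rewrite subrr mul0r.
by rewrite mulr_suml; apply: eq_bigr => d /andP[_ /eqP ->]; rewrite mulrC.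
Qed.

Variable pi : X -> R.

Definition q (x : X) (d e : {perm X}) : R := c x d * c x e * pi x.

Definition qstar (x : X) (d e : {perm X}) : R :=
  Num.min (q x d e)
    (Num.min (q (d x) d^-1%g e)
      (Num.min (q (e x) d e^-1%g) (q (d (e x)) d^-1%g e^-1%g))).

Definition curvature_term (x : X) (d : {perm X}) : R :=
  c x d - (if d != d^-1%g then c (d x) d else 0)
  - \sum_(e in G | (e != d) && (e != d^-1%g))
      (q (d x) d^-1%g e - qstar (d x) d^-1%g e) / (c x d * pi x).

End MappingRepresentation.

Definition is_minimum (R : realType) (A : set R) (m : R) : Prop :=
  A m /\ lbound A m.

(* Main.v *)
Require Import Defs.
From mathcomp Require Import ring lra measurable_realfun.

Set Implicit Arguments.
Unset Strict Implicit.
Unset Printing Implicit Defensive.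

Import Order.TTheory GRing.Theory Num.Theory.
Import numFieldNormedType.Exports.

Local Open Scope classical_set_scope.
Local Open Scope ring_scope.

(** The commutation of the moves gives a Bochner inequality for the energy
    [sum (psi x - psi y)^2 th(rho x, rho y) Q(x, y) pi(x) / 2], valid for every
    concave homogeneous mean [th]. Along the heat semigroup it integrates, first
    for symmetrized geometric means and then, averaging over the exponent, for
    the logarithmic mean, to the gradient estimate
    [E(rho, P_t phi) <= exp(- 2 kappa t) E(P_t rho, phi)]. By duality, applying
    [P_s(t)] with an affine heat time [s] to a curve [rho_t] contracts its
    action by [exp(- 2 kappa min s)], up to [2 s'] times the drop of the entropy.
    Cut a geodesic at [rho_t] and divide both halves into [N] pieces; let the
    heat time grow linearly from [0] to [h] on the first half and decrease back
    to [0] on the second. The resulting curve joins the same end points, so it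
    costs at least [W^2]; letting [N] tend to infinity and then [h] to [0]
    yields the convexity inequality for the entropy at [rho_t]. *)

(** * The entropic Bochner inequality *)

(** A geodesic enters only through the bounds [(u - s)^2 D + e] on the action between its points and
    through the minimality of [D = W^2] between its ends, which are statements about competitors and
    not about minimizers. The tent returns to heat time 0 at both ends because this minimality
    concerns the unheated end points. Densities may vanish, and there the entropy has infinite
    slope; heating makes them positive, so the entropy is differentiated only at interior times. On
    each piece the contraction factor is governed by the smaller of its two end heat times: a half
    made of a single piece would gain nothing, whereas with many pieces the factors average to about
    [1 - kappa h], the mean heat time being [h / 2]. Writing [gap] for [(H(rho_0) - H) / t +
    (H(rho_1) - H) / (1 - t)], with [H] the entropy of the heated [rho_t], the comparison reads
    [D <= D (1 - kappa h) + 2 h gap] to leading order; dividing by [h] leaves [D kappa <= 2 gap],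
    which is the convexity inequality multiplied by a constant. The error [e] is multiplied by the
    square of the number of pieces, so it has to vanish before [N] grows. *)

(* [th1] stands for the partial derivative of [th] in its first argument; by homogeneity
   and symmetry the third condition is the tangent inequality at [(s, t)]. *)
Definition concave_mean (R : realType) (th th1 : R -> R -> R) : Prop :=
  [/\ (forall s t, th s t = th t s),
      (forall s t, 0 < s -> 0 < t -> th s t = s * th1 s t + t * th1 t s),
      (forall s t u v, 0 < s -> 0 < t -> 0 < u -> 0 < v ->
         th u v <= u * th1 s t + v * th1 t s),
      (forall s t, 0 < s -> 0 < t -> 0 <= th1 s t) &
      (forall s, 0 < s -> th s s = s)].

Section Bochner.
Variables (R : realType) (X : finType) (G : {set {perm X}}).
Variables (c : X -> {perm X} -> R) (pi : X -> R) (lambda : R).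
Hypothesis G_inv : forall d, d \in G -> d^-1%g \in G.
Hypothesis c_ge0 : forall x d, d \in G -> 0 <= c x d.
Hypothesis pi_gt0 : forall x, 0 < pi x.
Hypothesis c_rev : forall x d, d \in G ->
  c x d * pi x = c (d x) d^-1%g * pi (d x).
Hypothesis G_comm : forall x d e, d \in G -> e \in G -> d (e x) = e (d x).
Hypothesis lambda_lb : forall x d, d \in G -> 0 < c x d ->
  lambda <= curvature_term G c pi x d.
Hypothesis lambda_ge0 : 0 <= lambda.

(** Edge reversal [(x, d) -> (d x, d^-1)] is an involution of the pairs with [d] in [G]; together
    with the exchange of two moves it generates all the changes of variables below. *)
Lemma sum_flip (F : X -> {perm X} -> R) :
  \sum_x \sum_(d in G) F x d = \sum_x \sum_(d in G) F (d x) d^-1%g.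
Proof.
rewrite exchange_big/= [RHS]exchange_big/=.
rewrite (reindex_inj (@invg_inj _))/=.
rewrite (eq_bigl (mem G)); last first.
  move=> d; rewrite !inE; apply/idP/idP => [/G_inv|/G_inv//].
  by rewrite invgK.
by apply: eq_bigr => d _; rewrite (reindex_inj (@perm_inj _ d)).
Qed.

Lemma sum_flip1 (F : X -> {perm X} -> {perm X} -> R) :
  \sum_x \sum_(d in G) \sum_(e in G) F x d e =
  \sum_x \sum_(d in G) \sum_(e in G) F (d x) d^-1%g e.
Proof. exact: (sum_flip (fun x d => \sum_(e in G) F x d e)). Qed.

Lemma sum_swap (F : X -> {perm X} -> {perm X} -> R) :
  \sum_x \sum_(d in G) \sum_(e in G) F x d e =
  \sum_x \sum_(d in G) \sum_(e in G) F x e d.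
Proof. by apply: eq_bigr => x _; rewrite exchange_big. Qed.

Lemma sum_flip2 (F : X -> {perm X} -> {perm X} -> R) :
  \sum_x \sum_(d in G) \sum_(e in G) F x d e =
  \sum_x \sum_(d in G) \sum_(e in G) F (e x) d e^-1%g.
Proof. by rewrite sum_swap sum_flip1 sum_swap. Qed.

Let qs := qstar c pi.
Let q0 := q c pi.

Lemma q_ge0 x d e : d \in G -> e \in G -> 0 <= q0 x d e.
Proof. by move=> dG eG; rewrite !mulr_ge0 ?c_ge0// ltW. Qed.

Lemma qstar_ge0 x d e : d \in G -> e \in G -> 0 <= qs x d e.
Proof.
by move=> dG eG; rewrite /qs/qstar !le_min !q_ge0// G_inv.
Qed.

Lemma qstar_le x d e : qs x d e <= q0 x d e.
Proof. by rewrite /qs/qstar ge_min lexx. Qed.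

Lemma q_sym x d e : q0 x d e = q0 x e d.
Proof. by rewrite /q0/q; ring. Qed.

Lemma qstar_sym x d e : d \in G -> e \in G -> qs x d e = qs x e d.
Proof.
move=> dG eG; rewrite /qs/qstar (G_comm x dG eG).
by rewrite -![q c pi _ d _]q_sym -![q c pi _ d^-1 _]q_sym; congr Num.min; rewrite minCA.
Qed.

Lemma perm_flip x (d e : {perm X}) : d \in G -> e \in G ->
  d^-1%g (e (d x)) = e x.
Proof. by move=> dG eG; rewrite -(G_comm x dG eG) permK. Qed.

Lemma qstar_flip x d e : d \in G -> e \in G -> qs (d x) d^-1%g e = qs x d e.
Proof.
move=> dG eG; rewrite /qs/qstar permK invgK perm_flip// (G_comm x dG eG).
by rewrite minCA; congr Num.min; congr Num.min; rewrite minC.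
Qed.

Lemma qstar_flip2 x d e : d \in G -> e \in G -> qs (e x) d e^-1%g = qs x d e.
Proof.
by move=> dG eG; rewrite qstar_sym ?G_inv// qstar_flip// qstar_sym.
Qed.

(* [qstar] is invariant under [(x, d, e) -> (d x, d^-1, e)] and under
   [(x, d, e) -> (e x, d, e^-1)]. The commuting part [qcom] keeps these
   symmetries and contributes a nonnegative term by concavity of the mean; the
   remainder [qrem] is absorbed into the diagonal part [e = d]. *)
Definition qrem x d e : R :=
  if e == d then 0 else if e == d^-1%g then q0 x d e else q0 x d e - qs x d e.

Definition qcom x d e : R :=
  if (e == d) || (e == d^-1%g) then 0 else qs x d e.

Lemma q_split x d e : q0 x d e =
  (if e == d then q0 x d d else 0) + qrem x d e + qcom x d e.
Proof.
rewrite /qrem/qcom; case: eqP => [->|_] /=; first by ring.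
by case: eqP => _; ring.
Qed.

Lemma qrem_ge0 x d e : d \in G -> e \in G -> 0 <= qrem x d e.
Proof.
move=> dG eG; rewrite /qrem; case: eqP => // _; case: eqP => _.
  exact: q_ge0.
by rewrite subr_ge0 qstar_le.
Qed.

Lemma qrem_sym x d e : d \in G -> e \in G -> qrem x d e = qrem x e d.
Proof.
move=> dG eG; rewrite /qrem eq_sym; case: eqP => // _.
by rewrite -eq_invg_sym eq_sym q_sym qstar_sym.
Qed.

Lemma qcom_ge0 x d e : d \in G -> e \in G -> 0 <= qcom x d e.
Proof. by move=> dG eG; rewrite /qcom; case: ifP => // _; exact: qstar_ge0. Qed.

Lemma qcom_flip x d e : d \in G -> e \in G -> qcom (d x) d^-1%g e = qcom x d e.
Proof.
by move=> dG eG; rewrite /qcom qstar_flip// invgK orbC.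
Qed.

Lemma qcom_flip2 x d e : d \in G -> e \in G -> qcom (e x) d e^-1%g = qcom x d e.
Proof.
move=> dG eG; rewrite /qcom qstar_flip2// eq_invg_sym orbC.
by rewrite (inj_eq invg_inj).
Qed.

(** Multiplying the curvature term by [c x d * pi x] clears its denominators. In [qrem] at
    [(d x, d^-1)] the term [e = d] is the inverse move and carries all of [q]; by [c_rev] it is the
    indicator part with [c (d x) d]. If [c x d = 0], reversibility kills [q] at [(d x, d^-1, e)] and
    the sum is nonpositive. *)
Lemma curvature_bound x d : d \in G ->
  lambda * (c x d * pi x) <=
  c x d ^+ 2 * pi x - \sum_(e in G) qrem (d x) d^-1%g e.
Proof.
move=> dG; have := c_ge0 x dG; rewrite le_eqVlt => /orP[/eqP c0|c_gt0].
  rewrite -c0 mul0r mulr0 expr0n/= mul0r sub0r oppr_ge0.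
  apply: sumr_le0 => e eG.
  have q0E : q0 (d x) d^-1%g e = 0.
    by rewrite /q0/q mulrAC -c_rev// -c0 !mul0r.
  rewrite /qrem; case: eqP => // _; case: eqP => _; rewrite q0E//.
  by rewrite sub0r oppr_le0 qstar_ge0// G_inv.
have cpi : 0 < c x d * pi x by rewrite mulr_gt0.
have := lambda_lb dG c_gt0; rewrite -(ler_pM2r cpi) => /le_trans; apply.
rewrite /curvature_term !mulrBl mulr_suml.
under [X in _ - _ - X <= _]eq_bigr do rewrite divfK ?gt_eqF//.
have -> : \sum_(e in G) qrem (d x) d^-1%g e =
  (if d != d^-1%g then c (d x) d else 0) * (c x d * pi x) +
  \sum_(e in G | (e != d) && (e != d^-1%g))
     (q0 (d x) d^-1%g e - qs (d x) d^-1%g e).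
  rewrite (bigD1 d)//= {1}/qrem invgK eqxx; congr (_ + _).
    case: eqP => _ /=; first by rewrite mul0r.
    by rewrite /q0/q mulrAC -c_rev// mulrC.
  rewrite [LHS]big_mkcond [RHS]big_mkcond; apply: eq_bigr => e _.
  rewrite /qrem invgK; case: (e \in G) => //=.
  by case: eqP => //= _; case: eqP.
by rewrite expr2 -!mulrA opprD !addrA.
Qed.

Variables (th th1 : R -> R -> R).
Hypothesis th_mean : concave_mean th th1.

Variables (rho psi : X -> R).
Hypothesis rho_gt0 : forall x, 0 < rho x.

Let L := generator G c.
Let T x (d : {perm X}) := th (rho x) (rho (d x)).
Let T1 x (d : {perm X}) := th1 (rho x) (rho (d x)).
Let T2 x (d : {perm X}) := th1 (rho (d x)) (rho x).
Let g x (d : {perm X}) := psi (d x) - psi x.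

Let T_ge0 x d : 0 <= T x d.
Proof.
have [_ hom _ th1_ge0 _] := th_mean.
by rewrite /T hom// addr_ge0// mulr_ge0 ?th1_ge0// ltW.
Qed.

(** Adding to the sum its image under [(d x, d^-1, e)] produces the tangent of the mean at
    [(rho x, rho (d x))], evaluated at [(rho (e x), rho (d (e x)))]. Concavity bounds it below by
    [T (e x) d] (this is [F1]), and the change of variables [(e x, d, e^-1)] then completes the
    squares of [g x d - g (e x) d]. Commutation is what relates [g (d x) e] to [g (e x) d]. *)
Lemma bochner_com : 0 <= \sum_x \sum_(d in G) \sum_(e in G) qcom x d e *
  (2^-1 * g x d ^+ 2 * T1 x d * (rho (e x) - rho x) + T x d * g x d * g x e).
Proof.
have [thC hom conc th1_ge0 diag] := th_mean.
set S := (X in 0 <= X).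
pose F1 x d e := qcom x d e * (2^-1 * g x d ^+ 2 * T (e x) d).
pose F2 x d e :=
  qcom x d e * T x d * (2^-1 * g x d ^+ 2 - g x d * g (e x) d).
suff : 0 <= S + S by lra.
apply: (@le_trans _ _ (\sum_x \sum_(d in G) \sum_(e in G) F1 x d e
                     + \sum_x \sum_(d in G) \sum_(e in G) F2 x d e)).
  rewrite sum_flip2 -big_split/=; apply: sumr_ge0 => x _.
  rewrite -big_split/=; apply: sumr_ge0 => d dG.
  rewrite -big_split/=; apply: sumr_ge0 => e eG.
  rewrite /F1 /F2 qcom_flip2// permK.
  have -> : qcom x d e * (2^-1 * g (e x) d ^+ 2 * T x d) +
    qcom x d e * T x d * (2^-1 * g x d ^+ 2 - g x d * g (e x) d) =
    qcom x d e * T x d * (2^-1 * (g x d - g (e x) d) ^+ 2) by field.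
  by apply: mulr_ge0; apply: mulr_ge0; rewrite ?qcom_ge0 ?T_ge0 ?sqr_ge0 ?invr_ge0.
rewrite [X in _ <= _ + X]sum_flip1 /S -!big_split/=; apply: ler_sum => x _.
rewrite -!big_split/=; apply: ler_sum => d dG.
rewrite -!big_split/=; apply: ler_sum => e eG.
rewrite /F1 /F2 qcom_flip// /T1 /T !permK (thC (rho (d x))).
have -> : g (d x) d^-1%g = - g x d by rewrite /g permK; ring.
have -> : g (d x) e = g x e - g x d + g (e x) d.
  by rewrite /g (G_comm x dG eG); ring.
have H := conc (rho x) (rho (d x)) (rho (e x)) (rho (d (e x))) (rho_gt0 _)
  (rho_gt0 _) (rho_gt0 _) (rho_gt0 _).
have {}H : 0 <= 2^-1 * (qcom x d e * g x d ^+ 2) * (rho (e x) * th1 (rho x) (rho (d x))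
    + rho (d (e x)) * th1 (rho (d x)) (rho x) - th (rho (e x)) (rho (d (e x)))).
  apply: mulr_ge0; rewrite ?subr_ge0//; apply: mulr_ge0 => //.
  by apply: mulr_ge0; rewrite ?sqr_ge0 ?qcom_ge0.
rewrite -(G_comm x dG eG) -subr_ge0.
rewrite (hom (rho x) (rho (d x)))//.
move: H; congr (0 <= _).
set r := qcom _ _ _; set a := g x d; by field.
Qed.

(** The added term is the price for having no invariance: with it, concavity at [(rho (e x), rho x)]
    lets [T x e] appear, and the symmetry of [qrem] in [d] and [e] leaves the squares of
    [g x d + g x e]. *)
Lemma bochner_rem : 0 <= \sum_x \sum_(d in G) \sum_(e in G) qrem x d e *
  (2^-1 * g x d ^+ 2 * T1 x d * (rho (e x) - rho x) + T x d * g x d * g x e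
   + 2^-1 * g x d ^+ 2 * (T x d + (T1 x d + T2 x d) * rho x)).
Proof.
have [thC hom conc th1_ge0 diag] := th_mean.
pose B := \sum_x \sum_(d in G) \sum_(e in G) qrem x d e *
  (2^-1 * g x d ^+ 2 * (T x e + T x d) + T x d * g x d * g x e).
apply: (@le_trans _ _ B); last first.
  apply: ler_sum => x _; apply: ler_sum => d dG; apply: ler_sum => e eG.
  apply: ler_wpM2l; first exact: qrem_ge0.
  have := conc (rho x) (rho (d x)) (rho (e x)) (rho x)
    (rho_gt0 _) (rho_gt0 _) (rho_gt0 _) (rho_gt0 _).
  rewrite thC -/(T x e) -/(T1 x d) -/(T2 x d) => H.
  have : 0 <= g x d ^+ 2 * (rho (e x) * T1 x d + rho x * T2 x d - T x e).
    by rewrite mulr_ge0 ?sqr_ge0// subr_ge0.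
  by nra.
suff : 0 <= B + B by lra.
rewrite {2}/B sum_swap /B -big_split/=; apply: sumr_ge0 => x _.
rewrite -big_split/=; apply: sumr_ge0 => d dG.
rewrite -big_split/=; apply: sumr_ge0 => e eG.
rewrite (qrem_sym x eG dG).
have -> : forall r : R, r * (2^-1 * g x d ^+ 2 * (T x e + T x d) + T x d * g x d * g x e)
  + r * (2^-1 * g x e ^+ 2 * (T x d + T x e) + T x e * g x e * g x d)
  = r * (2^-1 * (T x e + T x d) * (g x d + g x e) ^+ 2) by move=> r; field.
apply: mulr_ge0; first exact: qrem_ge0.
by apply: mulr_ge0; [apply: mulr_ge0; rewrite ?addr_ge0|exact: sqr_ge0].
Qed.

(** A quarter of the right-hand side of [bochner_rates]: the generators acting on [rho] and [psi]
    are expanded over [e], and edge reversal keeps one end of each edge. *)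
Definition dissipation : R := \sum_x \sum_(d in G) \sum_(e in G) q0 x d e *
  (2^-1 * g x d ^+ 2 * T1 x d * (rho (e x) - rho x) + T x d * g x d * g x e).

(** The diagonal moves [e = d] contribute [c^2 pi m g^2], and the remainder costs [qrem m' g^2].
    Reversing the edge turns [m'] into [m], so both combine into [D], where [curvature_bound]
    applies. Symmetrizing once more replaces [m] by the average of [m] and [m'], which dominates
    [T]. *)
Lemma bochner :
  lambda * \sum_x \sum_(d in G) c x d * pi x * T x d * g x d ^+ 2
  <= dissipation.
Proof.
have [thC hom conc th1_ge0 diag] := th_mean.
pose m x d := 2^-1 * (T x d + (T1 x d + T2 x d) * rho (d x)).
pose m' x d := 2^-1 * (T x d + (T1 x d + T2 x d) * rho x).
have T1_ge0 x d : 0 <= T1 x d by exact: th1_ge0.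
have T2_ge0 x d : 0 <= T2 x d by exact: th1_ge0.
have m_ge0 x d : 0 <= m x d.
  by rewrite mulr_ge0 ?invr_ge0// addr_ge0// mulr_ge0 ?addr_ge0// ltW.
(* The tangent at [(rho x, rho (d x))], evaluated on the diagonal at [r = rho x + rho (d x)], gives
   [T1 + T2 >= 1]; the tangent at [(1, 1)], whose slopes are one half, gives [T <= r / 2]. *)
have mm' x d : 2 * T x d <= m x d + m' x d.
  have r0 := rho_gt0 x; have r1 := rho_gt0 (d x).
  have r01 : 0 < rho x + rho (d x) by rewrite addr_gt0.
  have := conc (rho x) (rho (d x)) _ _ r0 r1 r01 r01.
  have := conc 1 1 _ _ ltr01 ltr01 r0 r1.
  have := hom 1 1 ltr01 ltr01.
  rewrite !diag// -/(T x d) -/(T1 x d) -/(T2 x d) /m /m'.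
  set t := th1 1 1 => ht; have {ht} -> : t = 2^-1 by lra.
  by move=> h1 h2; lra.
have gflip (x : X) (d : {perm X}) : g (d x) d^-1%g = - g x d by rewrite /g permK opprB.
pose D := \sum_x \sum_(d in G) g x d ^+ 2 * m x d *
  (c x d ^+ 2 * pi x - \sum_(e in G) qrem (d x) d^-1%g e).
apply: (@le_trans _ _ D).
  apply: (@le_trans _ _ (\sum_x \sum_(d in G)
     g x d ^+ 2 * m x d * (lambda * (c x d * pi x)))); last first.
    apply: ler_sum => x _; apply: ler_sum => d dG.
    apply: ler_wpM2l; last exact: curvature_bound.
    by apply: mulr_ge0; rewrite ?sqr_ge0.
  have -> : \sum_x \sum_(d in G) g x d ^+ 2 * m x d * (lambda * (c x d * pi x))
    = lambda * \sum_x \sum_(d in G) c x d * pi x * m x d * g x d ^+ 2.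
    rewrite mulr_sumr; apply: eq_bigr => x _.
    rewrite mulr_sumr; apply: eq_bigr => d _; ring.
  apply: ler_wpM2l => //.
  set S := (X in _ <= X); set S0 := (X in X <= _).
  suff : S0 + S0 <= S + S by lra.
  rewrite {2}/S sum_flip /S0 /S -!big_split/=; apply: ler_sum => x _.
  rewrite -!big_split/=; apply: ler_sum => d dG.
  have -> : m (d x) d^-1%g = m' x d.
    by rewrite /m /m' /T /T1 /T2 permK (thC (rho (d x))); ring.
  rewrite -c_rev// gflip sqrrN.
  have H : 0 <= c x d * pi x * g x d ^+ 2 * (m x d + m' x d - 2 * T x d).
    apply: mulr_ge0; rewrite ?subr_ge0//; apply: mulr_ge0; rewrite ?sqr_ge0//.
    by apply: mulr_ge0; [exact: c_ge0|exact: ltW].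
  by rewrite -subr_ge0; move: H; congr (0 <= _); ring.
have H := addr_ge0 bochner_com bochner_rem.
rewrite -subr_ge0; move: H; congr (0 <= _).
have -> : D = \sum_x \sum_(d in G) c x d ^+ 2 * pi x * m x d * g x d ^+ 2
  - \sum_x \sum_(d in G) \sum_(e in G) qrem x d e * (m' x d * g x d ^+ 2).
  rewrite [X in _ - X]sum_flip1 -sumrB; apply: eq_bigr => x _.
  rewrite -sumrB; apply: eq_bigr => d dG.
  rewrite mulrBr; congr (_ - _); first by ring.
  rewrite mulr_sumr; apply: eq_bigr => e _.
  have -> : m' (d x) d^-1%g = m x d.
    by rewrite /m /m' /T /T1 /T2 permK (thC (rho (d x))); ring.
  by rewrite gflip sqrrN; ring.
rewrite /dissipation -big_split/= -sumrB -sumrB; apply: eq_bigr => x _.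
rewrite -big_split/= -sumrB -sumrB; apply: eq_bigr => d dG.
(* Homogeneity, applied to half of [T x d], turns the diagonal coefficient
   [T1 (rho (d x) - rho x) / 2 + T] into [m]. *)
have -> : c x d ^+ 2 * pi x * m x d * g x d ^+ 2 =
  \sum_(e in G) (if e == d then q0 x d d else 0) * (2^-1 * g x d ^+ 2 *
   T1 x d * (rho (e x) - rho x) + T x d * g x d * g x e).
  rewrite (bigD1 d)//= eqxx big1 ?addr0; last first.
    by move=> e /andP[_ /negPf ->]; rewrite mul0r.
  rewrite /q0 /q /m {1}/T hom// -/(T1 x d) -/(T2 x d).
  by rewrite /T hom// -/(T1 x d) -/(T2 x d); field.
rewrite -!(big_split, sumrB)/=; apply: eq_bigr => e eG.
rewrite (q_split x d e) /m'; set i := (if _ then _ else _); ring.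
Qed.
Lemma sum_rates (F : X -> X -> R) : (forall x, F x x = 0) ->
  \sum_x \sum_y F x y * rates G c x y * pi x =
  \sum_x \sum_(d in G) F x (d x) * (c x d * pi x).
Proof.
move=> F0; apply: eq_bigr => x _.
rewrite [RHS](partition_big (fun d : {perm X} => d x) xpredT) //=.
apply: eq_bigr => y _; rewrite /rates; case: eqP => [->|_].
  rewrite mulr0 mul0r big1// => d /andP[_ /eqP ->].
  by rewrite F0 mul0r.
rewrite mulr_sumr mulr_suml; apply: eq_bigr => d /andP[_ /eqP ->].
by rewrite mulrA.
Qed.

Lemma bochner_rates :
  4 * lambda * \sum_x \sum_y
    (psi x - psi y) ^+ 2 * th (rho x) (rho y) * rates G c x y * pi x
  <= \sum_x \sum_y
    ((psi x - psi y) ^+ 2 * (th1 (rho x) (rho y) * L rho x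
                           + th1 (rho y) (rho x) * L rho y)
     - 2 * (psi x - psi y) * th (rho x) (rho y) * (L psi x - L psi y))
    * rates G c x y * pi x.
Proof.
have [thC hom conc th1_ge0 diag] := th_mean.
rewrite sum_rates => [|x]; last by rewrite subrr expr0n !mul0r.
rewrite sum_rates => [|x]; last by rewrite !subrr expr0n/=; ring.
set A := \sum_x _; set B := \sum_x _.
have -> : A = \sum_x \sum_(d in G) c x d * pi x * T x d * g x d ^+ 2.
  by apply: eq_bigr => x _; apply: eq_bigr => d _; rewrite /T/g; ring.
suff -> : B = 4 * dissipation by have := bochner; lra.
pose F x (d : {perm X}) := c x d * pi x *
  (2^-1 * g x d ^+ 2 * T1 x d * L rho x + T x d * g x d * L psi x).
have -> : dissipation = \sum_x \sum_(d in G) F x d.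
  apply: eq_bigr => x _; apply: eq_bigr => d _.
  rewrite /F {1 2}/L /generator !mulr_sumr -big_split/= mulr_sumr.
  by apply: eq_bigr => e _; rewrite /q0 /q /g; ring.
have -> : B = 2 * \sum_x \sum_(d in G) F x d
  + 2 * \sum_x \sum_(d in G) F x d; last by ring.
rewrite [in X in _ + X]sum_flip -mulrDr -big_split mulr_sumr/=.
apply: eq_bigr => x _; rewrite -big_split mulr_sumr/=.
apply: eq_bigr => d dG; rewrite /F -c_rev// /g /T /T1 permK.
by rewrite (thC (rho (d x))); field.
Qed.

End Bochner.

(** * The heat semigroup *)

Lemma is_derive_fsum (R : realType) (I : finType) (f : I -> R -> R)
    (df : I -> R) (t : R) :
  (forall i, is_derive t 1 (f i) (df i)) ->
  is_derive t 1 (fun s => \sum_i f i s) (\sum_i df i).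
Proof.
move=> H; rewrite (_ : (fun s => _) = \sum_i f i); last first.
  by apply/funext => s; rewrite fct_sumE.
by elim/big_ind2 : _ => // [|] *; [exact: is_derive_cst|exact: is_deriveD].
Qed.

Lemma is_derive_continuous (R : realType) (f : R -> R) (t df : R) :
  is_derive t 1 f df -> {for t, continuous f}.
Proof.
by move=> H; apply/differentiable_continuous/derivable1_diffP; case: H.
Qed.

Lemma sum_by_parts (R : realType) (X : finType) (w : X -> X -> R)
    (f g : X -> R) : (forall x y, w x y = w y x) ->
  \sum_x f x * (\sum_y w x y * (g y - g x)) =
  - 2^-1 * \sum_x \sum_y w x y * ((f x - f y) * (g x - g y)).
Proof.
move=> wC.
have E : \sum_x f x * (\sum_y w x y * (g y - g x)) =
    \sum_x \sum_y f x * (w x y * (g y - g x)).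
  by apply: eq_bigr => x _; rewrite mulr_sumr.
have E2 : \sum_x f x * (\sum_y w x y * (g y - g x)) =
    \sum_x \sum_y f y * (w x y * (g x - g y)).
  rewrite E exchange_big; apply: eq_bigr => x _; apply: eq_bigr => y _ /=.
  by rewrite wC.
suff -> : \sum_x \sum_y w x y * ((f x - f y) * (g x - g y)) =
    - (\sum_x f x * (\sum_y w x y * (g y - g x))
     + \sum_x f x * (\sum_y w x y * (g y - g x))) by lra.
rewrite {1}E E2 -big_split -sumrN; apply: eq_bigr => x _ /=.
by rewrite -big_split -sumrN; apply: eq_bigr => y _ /=; ring.
Qed.

Section HeatKernel.
Variables (R : realType) (X : finType) (Q : X -> X -> R) (pi : X -> R).
Hypothesis Q_ge0 : forall x y, 0 <= Q x y.
Hypothesis Q_irr : irreducible_rates Q.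
Hypothesis pi_gt0 : forall x, 0 < pi x.
Hypothesis Q_rev : reversible Q pi.

Definition lap (f : X -> R) (x : X) : R := \sum_y Q x y * (f y - f x).

Definition total_rate : R := \sum_x \sum_y Q x y.

(* The heat semigroup is [exp (t L) = exp (- C t) * exp (t (L + C))] with [C]
   so large that the matrix [L + C] has nonnegative entries. *)
Definition shifted_rate (x y : X) : R :=
  Q x y + (if x == y then total_rate - \sum_z Q x z else 0).

Fixpoint shifted_pow (k : nat) (x y : X) : R :=
  if k is k'.+1 then \sum_z shifted_rate x z * shifted_pow k' z y
  else (x == y)%:R.

Definition heat_coeff x y (k : nat) : R := shifted_pow k x y / k`!%:R.

Definition heat_kernel (t : R) (x y : X) : R :=
  expR (- total_rate * t) * limn (pseries (heat_coeff x y) t).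

Definition heat (t : R) (f : X -> R) (x : X) : R :=
  \sum_y heat_kernel t x y * f y.

Lemma row_sum_le x : \sum_z Q x z <= total_rate.
Proof.
rewrite /total_rate [leRHS](bigD1 x)//= lerDl; apply: sumr_ge0 => y _.
exact: sumr_ge0.
Qed.

Lemma total_rate_ge0 : 0 <= total_rate.
Proof. by apply: sumr_ge0 => x _; exact: sumr_ge0. Qed.

Lemma shifted_rate_ge0 x y : 0 <= shifted_rate x y.
Proof.
by rewrite addr_ge0//; case: eqP => // _; rewrite subr_ge0 row_sum_le.
Qed.

Lemma sum_shifted_rate f x :
  \sum_y shifted_rate x y * f y = total_rate * f x + lap f x.
Proof.
rewrite /shifted_rate /lap.
under eq_bigr do rewrite mulrDl.
rewrite big_split/= (bigD1 x (F := fun y => (if _ then _ else _) * _))//= eqxx.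
rewrite [X in _ + (_ + X)]big1 ?addr0; last first.
  by move=> y; rewrite eq_sym => /negPf ->; rewrite mul0r.
under [in RHS]eq_bigr do rewrite mulrBr.
by rewrite sumrB -mulr_suml; ring.
Qed.

Lemma shifted_pow_ge0 k x y : 0 <= shifted_pow k x y.
Proof.
elim: k x => [|k IH] x /=; first by rewrite ler0n.
by apply: sumr_ge0 => z _; rewrite mulr_ge0 ?shifted_rate_ge0.
Qed.

Lemma shifted_pow_le k x y : shifted_pow k x y <= total_rate ^+ k.
Proof.
elim: k x => [|k IH] x /=; first by rewrite expr0; case: eqP; rewrite ?lexx ?ler01.
apply: (@le_trans _ _ (\sum_z shifted_rate x z * total_rate ^+ k)).
  by apply: ler_sum => z _; rewrite ler_wpM2l ?shifted_rate_ge0.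
rewrite (sum_shifted_rate (fun=> total_rate ^+ k)) /lap big1 ?addr0 ?exprS//.
by move=> z _; rewrite subrr mulr0.
Qed.

Lemma shifted_powSr k x y :
  shifted_pow k.+1 x y = \sum_z shifted_pow k x z * shifted_rate z y.
Proof.
elim: k x => [|k IH] x.
  rewrite /= (bigD1 y)//= eqxx mulr1 big1 ?addr0; last first.
    by move=> z /negPf ->; rewrite mulr0.
  rewrite (bigD1 x)//= eqxx mul1r big1 ?addr0// => z.
  by rewrite eq_sym => /negPf ->; rewrite mul0r.
rewrite [LHS]/=; under eq_bigr => z _ do rewrite -/(shifted_pow k.+1 z y) IH mulr_sumr.
rewrite exchange_big; apply: eq_bigr => z _ /=.
by rewrite mulr_suml; apply: eq_bigr => w _; rewrite mulrA.
Qed.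

Lemma shifted_rate_rev x y : shifted_rate x y * pi x = shifted_rate y x * pi y.
Proof.
rewrite /shifted_rate !mulrDl Q_rev (eq_sym y).
by congr (_ + _); case: eqP => [->//|_]; rewrite !mul0r.
Qed.

Lemma shifted_pow_rev k x y : shifted_pow k x y * pi x = shifted_pow k y x * pi y.
Proof.
elim: k x y => [|k IH] x y.
  by rewrite /= (eq_sym y); case: eqP => [->//|_]; rewrite !mul0r.
rewrite shifted_powSr /= !mulr_suml; apply: eq_bigr => z _.
transitivity (shifted_pow k x z * pi x * shifted_rate z y); first by ring.
by rewrite IH -mulrA [pi z * _]mulrC (shifted_rate_rev z y); ring.
Qed.

Lemma is_cvg_heat_coeff x y t : cvgn (pseries (heat_coeff x y) t).
Proof.
apply: normed_cvg.
apply: series_le_cvg (is_cvg_series_exp_coeff (total_rate * `|t|)) => [k|k|k] /=.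
- by [].
- by rewrite /exp_coeff /= divr_ge0// exprn_ge0// mulr_ge0 ?total_rate_ge0.
rewrite /exp_coeff /heat_coeff/= normrM normf_div normrX exprMn.
rewrite (ger0_norm (shifted_pow_ge0 _ _ _)) normr_nat mulrAC.
by rewrite ler_wpM2r ?invr_ge0// ler_wpM2r ?exprn_ge0// shifted_pow_le.
Qed.

Lemma pseries_diffs_heat_coeff x y k : pseries_diffs (heat_coeff x y) k =
  \sum_z shifted_rate x z * heat_coeff z y k.
Proof.
rewrite /pseries_diffs /heat_coeff factS natrM invfM mulrCA mulVKf// /=.
by rewrite mulr_suml; apply: eq_bigr => z _; rewrite mulrA.
Qed.

Lemma cvg_pseries_diffs_heat_coeff x y t :
  pseries (pseries_diffs (heat_coeff x y)) t @ \oo -->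
  \sum_z shifted_rate x z * limn (pseries (heat_coeff z y) t).
Proof.
have -> : pseries (pseries_diffs (heat_coeff x y)) t =
    \sum_z (fun n => shifted_rate x z * pseries (heat_coeff z y) t n).
  apply/funext => n; rewrite fct_sumE /pseries /series/=.
  under [RHS]eq_bigr do rewrite mulr_sumr.
  rewrite [RHS]exchange_big/=; apply: eq_bigr => k _.
  rewrite pseries_diffs_heat_coeff mulr_suml.
  by apply: eq_bigr => z _; rewrite mulrA.
elim/big_ind2 : _ => [|f a g b cf cg|z _]; [exact: cvg_cst|exact: cvgD|].
by apply: cvgM; [exact: cvg_cst|exact: is_cvg_heat_coeff].
Qed.

Lemma is_cvg_pseries_diffs2_heat_coeff x y t :
  cvgn (pseries (pseries_diffs (pseries_diffs (heat_coeff x y))) t).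
Proof.
have -> : pseries (pseries_diffs (pseries_diffs (heat_coeff x y))) t =
    \sum_z (fun n => shifted_rate x z *
      pseries (pseries_diffs (heat_coeff z y)) t n).
  apply/funext => n; rewrite fct_sumE /pseries /series/=.
  under [RHS]eq_bigr do rewrite mulr_sumr.
  rewrite [RHS]exchange_big/=; apply: eq_bigr => k _.
  rewrite {1}/pseries_diffs pseries_diffs_heat_coeff mulr_sumr mulr_suml.
  by apply: eq_bigr => z _; rewrite /pseries_diffs; ring.
elim/big_ind : _ => [|f g cf cg|z _]; [exact: is_cvg_cst|exact: is_cvgD|].
by apply: is_cvgM; [exact: is_cvg_cst|apply/cvg_ex]; eexists; exact: cvg_pseries_diffs_heat_coeff.
Qed.

(** Termwise differentiation applies [L + C] to the series in its first variable and the exponential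
    prefactor subtracts [C] again. The number [|t| + 1] only serves as a radius exceeding [|t|]. *)
Lemma is_derive_heat_kernel (t : R) (x y : X) : is_derive t (1 : R)
  (fun s => heat_kernel s x y) (lap (fun z => heat_kernel t z y) x).
Proof.
have H := @pseries_snd_diffs _ (heat_coeff x y) (`|t| + 1) t
  (@is_cvg_heat_coeff _ _ _)
  (cvgP _ (@cvg_pseries_diffs_heat_coeff _ _ _))
  (@is_cvg_pseries_diffs2_heat_coeff _ _ _).
have {}H := H _.
have /H {}H : `|t| < `| `|t| + 1 |.
  by rewrite [ltRHS]ger0_norm ?ltrDl// addr_ge0.
rewrite (cvg_lim _ (@cvg_pseries_diffs_heat_coeff x y t))// in H.
have E : is_derive t (1 : R) (fun s => expR (- total_rate * s))
    (- total_rate * expR (- total_rate * t)).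
  have E1 := is_deriveZ (- total_rate) (is_derive_id t (1 : R)).
  have E2 := is_derive1_comp (is_derive_expR _) E1.
  by apply: is_derive_eq E2 _; rewrite /GRing.scale/= mulr1 mulrC.
have D := is_deriveM E H; apply: is_derive_eq D _.
rewrite /GRing.scale/= /heat_kernel.
transitivity (expR (- total_rate * t) * ((\sum_z shifted_rate x z *
   limn (pseries (heat_coeff z y) t)) - total_rate *
   limn (pseries (heat_coeff x y) t))); first by ring.
rewrite sum_shifted_rate addrAC subrr add0r /lap mulr_sumr.
by apply: eq_bigr => z _; ring.
Qed.

Lemma heat_kernel0 x y : heat_kernel 0 x y = (x == y)%:R.
Proof.
rewrite /heat_kernel mulr0 expR0 mul1r; apply/cvg_lim => //.
rewrite -(cvg_shiftS _ _) /=.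
rewrite (_ : (fun _ => _) = cst (x == y)%:R); first exact: cvg_cst.
apply/funext => n; rewrite /pseries /series/= big_nat_recl//= big1.
  by rewrite /heat_coeff /= fact0 divr1 expr0 mulr1 addr0.
by move=> k _; rewrite expr0n mulr0.
Qed.

Lemma heat_kernel_rev t x y :
  heat_kernel t x y * pi x = heat_kernel t y x * pi y.
Proof.
have E : heat_coeff x y = (fun k => pi y / pi x * heat_coeff y x k).
  apply/funext => k; apply: (mulIf (lt0r_neq0 (pi_gt0 x))).
  rewrite /heat_coeff mulrAC shifted_pow_rev.
  by field; rewrite gt_eqF// lt0r_neq0// ltr0n fact_gt0.
rewrite /heat_kernel -!mulrA; congr (_ * _).
have -> : limn (pseries (heat_coeff x y) t) =
    pi y / pi x * limn (pseries (heat_coeff y x) t).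
  apply/cvg_lim => //; rewrite E.
  rewrite (_ : pseries _ t = (fun n => pi y / pi x * pseries (heat_coeff y x) t n)).
    by apply: cvgM; [exact: cvg_cst|exact: is_cvg_heat_coeff].
  apply/funext => n; rewrite /pseries /series/= mulr_sumr.
  by apply: eq_bigr => k _; rewrite mulrA.
by field; rewrite gt_eqF.
Qed.

Lemma sum_lap g : \sum_x pi x * lap g x = 0.
Proof.
have E : \sum_x pi x * lap g x =
    \sum_x \sum_y pi x * (Q x y * (g y - g x)).
  by apply: eq_bigr => x _; rewrite mulr_sumr.
suff : \sum_x pi x * lap g x = - (\sum_x pi x * lap g x) by lra.
rewrite {1}E exchange_big E -sumrN; apply: eq_bigr => x _ /=.
rewrite -sumrN; apply: eq_bigr => y _.
by rewrite mulrA [pi y * _]mulrC Q_rev; ring.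
Qed.

(** The [pi]-weighted column sum has derivative zero by [sum_lap], hence keeps its initial value
    [pi x]; reversibility converts it into a row sum. *)
Lemma sum_heat_kernel t x : \sum_y heat_kernel t x y = 1.
Proof.
pose f s := \sum_y pi y * heat_kernel s y x.
have df (s : R) : is_derive s (1 : R) f 0.
  have D y : is_derive s (1 : R) (fun s => pi y * heat_kernel s y x)
    (pi y *: lap (fun z => heat_kernel s z x) y).
    exact: is_deriveZ (is_derive_heat_kernel _ _ _).
  by apply: is_derive_eq (is_derive_fsum D) _; exact: sum_lap.
have : f t = pi x.
  rewrite (is_derive_0_is_cst t 0 df) /f (bigD1 x)//= heat_kernel0 eqxx mulr1.
  by rewrite big1 ?addr0// => y /negPf yx; rewrite heat_kernel0 yx mulr0.
move=> E; apply: (mulIf (lt0r_neq0 (pi_gt0 x))); rewrite mul1r -[RHS]E.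
by rewrite mulr_suml; apply: eq_bigr => y _; rewrite heat_kernel_rev mulrC.
Qed.

Lemma heat_kernel_ge0 t x y : 0 <= t -> 0 <= heat_kernel t x y.
Proof.
move=> t0; rewrite mulr_ge0 ?expR_ge0//; apply: limr_ge.
  exact: is_cvg_heat_coeff.
apply: nearW => n; apply: sumr_ge0 => k _.
by rewrite !mulr_ge0 ?shifted_pow_ge0 ?invr_ge0 ?exprn_ge0.
Qed.

Lemma shifted_pow_connected x y : exists k, 0 < shifted_pow k x y.
Proof.
have /connectP[p] := Q_irr x y.
elim: p x => [|z p IH] x /= => [_ ->|/andP[Qxz pz] yE].
  by exists 0; rewrite /= eqxx.
have [k kzy] := IH z pz yE; exists k.+1 => /=.
rewrite (bigD1 z)//= ltr_pwDl//; last first.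
  by apply: sumr_ge0 => w _; rewrite mulr_ge0 ?shifted_rate_ge0 ?shifted_pow_ge0.
rewrite mulr_gt0//; apply: lt_le_trans Qxz _.
rewrite lerDl; case: eqP => // _; by rewrite subr_ge0 row_sum_le.
Qed.

(** A path of positive rates makes one coefficient of the series positive, and all the others are
    nonnegative. *)
Lemma heat_kernel_gt0 t x y : 0 < t -> 0 < heat_kernel t x y.
Proof.
move=> t0; rewrite mulr_gt0 ?expR_gt0//.
have [k kxy] := shifted_pow_connected x y.
have : 0 < heat_coeff x y k * t ^+ k.
  by rewrite mulr_gt0 ?exprn_gt0// divr_gt0// ltr0n fact_gt0.
move=> /lt_le_trans; apply; apply: limr_ge; first exact: is_cvg_heat_coeff.
exists k.+1 => // n /= kn; rewrite /pseries /series /=.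
rewrite (big_cat_nat (leq0n _) kn)//= big_nat_recr//= -[leLHS]add0r -addrA.
apply: lerD; first apply: sumr_ge0 => i _; last rewrite lerDl.
  by rewrite !mulr_ge0 ?shifted_pow_ge0 ?invr_ge0 ?exprn_ge0// ltW.
apply: sumr_ge0 => i _.
by rewrite !mulr_ge0 ?shifted_pow_ge0 ?invr_ge0 ?exprn_ge0// ltW.
Qed.

Lemma lap_heatE t f x :
  lap (heat t f) x = \sum_y lap (fun z => heat_kernel t z y) x * f y.
Proof.
rewrite /lap /heat; under [RHS]eq_bigr do rewrite mulr_suml.
rewrite exchange_big; apply: eq_bigr => z _ /=.
by rewrite -sumrB mulr_sumr; apply: eq_bigr => y _; ring.
Qed.

Lemma lap_sym f g :
  \sum_x pi x * (f x * lap g x) = \sum_x pi x * (lap f x * g x).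
Proof.
have H h k : \sum_x pi x * (h x * lap k x) =
    \sum_x h x * (\sum_y (Q x y * pi x) * (k y - k x)).
  apply: eq_bigr => x _; rewrite mulrCA; congr (_ * _).
  by rewrite /lap mulr_sumr; apply: eq_bigr => y _; ring.
under [RHS]eq_bigr do rewrite [lap _ _ * _]mulrC.
rewrite !H !sum_by_parts//; congr (_ * _).
by apply: eq_bigr => x _; apply: eq_bigr => y _; ring.
Qed.

(** Both sides are the time derivatives of the two sides of [heat_kernel_rev]. This moves the
    Laplacian from one variable of the kernel to the other, whence its commutation with the
    semigroup. *)
Lemma lap_heat_kernel_rev t x y :
  pi x * lap (fun z => heat_kernel t z y) x =
  pi y * lap (fun z => heat_kernel t z x) y.
Proof.
have D1 := is_deriveZ (pi x) (is_derive_heat_kernel t x y).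
have D2 := is_deriveZ (pi y) (is_derive_heat_kernel t y x).
rewrite -[LHS](@derive_val _ _ _ _ _ _ _ D1) -[RHS](@derive_val _ _ _ _ _ _ _ D2).
congr ('D_1 _ t); apply/funext => s.
by rewrite /= /GRing.scale/= mulrC heat_kernel_rev mulrC.
Qed.

Lemma heat_lap t f x : lap (heat t f) x = heat t (lap f) x.
Proof.
apply: (mulfI (lt0r_neq0 (pi_gt0 x))); rewrite lap_heatE mulr_sumr.
under eq_bigr do rewrite mulrA lap_heat_kernel_rev -mulrA.
rewrite -lap_sym /heat mulr_sumr; apply: eq_bigr => y _.
by rewrite mulrA [pi y * _]mulrC -heat_kernel_rev; ring.
Qed.

Lemma is_derive_heat t f x :
  is_derive t (1 : R) (fun s => heat s f x) (heat t (lap f) x).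
Proof.
have D y : is_derive t (1 : R) (fun s => heat_kernel s x y * f y)
    (f y *: lap (fun z => heat_kernel t z y) x).
  rewrite (_ : (fun s => _) = f y \*: (fun s => heat_kernel s x y)).
    exact: is_deriveZ (is_derive_heat_kernel _ _ _).
  by apply/funext => s; rewrite /= mulrC.
apply: is_derive_eq (is_derive_fsum D) _.
by rewrite -heat_lap lap_heatE; apply: eq_bigr => y _; rewrite mulrC.
Qed.

Lemma heat0 f x : heat 0 f x = f x.
Proof.
rewrite /heat (bigD1 x)//= heat_kernel0 eqxx mul1r big1 ?addr0// => y.
by rewrite heat_kernel0 eq_sym => /negPf ->; rewrite mul0r.
Qed.

Lemma heat_rev t f g :
  \sum_x pi x * (f x * heat t g x) = \sum_x pi x * (heat t f x * g x).
Proof.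
rewrite /heat; under eq_bigr do rewrite !mulr_sumr.
rewrite exchange_big; apply: eq_bigr => y _ /=.
rewrite mulr_suml mulr_sumr; apply: eq_bigr => x _.
have := heat_kernel_rev t x y; set p := heat_kernel t x y => E.
transitivity (p * pi x * (f x * g y)); first by ring.
by rewrite E; ring.
Qed.

Lemma heat_cst t a x : heat t (fun=> a) x = a.
Proof. by rewrite /heat -mulr_suml sum_heat_kernel mul1r. Qed.

Lemma sum_heat t f : \sum_x pi x * heat t f x = \sum_x pi x * f x.
Proof.
have := heat_rev t (fun=> 1) f.
under eq_bigr do rewrite mul1r.
by move=> ->; apply: eq_bigr => x _; rewrite heat_cst mul1r.
Qed.

Lemma heat_ge0 t f x : 0 <= t -> (forall y, 0 <= f y) -> 0 <= heat t f x.
Proof.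
by move=> t0 f0; apply: sumr_ge0 => y _; rewrite mulr_ge0 ?heat_kernel_ge0.
Qed.

Lemma density_heat t rho : 0 <= t -> density pi rho -> density pi (heat t rho).
Proof.
move=> t0 [r0 r1]; split=> [x|]; first exact: heat_ge0.
under eq_bigr do rewrite mulrC.
by rewrite sum_heat -[RHS]r1; apply: eq_bigr => x _; rewrite mulrC.
Qed.

Lemma heat_gt0 t rho x : 0 < t -> density pi rho -> 0 < heat t rho x.
Proof.
move=> t0 [r0 r1].
have /existsP[y ry] : [exists y, 0 < rho y]%B.
  apply: contraT => /existsPn H; move: r1; rewrite big1.
    by move/eqP; rewrite eq_sym oner_eq0.
  move=> y _; apply/eqP; rewrite mulf_eq0; apply/orP; left.
  by rewrite eq_le r0 andbT leNgt H.
rewrite /heat (bigD1 y)//= ltr_pwDl//.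
  by apply: mulr_gt0 => //; exact: heat_kernel_gt0.
by apply: sumr_ge0 => z _; rewrite mulr_ge0 ?heat_kernel_ge0// ltW.
Qed.

End HeatKernel.

(** * Geometric and logarithmic means *)

Section GeometricMean.
Variable R : realType.
Implicit Types a s t u v : R.

Definition wgm a s t : R := s `^ a * t `^ (1 - a).

(* [logmean] is the average of [gmean a] over [a] in [0, 1]; working with each
   [gmean a] avoids differentiating [logmean]. *)
Definition gmean a s t : R := (wgm a s t + wgm (1 - a) s t) / 2.

(* The partial derivative of [gmean a] in its first argument. *)
Definition gmean1 a s t : R :=
  (a * wgm a s t + (1 - a) * wgm (1 - a) s t) / (2 * s).

Lemma wgmE a s t : 0 < s -> 0 < t ->
  wgm a s t = expR (a * ln s + (1 - a) * ln t).
Proof. by move=> s0 t0; rewrite /wgm /powR !gt_eqF// expRD. Qed.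

Lemma wgm_sym a s t : wgm (1 - a) s t = wgm a t s.
Proof. by rewrite /wgm subKr mulrC. Qed.

Lemma wgm_ge0 a s t : 0 <= wgm a s t.
Proof. by rewrite mulr_ge0 ?powR_ge0. Qed.

(* From [1 + x <= expR x]. *)
Lemma wgm_tangent a s t u v : 0 <= a <= 1 -> 0 < s -> 0 < t -> 0 < u -> 0 < v ->
  wgm a u v <= wgm a s t * (a * (u / s) + (1 - a) * (v / t)).
Proof.
move=> /andP[a0 a1] s0 t0 u0 v0.
have E x y : 0 < x -> 0 < y -> x / y = expR (ln x - ln y).
  by move=> x0 y0; rewrite expRB !lnK.
rewrite !wgmE// !E//.
set ls := ln s; set lt := ln t; set lu := ln u; set lv := ln v.
set m := a * ls + (1 - a) * lt; set m' := a * lu + (1 - a) * lv.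
(* With [d] the weighted mean of the two logarithmic ratios, the first-order terms of the
   exponential bounds at [d] cancel in the weighted sum ([Ed]): this is weighted AM-GM. *)
pose d := m' - m.
have -> : m' = m + d by rewrite /d; ring.
rewrite (expRD m d) ler_wpM2l ?expR_ge0//.
have T x : expR d * (1 + (x - d)) <= expR x.
  have -> : expR x = expR d * expR (x - d) by rewrite -expRD; congr expR; ring.
  by rewrite ler_wpM2l ?expR_ge0// expR_ge1Dx.
have H1 := T (lu - ls); have H2 := T (lv - lt).
have {}H1 : 0 <= a * (expR (lu - ls) - expR d * (1 + (lu - ls - d))).
  by rewrite mulr_ge0 ?subr_ge0.
have {}H2 : 0 <= (1 - a) * (expR (lv - lt) - expR d * (1 + (lv - lt - d))).
  by rewrite mulr_ge0 ?subr_ge0.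
have Ed : a * (lu - ls - d) + (1 - a) * (lv - lt - d) = 0.
  by rewrite /d /m /m'; ring.
have := addr_ge0 H1 H2.
have -> : a * (expR (lu - ls) - expR d * (1 + (lu - ls - d))) +
  (1 - a) * (expR (lv - lt) - expR d * (1 + (lv - lt - d))) =
  a * expR (lu - ls) + (1 - a) * expR (lv - lt) - expR d
  - expR d * (a * (lu - ls - d) + (1 - a) * (lv - lt - d)) by ring.
by rewrite Ed mulr0 subr0 subr_ge0.
Qed.

Lemma gmean_concave a : 0 <= a <= 1 -> concave_mean (gmean a) (gmean1 a).
Proof.
move=> a01; have a01' : 0 <= 1 - a <= 1 by lra.
split.
- by move=> s t; rewrite /gmean !wgm_sym addrC.
- move=> s t s0 t0; rewrite /gmean /gmean1 (wgm_sym a t s) -(wgm_sym a s t).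
  by field; rewrite !gt_eqF.
- move=> s t u v s0 t0 u0 v0; rewrite /gmean /gmean1.
  have H1 := wgm_tangent a01 s0 t0 u0 v0.
  have H2 := wgm_tangent a01' s0 t0 u0 v0.
  rewrite subKr in H2; rewrite (wgm_sym a t s) -(wgm_sym a s t).
  have -> : u * ((a * wgm a s t + (1 - a) * wgm (1 - a) s t) / (2 * s)) +
    v * ((a * wgm (1 - a) s t + (1 - a) * wgm a s t) / (2 * t)) =
    (wgm a s t * (a * (u / s) + (1 - a) * (v / t)) +
     wgm (1 - a) s t * ((1 - a) * (u / s) + a * (v / t))) / 2.
    by field; rewrite !gt_eqF.
  by lra.
- move=> s t s0 t0; have /andP[a0 a1] := a01; apply: divr_ge0.
    by rewrite addr_ge0// mulr_ge0 ?wgm_ge0// subr_ge0.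
  by rewrite mulr_ge0// ltW.
- move=> s s0; rewrite /gmean !wgmE//.
  have -> : a * ln s + (1 - a) * ln s = ln s by ring.
  have -> : (1 - a) * ln s + (1 - (1 - a)) * ln s = ln s by ring.
  by rewrite lnK//; field.
Qed.

Lemma is_derive_gmean a (f g : R -> R) (df dg x : R) : 0 < f x -> 0 < g x ->
  is_derive x (1 : R) f df -> is_derive x (1 : R) g dg ->
  is_derive x (1 : R) (fun y => gmean a (f y) (g y))
    (gmean1 a (f x) (g x) * df + gmean1 a (g x) (f x) * dg).
Proof.
move=> f0 g0 Df Dg.
have P b (h : R -> R) dh : 0 < h x -> is_derive x (1 : R) h dh ->
    is_derive x (1 : R) (fun y => h y `^ b) (b * h x `^ b / h x * dh).
  move=> h0 Dh; apply: is_derive_eq (is_derive1_comp (is_derive1_powR b h0) Dh) _.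
  by rewrite powRB ?(gt_eqF h0) ?implybT// powRr1 ?ltW// mulrA.
have W b : is_derive x (1 : R) (fun y => wgm b (f y) (g y))
   (wgm b (f x) (g x) * (b / f x * df + (1 - b) / g x * dg)).
  apply: is_derive_eq (is_deriveM (P b _ _ f0 Df) (P (1 - b) _ _ g0 Dg)) _.
  by rewrite /GRing.scale/= /wgm; field; rewrite !gt_eqF.
have D := is_deriveZ 2^-1 (is_deriveD (W a) (W (1 - a))).
rewrite (_ : (fun y => _) = 2^-1 \*: ((fun y => wgm a (f y) (g y)) +
  (fun y => wgm (1 - a) (f y) (g y)))); last first.
  by apply/funext => y; rewrite /gmean mulrC.
apply: is_derive_eq D _; rewrite /GRing.scale/= /gmean1 (wgm_sym a (g x)) -(wgm_sym a (f x)).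
by field; rewrite !gt_eqF.
Qed.

End GeometricMean.

Lemma le_of_derive (R : realType) (F f : R -> R) (a b : R) : a <= b ->
  (forall x, a <= x <= b -> is_derive x (1 : R) F (f x)) ->
  (forall x, a <= x <= b -> 0 <= f x) -> F a <= F b.
Proof.
move=> ab DF f0.
apply: (@ger0_derive1_ndecr _ F a b _ _ _ a b) => //.
- move=> x; rewrite in_itv/= => /andP[ax xb].
  by case: (DF x _) => //; rewrite !ltW.
- move=> x; rewrite in_itv/= => /andP[ax xb].
  have xab : a <= x <= b by rewrite !ltW.
  by rewrite derive1E (@derive_val _ _ _ _ _ _ _ (DF x xab)) f0.
- apply: derivable_within_continuous => x; rewrite in_itv/= => xab.
  by case: (DF x xab).
Qed.

Lemma integral_derive (R : realType) (F f : R -> R) (a b : R) : a < b ->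
  (forall x, a <= x <= b -> is_derive x (1 : R) F (f x)) ->
  {within `[a, b], continuous f} ->
  (\int[lebesgue_measure]_(x in `[a, b]) (f x)%:E = (F b - F a)%:E)%E.
Proof.
move=> ab DF cf; rewrite EFinB; apply: continuous_FTC2 => //.
- have cF x : a <= x <= b -> {for x, continuous F}.
    by move=> /DF; exact: is_derive_continuous.
  split.
  + move=> x; rewrite in_itv/= => /andP[ax xb].
    by case: (DF x _) => //; rewrite !ltW.
  + by apply: cvg_at_right_filter; apply: cF; rewrite lexx ltW.
  + by apply: cvg_at_left_filter; apply: cF; rewrite lexx ltW.
- move=> x; rewrite in_itv/= => /andP[ax xb].
  have xab : a <= x <= b by rewrite !ltW.
  by rewrite derive1E (@derive_val _ _ _ _ _ _ _ (DF x xab)).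
Qed.

Section LogMean.
Variable R : realType.
Implicit Types a s t u v : R.

(** An antiderivative of [wgm a s t] in the exponent: the integrand is exponential in [a] with rate
    [ln s - ln t], and constant when [s = t]. *)
Definition wgm_prim s t a : R :=
  if s == t then s * a else wgm a s t / (ln s - ln t).

Lemma is_derive_wgm_prim s t a : 0 < s -> 0 < t ->
  is_derive a (1 : R) (wgm_prim s t) (wgm a s t).
Proof.
move=> s0 t0; have [st|st] := eqVneq s t.
  rewrite (_ : wgm_prim s t = s \*: id); last first.
    by apply/funext => b; rewrite /wgm_prim st eqxx.
  apply: is_derive_eq (is_deriveZ s (is_derive_id a (1 : R))) _.
  rewrite -st wgmE// /GRing.scale/= mulr1.
  have -> : a * ln s + (1 - a) * ln s = ln s by ring.
  by rewrite lnK.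
set d := ln s - ln t.
have d0 : d != 0.
  by rewrite subr_eq0; apply: contra st => /eqP/ln_inj -> //; rewrite posrE.
have E : wgm_prim s t = d^-1 \*: (expR \o (d \*: id + cst (ln t))).
  apply/funext => b; rewrite /wgm_prim (negPf st) -/d wgmE// /= mulrC.
  congr (_ * expR _).
  by transitivity (d * b + ln t) => //; rewrite /d; ring.
have D0 := is_deriveD (is_deriveZ d (is_derive_id a (1 : R)))
  (is_derive_cst (ln t) a 1).
have D1 := is_derive1_comp (is_derive_expR _) D0.
have D2 := is_deriveZ d^-1 D1.
rewrite E; apply: is_derive_eq D2 _.
rewrite wgmE// /GRing.scale/= mulr1 addr0 mulrCA mulVf// mulr1.
by congr expR; transitivity (d * a + ln t) => //; rewrite /d; ring.
Qed.

Lemma logmean_prim s t : 0 < s -> 0 < t ->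
  logmean s t = wgm_prim s t 1 - wgm_prim s t 0.
Proof.
move=> s0 t0; rewrite /logmean /Rintegral.
have H := @integral_derive R (wgm_prim s t) (fun a => wgm a s t) 0 1 ltr01.
rewrite (H _ _)// => [a _|]; first exact: is_derive_wgm_prim.
apply: continuous_subspaceT => a.
  rewrite (_ : (fun a => _) = expR \o ((ln s - ln t) \*: id + cst (ln t))).
    apply: continuous_comp; last exact: continuous_expR.
    apply: cvgD; last exact: cvg_cst.
    by apply: cvgZr; exact: cvg_id.
  apply/funext => b; rewrite wgmE//=; congr expR.
  by transitivity ((ln s - ln t) * b + ln t) => //; ring.
Qed.

Lemma logmean_posE s t : 0 < s -> 0 < t ->
  logmean s t = if s == t then s else (s - t) / (ln s - ln t).
Proof.
move=> s0 t0; rewrite logmean_prim// /wgm_prim; case: eqP => _.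
  by rewrite mulr1 mulr0 subr0.
rewrite /wgm subrr !powRr0 subr0 !powRr1 ?ltW// mulr1 mul1r.
by rewrite mulrBl.
Qed.

Lemma logmean0r s : logmean s 0 = 0.
Proof.
(* The integrands are compared on the open interval only: at [a = 1] the factor [0 ^ 0] equals 1. *)
rewrite /logmean /Rintegral (@eq_integral_itv_bounded _ _ _ (cst 0))//=.
  by rewrite integral0.
  refine (eq_measurable_fun (cst (0 : R)) _ (measurable_cst _)) => // a; rewrite inE/= in_itv/=.
  by move=> /andP[a0 a1]; rewrite [in RHS]powR0 ?mulr0// subr_eq0 gt_eqF.
by move=> a /andP[a0 a1]; rewrite powR0 ?mulr0// subr_eq0 gt_eqF.
Qed.

Lemma logmean0l t : logmean 0 t = 0.
Proof.
rewrite /logmean /Rintegral (@eq_integral_itv_bounded _ _ _ (cst 0))//=.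
  by rewrite integral0.
  refine (eq_measurable_fun (cst (0 : R)) _ (measurable_cst _)) => // a; rewrite inE/= in_itv/=.
  by move=> /andP[a0 a1]; rewrite [in RHS]powR0 ?mul0r// gt_eqF.
by move=> a /andP[a0 a1]; rewrite powR0 ?mul0r// gt_eqF.
Qed.

Lemma logmean_ge0 s t : 0 <= logmean s t.
Proof. by apply: Rintegral_ge0 => a _; exact: wgm_ge0. Qed.

Lemma logmean_sym s t : 0 <= s -> 0 <= t -> logmean s t = logmean t s.
Proof.
rewrite le_eqVlt => /predU1P[<- _|s0]; first by rewrite logmean0r logmean0l.
rewrite le_eqVlt => /predU1P[<-|t0]; first by rewrite logmean0r logmean0l.
rewrite !logmean_posE// (eq_sym t); case: eqP => [->//|_].
by rewrite -opprB -[ln s - ln t]opprB invrN mulrNN.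
Qed.

Lemma logmean_ln s t : 0 < s -> 0 < t ->
  logmean s t * (ln s - ln t) = s - t.
Proof.
move=> s0 t0; rewrite logmean_posE//.
case: eqP => [->|/eqP st]; first by rewrite !subrr mulr0.
by rewrite divfK// subr_eq0; apply: contra st => /eqP/ln_inj -> //.
Qed.

Definition gmean_prim s t a : R := (wgm_prim s t a + wgm_prim t s a) / 2.

Lemma is_derive_gmean_prim s t a : 0 < s -> 0 < t ->
  is_derive a (1 : R) (gmean_prim s t) (gmean a s t).
Proof.
move=> s0 t0; have D := is_deriveZ 2^-1 (is_deriveD
  (is_derive_wgm_prim a s0 t0) (is_derive_wgm_prim a t0 s0)).
rewrite (_ : gmean_prim s t = 2^-1 \*: (wgm_prim s t + wgm_prim t s)).
  by apply: is_derive_eq D _; rewrite /gmean wgm_sym [RHS]mulrC.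
by apply/funext => b; rewrite /gmean_prim mulrC.
Qed.

Lemma logmean_gmean_prim s t : 0 < s -> 0 < t ->
  logmean s t = gmean_prim s t 1 - gmean_prim s t 0.
Proof.
move=> s0 t0; rewrite /gmean_prim -mulrBl opprD addrACA -!logmean_prim//.
by rewrite (logmean_sym (ltW t0))// ?ltW//; field.
Qed.

(** Pointwise monotonicity of the geometric means is integrated over the exponent through their
    antiderivatives; vanishing arguments are treated apart, because the antiderivative uses
    logarithms. *)
Lemma logmean_le s t s' t' : 0 <= s <= s' -> 0 <= t <= t' ->
  logmean s t <= logmean s' t'.
Proof.
move=> /andP[s0 ss] /andP[t0 tt].
move: s0; rewrite le_eqVlt => /predU1P[s0|s0].
  by rewrite -s0 logmean0l logmean_ge0.
move: t0; rewrite le_eqVlt => /predU1P[t0|t0].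
  by rewrite -t0 logmean0r logmean_ge0.
have s'0 := lt_le_trans s0 ss; have t'0 := lt_le_trans t0 tt.
rewrite !logmean_prim// -subr_ge0.
have -> : forall a b c d : R, a - b - (c - d) = (a - c) - (b - d).
  by move=> a b c d; ring.
rewrite subr_ge0.
apply: (@le_of_derive _ (wgm_prim s' t' - wgm_prim s t)
  (fun a => wgm a s' t' - wgm a s t) 0 1) => // a /andP[a0 a1].
  by apply: is_deriveB; exact: is_derive_wgm_prim.
rewrite subr_ge0 /wgm; apply: ler_pM; rewrite ?powR_ge0//.
  by apply: ge0_ler_powR; rewrite ?nnegrE// ltW.
by apply: ge0_ler_powR; rewrite ?nnegrE ?subr_ge0// ltW.
Qed.

Lemma logmeanM k s t : 0 < k -> 0 < s -> 0 < t ->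
  logmean (k * s) (k * t) = k * logmean s t.
Proof.
move=> k0 s0 t0; rewrite !logmean_posE ?mulr_gt0// (inj_eq (mulfI (lt0r_neq0 k0))).
have [//|_] := eqVneq s t; rewrite !lnM ?posrE// -mulrBr -mulrA.
by congr (_ * (_ / _)); ring.
Qed.

Lemma logmean_diag s : 0 < s -> logmean s s = s.
Proof. by move=> s0; rewrite logmean_posE// eqxx. Qed.

Lemma logmean_ge_min m s t : 0 < m -> m <= s -> m <= t -> m <= logmean s t.
Proof.
move=> m0 ms mt; rewrite -[leLHS]logmean_diag//.
by apply: logmean_le; rewrite ltW//.
Qed.

(** The parameter integral is replaced by its closed form. The quotient of differences is positive,
    hence the exponential of a difference of logarithms of absolute values, a composition of
    measurable functions. *)
Lemma measurable_logmean d (T : measurableType d) (D : set T) (f g : T -> R) :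
  measurable D -> (forall x, D x -> 0 <= f x) -> (forall x, D x -> 0 <= g x) ->
  measurable_fun D f -> measurable_fun D g ->
  measurable_fun D (fun x => logmean (f x) (g x)).
Proof.
move=> mD f0 g0 mf mg.
have mif (b : T -> bool) (h k : T -> R) : measurable_fun D b ->
    measurable_fun D h -> measurable_fun D k ->
    measurable_fun D (fun x => if b x then h x else k x).
  move=> mb mh mk; apply: measurable_fun_if => //.
    by apply: measurable_funS mD _ mh; exact: subIsetl.
  by apply: measurable_funS mD _ mk; exact: subIsetl.
pose h x := if f x == 0 then 0 else if g x == 0 then 0 else
  if f x == g x then f x else
  expR (ln `|f x - g x| - ln `|ln (f x) - ln (g x)|).
refine (eq_measurable_fun h _ _) => [x /[1!inE] Dx|].
  rewrite /h; case: eqP => [->|/eqP fx]; first by rewrite logmean0l.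
  case: eqP => [->|/eqP gx]; first by rewrite logmean0r.
  have fx0 : 0 < f x by rewrite lt_neqAle eq_sym fx f0.
  have gx0 : 0 < g x by rewrite lt_neqAle eq_sym gx g0.
  have [->|fg] := eqVneq (f x) (g x); first by rewrite logmean_diag.
  have L := logmean_ln fx0 gx0.
  have l0 : ln (f x) - ln (g x) != 0.
    by apply/eqP => l0; move: L fg; rewrite l0 mulr0 -subr_eq0 => <-; rewrite eqxx.
  have m0 : 0 < logmean (f x) (g x).
    rewrite lt_neqAle logmean_ge0 andbT; apply/eqP => m0.
    by move: L fg; rewrite -m0 mul0r -subr_eq0 => <-; rewrite eqxx.
  rewrite -L normrM (gtr0_norm m0) lnM ?posrE ?normr_gt0// addrK lnK//.
apply: (mif); [exact: measurable_fun_eqr|exact: measurable_cst|].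
apply: (mif); [exact: measurable_fun_eqr|exact: measurable_cst|].
apply: (mif); [exact: measurable_fun_eqr|exact: mf|].
apply: measurableT_comp; first exact: measurable_expR.
have mlnn (k : T -> R) : measurable_fun D k -> measurable_fun D (fun x => ln `|k x|).
  move=> mk; apply: measurableT_comp; first exact: measurable_ln.
  by apply: measurableT_comp; first exact: normr_measurable.
have mln (k : T -> R) : measurable_fun D k -> measurable_fun D (fun x => ln (k x)).
  by move=> mk; apply: measurableT_comp => //; exact: measurable_ln.
by apply: measurable_funB; apply: mlnn; apply: measurable_funB => //; exact: mln.
Qed.

End LogMean.

(** * Gradient estimate *)

(** Each [(f x)^-1] is one of the summands in the denominator of the witness; the extra 1 keeps that
    denominator positive even when [X] is empty. *)
Lemma pos_lower_bound (R : realType) (X : finType) (f : X -> R) :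
  (forall x, 0 < f x) -> exists m, 0 < m /\ forall x, m <= f x.
Proof.
move=> f0; have S0 : 0 < 1 + \sum_x (f x)^-1.
  by rewrite ltr_pwDl// sumr_ge0// => x _; rewrite invr_ge0 ltW.
exists (1 + \sum_x (f x)^-1)^-1; split=> [|x]; first by rewrite invr_gt0.
rewrite -[leRHS]invrK lef_pV2 ?posrE ?invr_gt0// (bigD1 x)//= addrCA lerDl.
by rewrite addr_ge0// sumr_ge0// => y _; rewrite invr_ge0 ltW.
Qed.

Section GradientEstimate.
Variables (R : realType) (X : finType) (Q : X -> X -> R) (pi : X -> R).
Variable kappa : R.

Definition energy (th : R -> R -> R) (rho psi : X -> R) : R :=
  \sum_x \sum_y (psi x - psi y) ^+ 2 * th (rho x) (rho y) * Q x y * pi x.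

(** The derivative in [s] of the energy of [psi] flowed for time [t - s] at the density [rho] flowed
    for time [s]: the potential runs backward, whence the minus sign. *)
Definition denergy (th th1 : R -> R -> R) (rho psi : X -> R) : R :=
  \sum_x \sum_y
    ((psi x - psi y) ^+ 2 * (th1 (rho x) (rho y) * lap Q rho x
                           + th1 (rho y) (rho x) * lap Q rho y)
     - 2 * (psi x - psi y) * th (rho x) (rho y) * (lap Q psi x - lap Q psi y))
    * Q x y * pi x.

(** This is all that later arguments retain of the moves: from here on only the rates occur. *)
Definition bochner_inequality : Prop :=
  forall th th1 rho psi, concave_mean th th1 -> (forall x, 0 < rho x) ->
  2 * kappa * energy th rho psi <= denergy th th1 rho psi.

Hypothesis Q_ge0 : forall x y, 0 <= Q x y.
Hypothesis Q_irr : irreducible_rates Q.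
Hypothesis pi_gt0 : forall x, 0 < pi x.
Hypothesis Q_rev : reversible Q pi.
Hypothesis bochnerQ : bochner_inequality.

Let P := heat Q.

Lemma heat_pos_gt0 t rho x : 0 <= t -> (forall y, 0 < rho y) -> 0 < P t rho x.
Proof.
rewrite le_eqVlt => /predU1P[<-|t0] r0; first by rewrite /P heat0.
rewrite /P/heat (bigD1 x)//= ltr_pwDl//.
  by apply: mulr_gt0 => //; exact: heat_kernel_gt0.
by apply: sumr_ge0 => y _; apply: mulr_ge0; rewrite ?heat_kernel_ge0// ltW.
Qed.

Lemma energy_ge0 th rho psi : (forall x y, 0 <= th (rho x) (rho y)) ->
  0 <= energy th rho psi.
Proof.
move=> th0; apply: sumr_ge0 => x _; apply: sumr_ge0 => y _.
apply: mulr_ge0; last exact: ltW.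
by apply: mulr_ge0 => //; apply: mulr_ge0 => //; exact: sqr_ge0.
Qed.

Lemma energy_le th th' rho rho' psi :
  (forall x y, th (rho x) (rho y) <= th' (rho' x) (rho' y)) ->
  energy th rho psi <= energy th' rho' psi.
Proof.
move=> H; apply: ler_sum => x _; apply: ler_sum => y _.
apply: ler_wpM2r; first exact: ltW.
apply: ler_wpM2r => //.
by apply: ler_wpM2l; rewrite ?sqr_ge0.
Qed.

(** Bakry-Emery interpolation: [F] joins the two sides, and its derivative is the Bochner defect
    times a positive exponential. *)
Lemma gradient_gmean a t rho phi : 0 <= a <= 1 -> 0 <= t ->
  (forall x, 0 < rho x) ->
  energy (gmean a) rho (P t phi) <=
  expR (- (2 * kappa) * t) * energy (gmean a) (P t rho) phi.
Proof.
move=> a01 t0 r0.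
pose F s := expR (- (2 * kappa) * s) *
  energy (gmean a) (P s rho) (P (t - s) phi).
have -> : energy (gmean a) rho (P t phi) = F 0.
  rewrite /F mulr0 expR0 mul1r subr0.
  by rewrite (_ : P 0 rho = rho)//; apply/funext => x; rewrite /P heat0.
have -> : expR (- (2 * kappa) * t) * energy (gmean a) (P t rho) phi = F t.
  rewrite /F subrr.
  by rewrite (_ : P 0 phi = phi)//; apply/funext => x; rewrite /P heat0.
pose f s := expR (- (2 * kappa) * s) *
  (denergy (gmean a) (gmean1 a) (P s rho) (P (t - s) phi)
   - 2 * kappa * energy (gmean a) (P s rho) (P (t - s) phi)).
apply: (le_of_derive (f := f) t0) => s /andP[s0 st]; last first.
  rewrite mulr_ge0 ?expR_ge0// subr_ge0 bochnerQ//; first exact: gmean_concave.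
  by move=> x; exact: heat_pos_gt0.
have Drho x : is_derive s (1 : R) (fun s => P s rho x) (lap Q (P s rho) x).
  by rewrite (heat_lap Q_ge0 pi_gt0 Q_rev); exact: (is_derive_heat Q_ge0 pi_gt0 Q_rev).
have Dpsi x : is_derive s (1 : R) (fun s => P (t - s) phi x)
    (- lap Q (P (t - s) phi) x).
  have D := is_deriveB (is_derive_cst t s (1 : R)) (is_derive_id s (1 : R)).
  have D1 : is_derive ((cst t - id) s) (1 : R) (fun s => P s phi x)
      (P (t - s) (lap Q phi) x) by exact: (is_derive_heat Q_ge0 pi_gt0 Q_rev).
  apply: is_derive_eq (is_derive1_comp D1 D) _.
  by rewrite (heat_lap Q_ge0 pi_gt0 Q_rev) sub0r mulrN1.
have DE : is_derive s (1 : R)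
    (fun s => energy (gmean a) (P s rho) (P (t - s) phi))
    (denergy (gmean a) (gmean1 a) (P s rho) (P (t - s) phi)).
  apply: is_derive_fsum => x; apply: is_derive_fsum => y.
  have Dg := is_derive_gmean a (heat_pos_gt0 x s0 r0) (heat_pos_gt0 y s0 r0)
    (Drho x) (Drho y).
  pose w u := P (t - u) phi x - P (t - u) phi y.
  pose dw := - lap Q (P (t - s) phi) x - - lap Q (P (t - s) phi) y.
  have Dw : is_derive s (1 : R) w dw := is_deriveB (Dpsi x) (Dpsi y).
  have Dww : is_derive s (1 : R) (fun u => w u * w u) (w s * dw + w s * dw) :=
    is_deriveM Dw Dw.
  have D := is_deriveZ (Q x y * pi x) (is_deriveM Dww Dg).
  rewrite (_ : (fun _ => _) = (Q x y * pi x) \*: ((fun u => w u * w u) *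
    (fun s => gmean a (P s rho x) (P s rho y)))).
    by apply: is_derive_eq D _; rewrite /GRing.scale/= /w /dw; ring.
  apply/funext => u; by rewrite -mulrA mulrC expr2.
have Dexp : is_derive s (1 : R) (fun s => expR (- (2 * kappa) * s))
    (- (2 * kappa) * expR (- (2 * kappa) * s)).
  have E1 := is_deriveZ (- (2 * kappa)) (is_derive_id s (1 : R)).
  apply: is_derive_eq (is_derive1_comp (is_derive_expR _) E1) _.
  by rewrite /GRing.scale/= mulr1 mulrC.
apply: is_derive_eq (is_deriveM Dexp DE) _.
by rewrite /GRing.scale/= /f; ring.
Qed.

Lemma is_derive_energy_prim rho psi a : (forall x, 0 < rho x) ->
  is_derive a (1 : R) (fun b => energy (fun s t => gmean_prim s t b) rho psi)
    (energy (gmean a) rho psi).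
Proof.
move=> r0; apply: is_derive_fsum => x; apply: is_derive_fsum => y.
have D := is_deriveZ ((psi x - psi y) ^+ 2 * (Q x y * pi x))
  (is_derive_gmean_prim a (r0 x) (r0 y)).
rewrite (_ : (fun _ => _) = ((psi x - psi y) ^+ 2 * (Q x y * pi x)) \*:
  gmean_prim (rho x) (rho y)).
  by apply: is_derive_eq D _; rewrite /GRing.scale/=; ring.
by apply/funext => b; rewrite [RHS]mulrC [in RHS]mulrA [RHS]mulrA; ring.
Qed.

Lemma energy_logmeanE rho psi : (forall x, 0 < rho x) ->
  energy (@logmean R) rho psi =
  energy (fun s t => gmean_prim s t 1) rho psi -
  energy (fun s t => gmean_prim s t 0) rho psi.
Proof.
move=> r0; rewrite -sumrB; apply: eq_bigr => x _.
rewrite -sumrB; apply: eq_bigr => y _.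
by rewrite logmean_gmean_prim//; ring.
Qed.

(** The energy is linear in the mean, so the energy for [logmean] is the increment over [0, 1] of a
    primitive of [a -> energy (gmean a)]. The difference of the two sides is thus the increment of a
    function [H] with nonnegative derivative. *)
Lemma gradient_logmean t rho phi : 0 <= t ->
  (forall x, 0 < rho x) ->
  energy (@logmean R) rho (P t phi) <=
  expR (- (2 * kappa) * t) * energy (@logmean R) (P t rho) phi.
Proof.
move=> t0 r0; have Pr0 x : 0 < P t rho x by exact: heat_pos_gt0.
rewrite !energy_logmeanE// -subr_ge0; set E := expR _.
pose e b r f := energy (fun s t => gmean_prim s t b) r f.
pose H b := E * e b (P t rho) phi - e b rho (P t phi).
have -> : forall a b c d : R, E * (a - b) - (c - d) = (E * a - c) - (E * b - d).
  by move=> *; ring.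
rewrite subr_ge0 -/(H 0) -/(H 1).
pose h a := E * energy (gmean a) (P t rho) phi - energy (gmean a) rho (P t phi).
apply: (le_of_derive (f := h) ler01).
  move=> a _; apply: is_deriveB; last exact: is_derive_energy_prim.
  exact: is_deriveZ (is_derive_energy_prim _ _ Pr0).
by move=> a a01; rewrite subr_ge0; exact: gradient_gmean.
Qed.

(** Vanishing densities are reached by adding a constant [d] to [rho]. The semigroup preserves
    constants, and the heated density is bounded below by [m], so that adding [d] to it costs at
    most the factor [1 + d / m], which homogeneity of the mean takes out of the energy. *)
Lemma gradient_estimate t rho phi : 0 <= t -> density pi rho ->
  energy (@logmean R) rho (P t phi) <=
  expR (- (2 * kappa) * t) * energy (@logmean R) (P t rho) phi.
Proof.
rewrite le_eqVlt => /predU1P[<- _|t0 rd].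
  have P0 f : P 0 f = f by apply/funext => x; exact: heat0.
  by rewrite mulr0 expR0 mul1r !P0.
have [r0 _] := rd.
have Pr0 x : 0 < P t rho x by exact: (heat_gt0 Q_ge0 Q_irr x t0 rd).
have [m [m0 mP]] := pos_lower_bound Pr0.
set B := _ * _.
have B0 : 0 <= B.
  by rewrite mulr_ge0 ?expR_ge0 ?energy_ge0// => x y; exact: logmean_ge0.
apply/ler_addgt0Pr => e e0.
(* Chosen so that [B * (d / m) = e * (B / (B + 1)) <= e]; adding 1 covers [B = 0]. *)
pose d := e * m / (B + 1).
have B1 : 0 < B + 1 by rewrite ltr_wpDl.
have d0 : 0 < d by rewrite divr_gt0 ?mulr_gt0.
pose rd' x := rho x + d.
have Prd x : P t rd' x = P t rho x + d.
  rewrite /P /heat /rd'; under eq_bigr do rewrite mulrDr.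
  by rewrite big_split/= -mulr_suml (sum_heat_kernel Q_ge0 pi_gt0 Q_rev) mul1r.
apply: (@le_trans _ _ (energy (@logmean R) rd' (P t phi))).
  apply: energy_le => x y; by apply: logmean_le; apply/andP; split; rewrite ?r0// /rd' lerDl ltW.
apply: le_trans (gradient_logmean _ (ltW t0) _) _.
  by move=> x; rewrite ltr_wpDl.
have -> : B + e = expR (- (2 * kappa) * t) * energy (@logmean R) (P t rho) phi
   + e by [].
apply: (@le_trans _ _ (B * (1 + d / m))); last first.
  rewrite mulrDr mulr1 lerD2l.
  have -> : B * (d / m) = e * (B / (B + 1)).
    by rewrite /d; field; rewrite !gt_eqF.
  by rewrite ger_pMr// ler_pdivrMr// mul1r lerDl.
rewrite /B -mulrA; apply: ler_wpM2l; first exact: expR_ge0.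
have dm0 : 0 < 1 + d / m by apply: addr_gt0 => //; exact: divr_gt0.
have H z : 0 <= P t rd' z <= (1 + d / m) * P t rho z.
  rewrite Prd addr_ge0 ?(ltW d0) ?(ltW (Pr0 _))//= mulrDl mul1r lerD2l.
  by rewrite mulrAC ler_pdivlMr// ler_wpM2l// ltW.
rewrite [leRHS]mulrC /energy mulr_sumr; apply: ler_sum => x _.
rewrite mulr_sumr; apply: ler_sum => y _.
have := sqr_ge0 (phi x - phi y); move: (_ ^+ 2) => w w0; rewrite !mulrA.
apply: ler_wpM2r; first exact: ltW.
apply: ler_wpM2r; first exact: Q_ge0.
rewrite [leRHS]mulrAC [leRHS]mulrC; apply: ler_wpM2l; first exact: w0.
by rewrite -logmeanM//; apply: logmean_le.
Qed.

End GradientEstimate.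

(** * Measurability of sums, products, inverses, determinants and adjugates *)

Lemma measurable_fsum d (T : measurableType d) (R : realType) (D : set T)
    (I : Type) (r : seq I) (P : pred I) (f : I -> T -> R) :
  (forall i, measurable_fun D (f i)) ->
  measurable_fun D (fun t => \sum_(i <- r | P i) f i t).
Proof.
move=> mf; elim: r => [|i r IH].
  by under eq_fun do rewrite big_nil; exact: measurable_cst.
under eq_fun do rewrite big_cons; case: (P i) => //.
exact: measurable_funD.
Qed.

Lemma measurable_fprod d (T : measurableType d) (R : realType) (D : set T)
    (I : Type) (r : seq I) (P : pred I) (f : I -> T -> R) :
  (forall i, measurable_fun D (f i)) ->
  measurable_fun D (fun t => \prod_(i <- r | P i) f i t).
Proof.
move=> mf; elim: r => [|i r IH].
  by under eq_fun do rewrite big_nil; exact: measurable_cst.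
under eq_fun do rewrite big_cons; case: (P i) => //.
exact: measurable_funM.
Qed.

Lemma measurable_fun_inv d (T : measurableType d) (R : realType) (D : set T)
    (f : T -> R) : measurable_fun D f -> measurable_fun D (fun t => (f t)^-1).
Proof.
move=> mf.
(* The inverse is [f / |f|^2], with the square written as an exponential; where [f] vanishes both
   sides are 0 since [0^-1 = 0]. *)
rewrite (_ : (fun t => _) = (fun t => f t * expR (- (ln `|f t| * 2)))).
  apply: measurable_funM => //.
  apply: measurableT_comp; first exact: measurable_expR.
  apply: measurableT_comp; first exact: oppr_measurable.
  apply: measurable_funM; last exact: measurable_cst.
  apply: measurableT_comp; first exact: measurable_ln.
  by apply: measurableT_comp => //; exact: normr_measurable.
apply/funext => t; have [->|ft] := eqVneq (f t) 0; first by rewrite invr0 mul0r.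
rewrite expRN (expRM_natr 2) lnK ?posrE ?normr_gt0// real_normK ?num_real//.
by rewrite expr2 invfM mulrA divff// mul1r.
Qed.

Lemma measurable_det d (T : measurableType d) (R : realType) (D : set T) n
    (A : T -> 'M[R]_n) : (forall i j, measurable_fun D (fun t => A t i j)) ->
  measurable_fun D (fun t => \det (A t)).
Proof.
move=> mA; rewrite /determinant; apply: measurable_fsum => s.
apply: measurable_funM; first exact: measurable_cst.
exact: measurable_fprod.
Qed.

Lemma measurable_adj d (T : measurableType d) (R : realType) (D : set T) n
    (A : T -> 'M[R]_n) i j : (forall i j, measurable_fun D (fun t => A t i j)) ->
  measurable_fun D (fun t => (\adj (A t)) i j).
Proof.
move=> mA; under eq_fun do rewrite mxE /cofactor.
apply: measurable_funM; first exact: measurable_cst.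
apply: measurable_det => k l.
by under eq_fun do rewrite !mxE; exact: mA.
Qed.

(** * Potentials and heated curves *)

Section Potential.
Variables (R : realType) (X : finType) (Q : X -> X -> R) (pi : X -> R).
Variable kappa : R.
Hypothesis Q_ge0 : forall x y, 0 <= Q x y.
Hypothesis Q_irr : irreducible_rates Q.
Hypothesis pi_gt0 : forall x, 0 < pi x.
Hypothesis pi_sum1 : \sum_x pi x = 1.
Hypothesis Q_rev : reversible Q pi.

Definition flux (rho psi : X -> R) (x : X) : R :=
  \sum_y (psi y - psi x) * logmean (rho x) (rho y) * Q x y.

Definition bilinear (rho f g : X -> R) : R := \sum_x \sum_y
  logmean (rho x) (rho y) * Q x y * pi x * ((f x - f y) * (g x - g y)).

Lemma bilinear_energy rho f : bilinear rho f f = energy Q pi (@logmean R) rho f.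
Proof. by apply: eq_bigr => x _; apply: eq_bigr => y _; ring. Qed.

Lemma flux_by_parts rho f g : (forall x, 0 <= rho x) ->
  \sum_x pi x * (f x * flux rho g x) = - 2^-1 * bilinear rho f g.
Proof.
move=> r0.
rewrite -(sum_by_parts (w := fun x y => logmean (rho x) (rho y) * Q x y * pi x)).
  apply: eq_bigr => x _; rewrite mulrCA; congr (_ * _).
  by rewrite /flux mulr_sumr; apply: eq_bigr => y _; ring.
by move=> x y; rewrite -!mulrA Q_rev (logmean_sym (r0 x)).
Qed.

Lemma sum_flux rho g : (forall x, 0 <= rho x) ->
  \sum_x pi x * flux rho g x = 0.
Proof.
move=> r0; have := flux_by_parts (fun=> 1) g r0.
under eq_bigr do rewrite mul1r.
move=> ->; rewrite /bilinear big1 ?mulr0// => x _.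
by rewrite big1// => y _; rewrite subrr mul0r mulr0.
Qed.

(** This is where the logarithmic mean matches the entropy: the mean times the difference of
    logarithms is the difference of densities, so the potential [- ln rho] drives the heat flow. *)
Lemma flux_ln rho x : (forall x, 0 < rho x) ->
  flux rho (fun x => ln (rho x)) x = lap Q rho x.
Proof.
move=> r0; apply: eq_bigr => y _; rewrite -opprB mulNr [_ * logmean _ _]mulrC.
by rewrite logmean_ln// opprB mulrC.
Qed.

(* The rank one term [pi y] makes the Laplacian with conductances [logmean * Q]
   invertible: it only fixes the additive constant of the potential. *)
Definition potential_mx (rho : X -> R) : 'M[R]_#|X| :=
  \matrix_(i, j) ((if i == j then \sum_y logmean (rho (enum_val i)) (rho y) *
                                         Q (enum_val i) y else 0)
    - logmean (rho (enum_val i)) (rho (enum_val j)) *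
      Q (enum_val i) (enum_val j) + pi (enum_val j)).

(** Cramer's rule instead of a chosen solution: measurability in time is then inherited from the
    matrix entries. *)
Definition potential (rho V : X -> R) (x : X) : R :=
  (\det (potential_mx rho))^-1 *
  \sum_j (\adj (potential_mx rho)) (enum_rank x) j * V (enum_val j).

Lemma potential_mxE rho (psi : X -> R) i :
  \sum_j potential_mx rho i j * psi (enum_val j) =
  - flux rho psi (enum_val i) + \sum_y pi y * psi y.
Proof.
set x := enum_val i.
rewrite (reindex enum_rank) /=; last first.
  by apply: onW_bij; exists enum_val; [exact: enum_rankK|exact: enum_valK].
under eq_bigr do rewrite mxE enum_rankK !mulrDl -/x.
rewrite !big_split/=; congr (_ + _).
rewrite (bigD1 x)//= /x enum_valK eqxx [X in _ + X + _ = _]big1 ?addr0; last first.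
  move=> y yx; rewrite ifN ?mul0r//; apply: contra yx => /eqP ->.
  by rewrite enum_rankK.
by rewrite mulr_suml -big_split -sumrN; apply: eq_bigr => y _ /=; ring.
Qed.

(** Averaging the kernel equation against [pi] removes the flux, so a kernel vector has mean zero
    and zero flux. Its Dirichlet energy then vanishes, irreducibility makes it constant, and the
    mean makes it zero. *)
Lemma potential_mx_unit rho : (forall x, 0 < rho x) ->
  \det (potential_mx rho) != 0.
Proof.
move=> r0; have r0' x : 0 <= rho x by exact: ltW.
rewrite -det_tr; apply/det0P => -[v v0].
move=> vM; pose psi x := v 0 (enum_rank x).
have Mpsi x : - flux rho psi x + \sum_y pi y * psi y = 0.
  rewrite -[x]enum_rankK -potential_mxE.
  move/matrixP : vM => /(_ 0 (enum_rank x)); rewrite mxE [RHS]mxE => vM0.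
  rewrite -[RHS]vM0; apply: eq_bigr => j _.
  by rewrite mulrC /psi enum_valK [_^T _ _]mxE.
have S0 : \sum_y pi y * psi y = 0.
  transitivity (\sum_x pi x * (- flux rho psi x + \sum_y pi y * psi y)).
    under [RHS]eq_bigr do rewrite mulrDr mulrN.
    by rewrite big_split/= sumrN sum_flux// oppr0 add0r -mulr_suml pi_sum1 mul1r.
  by rewrite big1// => x _; rewrite Mpsi mulr0.
have F0 x : flux rho psi x = 0.
  by apply/eqP; rewrite -oppr_eq0; have := Mpsi x; rewrite S0 addr0 => ->.
have E0 : bilinear rho psi psi = 0.
  have := flux_by_parts psi psi r0'; rewrite big1 => [|x _]; first by lra.
  by rewrite F0 !mulr0.
have cst x y : psi x = psi y.
  have /connectP[p] := Q_irr x y.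
  elim: p x => [|z p IH] x /= => [_ ->//|/andP[Qxz pz] yE].
  rewrite -(IH z pz yE); apply/eqP; rewrite -subr_eq0 -sqrf_eq0 expr2.
  move/eqP: E0; rewrite psumr_eq0; last first.
    move=> u _; apply: sumr_ge0 => w _; rewrite -expr2 mulr_ge0 ?sqr_ge0//.
    by rewrite !mulr_ge0 ?logmean_ge0// ltW.
  move=> /allP/(_ x (mem_index_enum _)) /=; rewrite psumr_eq0; last first.
    move=> w _; rewrite -expr2 mulr_ge0 ?sqr_ge0//.
    by rewrite !mulr_ge0 ?logmean_ge0// ltW.
  move=> /allP/(_ z (mem_index_enum _)) /= H; move: H.
  rewrite [in X in X -> _]mulf_eq0 => /orP[|//]; rewrite gt_eqF// !mulr_gt0//.
  have m0 : 0 < Num.min (rho x) (rho z) by rewrite lt_min !r0.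
  by apply: lt_le_trans m0 _; apply: logmean_ge_min; rewrite ?lt_min ?r0// ge_min lexx ?orbT.
have psi0 x : psi x = 0.
  rewrite -S0; under eq_bigr do rewrite (cst _ x).
  by rewrite -mulr_suml pi_sum1 mul1r.
case/negP: v0; apply/eqP/rowP => j; rewrite mxE -[RHS](psi0 (enum_val j)).
by rewrite /psi enum_valK.
Qed.

Lemma potentialP rho V x : (forall x, 0 < rho x) -> \sum_x pi x * V x = 0 ->
  V x + flux rho (potential rho V) x = 0.
Proof.
move=> r0 V0; set psi := potential rho V.
have r0' y : 0 <= rho y by exact: ltW.
have E y : - flux rho psi y + \sum_z pi z * psi z = V y.
  set M := potential_mx rho; set i := enum_rank y.
  pose Vc : 'cV[R]_#|X| := \col_j V (enum_val j).
  have H : \sum_k M i k * (\sum_j (\adj M) k j * V (enum_val j)) = \det M * V y.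
    have /matrixP/(_ i 0) := congr1 (fun B => B *m Vc) (mul_mx_adj M).
    rewrite -mulmxA mul_scalar_mx [LHS]mxE [RHS]mxE [Vc i 0]mxE enum_rankK => <-.
    apply: eq_bigr => k _; congr (_ * _); rewrite [RHS]mxE.
    by apply: eq_bigr => j _; rewrite [Vc _ _]mxE.
  rewrite -[y]enum_rankK -potential_mxE enum_rankK -/i -/M.
  apply: (mulfI (potential_mx_unit r0)); rewrite -H mulr_sumr.
  apply: eq_bigr => j _; rewrite mulrCA; congr (_ * _).
  by rewrite /psi /potential enum_valK mulrA divff ?mul1r ?potential_mx_unit.
(* Averaging against [pi] shows that the potential has the same mean as [V], namely 0, so the rank
   one term drops out of the equation. *)
have S0 : \sum_z pi z * psi z = 0.
  transitivity (\sum_y pi y * (- flux rho psi y + \sum_z pi z * psi z)).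
    under [RHS]eq_bigr do rewrite mulrDr mulrN.
    by rewrite big_split/= sumrN sum_flux// oppr0 add0r -mulr_suml pi_sum1 mul1r.
  by rewrite -[RHS]V0; apply: eq_bigr => y _; rewrite E.
by rewrite -E S0 addr0 addNr.
Qed.

Lemma measurable_potential d (T : measurableType d) (D : set T)
    (rho V : T -> X -> R) x : measurable D ->
  (forall t y, D t -> 0 <= rho t y) ->
  (forall y, measurable_fun D (rho^~ y)) ->
  (forall y, measurable_fun D (V^~ y)) ->
  measurable_fun D (fun t => potential (rho t) (V t) x).
Proof.
move=> mD r0 mr mV.
have mlm y z : measurable_fun D (fun t => logmean (rho t y) (rho t z)).
  by apply: measurable_logmean => // t; exact: r0.
have mM i j : measurable_fun D (fun t => potential_mx (rho t) i j).
  under eq_fun do rewrite mxE.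
  apply: measurable_funD; last exact: measurable_cst.
  apply: measurable_funB; last by apply: measurable_funM; last exact: measurable_cst.
  case: eqP => _; last exact: measurable_cst.
  by apply: measurable_fsum => y; apply: measurable_funM; last exact: measurable_cst.
apply: measurable_funM; first by apply: measurable_fun_inv; exact: measurable_det.
by apply: measurable_fsum => j; apply: measurable_funM => //; exact: measurable_adj.
Qed.

Lemma bilinear_young rho f g k : 0 < k -> 2 * bilinear rho f g <=
  bilinear rho f f / k + k * bilinear rho g g.
Proof.
move=> k0; rewrite -subr_ge0 /bilinear mulr_suml !mulr_sumr -big_split -sumrB.
apply: sumr_ge0 => x _; rewrite mulr_suml !mulr_sumr -big_split -sumrB.
apply: sumr_ge0 => y _ /=; set w := _ * pi x.
have w0 : 0 <= w by rewrite !mulr_ge0 ?logmean_ge0// ltW.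
set a := f x - f y; set c := g x - g y.
have -> : w * (a * a) / k + k * (w * (c * c)) - 2 * (w * (a * c)) =
  w * k^-1 * (a - k * c) ^+ 2 by field; rewrite gt_eqF.
by apply: mulr_ge0; rewrite ?sqr_ge0// mulr_ge0// invr_ge0 ltW.
Qed.

Hypothesis bochnerQ : bochner_inequality Q pi kappa.

Variables (rho psi : X -> R) (tau b : R).
Hypothesis rho_density : density pi rho.
Hypothesis tau_gt0 : 0 < tau.

Let rhoh := heat Q tau rho.
Let V x := - flux rho psi x.

(** The time derivative of [heat Q (tau t) (rho t)] when [rho] moves with velocity [V] and the heat
    time [tau] has slope [b]. *)
Definition heated_velocity (x : X) : R := heat Q tau V x + b * lap Q rhoh x.

(** The first term drives the transported velocity [heat Q tau V]; the logarithm drives the heating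
    part, by [flux_ln]. *)
Definition heated_potential (x : X) : R :=
  potential rhoh (heat Q tau V) x - b * ln (rhoh x).

Let rhoh_gt0 x : 0 < rhoh x.
Proof. exact: (heat_gt0 Q_ge0 Q_irr x tau_gt0 rho_density). Qed.

Let rhoh_ge0 x : 0 <= rhoh x. Proof. exact: ltW. Qed.

Let chi := potential rhoh (heat Q tau V).

Let chiP x : heat Q tau V x + flux rhoh chi x = 0.
Proof.
apply: potentialP => //; rewrite (sum_heat Q_ge0 pi_gt0 Q_rev).
under eq_bigr do rewrite mulrN.
by rewrite sumrN sum_flux ?oppr0//; case: rho_density.
Qed.

Lemma heated_continuity x : heated_velocity x + flux rhoh heated_potential x = 0.
Proof.
have -> : flux rhoh heated_potential x =
    flux rhoh chi x - b * flux rhoh (fun x => ln (rhoh x)) x.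
  rewrite /flux mulr_sumr -sumrB; apply: eq_bigr => y _.
  by rewrite /heated_potential -/chi; ring.
rewrite flux_ln// -[RHS](chiP x) /heated_velocity; ring.
Qed.

(* [sum_x pi x * heated_velocity x * ln (rhoh x)] is the time derivative of the
   entropy along the heated curve. *)
Lemma heated_energy :
  energy Q pi (@logmean R) rhoh heated_potential
  + 4 * b * \sum_x pi x * (ln (rhoh x) * heated_velocity x)
  <= expR (- (2 * kappa) * tau) * energy Q pi (@logmean R) rho psi.
Proof.
set k := expR _; have k0 : 0 < k by exact: expR_gt0.
pose l x := ln (rhoh x).
have -> : \sum_x pi x * (ln (rhoh x) * heated_velocity x) =
    2^-1 * bilinear rhoh l heated_potential.
  have := flux_by_parts l heated_potential rhoh_ge0.
  rewrite mulNr => /eqP; rewrite -eqr_oppLR => /eqP <-; rewrite -sumrN.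
  apply: eq_bigr => x _; rewrite -[heated_velocity x]addr0.
  by rewrite -[X in _ + X](subrr (flux rhoh heated_potential x)) addrA
     heated_continuity /l; ring.
have r0 x : 0 <= rho x by case: rho_density.
(* Duality: both fluxes are tested against [chi], and self-adjointness of the semigroup moves it
   from the velocity onto the potential. *)
have chiE : bilinear rhoh chi chi = bilinear rho (heat Q tau chi) psi.
  have H1 := flux_by_parts chi chi rhoh_ge0.
  have H2 := flux_by_parts (heat Q tau chi) psi r0.
  suff E : \sum_x pi x * (chi x * flux rhoh chi x) =
      \sum_x pi x * (heat Q tau chi x * flux rho psi x).
    have h0 : - 2^-1 != 0 :> R by rewrite oppr_eq0 invr_eq0 pnatr_eq0.
    by apply: (mulfI h0); rewrite -H1 -H2.
  transitivity (- \sum_x pi x * (chi x * heat Q tau V x)).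
    rewrite -sumrN; apply: eq_bigr => x _.
    rewrite -mulrN -mulrN; congr (_ * (_ * _)).
    by apply/eqP; rewrite -addr_eq0 addrC; apply/eqP; exact: chiP.
  rewrite (heat_rev Q_ge0 pi_gt0 Q_rev) -sumrN; apply: eq_bigr => x _.
  by rewrite /V; ring.
(* Young's inequality with weight [k] bounds [2 |chi|^2] by [|P chi|^2 / k + k |psi|^2], and the
   gradient estimate absorbs the first term into one [|chi|^2]. *)
have chi_le : bilinear rhoh chi chi <= k * bilinear rho psi psi.
  have := bilinear_young rho (heat Q tau chi) psi k0.
  have := gradient_estimate Q_ge0 Q_irr pi_gt0 Q_rev bochnerQ chi
    (ltW tau_gt0) rho_density.
  rewrite -!bilinear_energy -/k -/rhoh -chiE => H.
  have : bilinear rho (heat Q tau chi) (heat Q tau chi) / k <=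
    bilinear rhoh chi chi by rewrite ler_pdivrMr// mulrC.
  lra.
rewrite -!bilinear_energy; apply: le_trans chi_le.
have l2 : 0 <= b ^+ 2 * bilinear rhoh l l.
  rewrite mulr_ge0 ?sqr_ge0// bilinear_energy energy_ge0// => x y.
  exact: logmean_ge0.
(* The square is expanded around [chi = heated_potential + b l]; the term [b^2 |l|^2] has a
   favourable sign, and the cross term is the entropy derivative. *)
suff -> : bilinear rhoh heated_potential heated_potential =
  bilinear rhoh chi chi - b ^+ 2 * bilinear rhoh l l
  - 2 * b * bilinear rhoh l heated_potential by lra.
rewrite /bilinear !mulr_sumr -!sumrB; apply: eq_bigr => x _.
rewrite !mulr_sumr -!sumrB; apply: eq_bigr => y _.
by rewrite /heated_potential -/chi -/(l x) -/(l y); ring.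
Qed.

End Potential.

(** * Integration of a differential inequality *)

Section IntegralInequality.
Variable R : realType.
Notation mu := (@lebesgue_measure R).
Implicit Types (u v : R) (f E G dG : R -> R).

(** The energies may have infinite integrals and [dG] has no sign. Adding a constant [M] with
    [dG + M >= 0] makes every integrand nonnegative, so integrals add; the finite contribution of
    [M] is cancelled afterwards. *)
Lemma integral_le_compact u v f E G dG : u < v ->
  measurable_fun `[u, v] f -> measurable_fun `[u, v] E ->
  (forall t, t \in `[u, v] -> 0 <= f t) ->
  (forall t, t \in `[u, v] -> 0 <= E t) ->
  (forall t, t \in `[u, v] -> is_derive t (1 : R) G (dG t)) ->
  {within `[u, v], continuous dG} ->
  {ae mu, forall t, t \in `[u, v] -> f t + dG t <= E t} ->
  (\int[mu]_(t in `[u, v]) (f t)%:E + (G v - G u)%:E <=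
   \int[mu]_(t in `[u, v]) (E t)%:E)%E.
Proof.
move=> uv mf mE f0 E0 DG cdG H.
have [c0 _ c0P] := EVT_min (ltW uv) cdG.
pose M := `|dG c0|.
have M0 : 0 <= M by exact: normr_ge0.
have dGM t : t \in `[u, v] -> 0 <= dG t + M.
  move=> /c0P h; have : - M <= dG c0 by rewrite /M lerNl -normrN ler_norm.
  by lra.
have itvE t : (u <= t <= v) = (t \in `[u, v]) by rewrite in_itv.
have cM : {within `[u, v], continuous (fun=> M)}.
  by apply: continuous_subspaceT; exact: cst_continuous.
have DM t : is_derive t (1 : R) (fun s => M * s) M.
  apply: is_derive_eq (is_deriveZ M (is_derive_id t (1 : R))) _.
  by rewrite /GRing.scale/= mulr1.
have IM := integral_derive uv (fun t _ => DM t) cM.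
have cdGM : {within `[u, v], continuous (fun t => dG t + M)}.
  by move=> x; apply: cvgD; [exact: cdG|exact: cM].
have IG : (\int[mu]_(t in `[u, v]) (dG t + M)%:E =
    (G v - G u)%:E + (M * v - M * u)%:E)%E.
  have D t : u <= t <= v -> is_derive t (1 : R) (fun s => G s + M * s) (dG t + M).
    by rewrite itvE => /DG DGt; exact: is_deriveD.
  rewrite (integral_derive uv D cdGM) -EFinD; congr EFin; ring.
have mI : measurable (`[u, v] : set R) by exact: measurable_itv.
have mc (k : R -> R) : {within `[u, v], continuous k} -> measurable_fun (`[u, v] : set R) k.
  by move=> ck; exact: subspace_continuous_measurable_fun.
rewrite -(leeD2rE (x := (M * v - M * u)%:E))// -addeA -IG -IM.
rewrite -ge0_integralD//=.
- rewrite -ge0_integralD//=.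
  + apply: ae_ge0_le_integral => //.
    * by move=> t tI; rewrite -EFinD lee_fin addr_ge0 ?f0 ?dGM.
    * apply: emeasurable_funD; apply/measurable_EFinP => //; exact: mc.
    * by move=> t tI; rewrite -EFinD lee_fin addr_ge0 ?E0.
    * apply: emeasurable_funD; apply/measurable_EFinP => //; exact: mc.
    * have FF := ae_filter_ringOfSetsType mu.
      apply: (@filterS _ _ FF _ _ _ H) => t h tI; rewrite -!EFinD lee_fin addrA lerD2r.
      exact: h.
  + by apply/measurable_EFinP.
- by apply/measurable_EFinP.
- by apply/measurable_EFinP; exact: mc.
Qed.

(** [G] will be the entropy, whose derivative may blow up at the ends of a piece, where the heat
    time can vanish. The interval is exhausted from inside: monotone convergence handles [f] and
    continuity handles [G]. If [E] has infinite integral, the bound is immediate. *)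
Lemma integral_le_open u v f E G dG : u < v ->
  measurable_fun `[u, v] f -> measurable_fun `[u, v] E ->
  (forall t, t \in `[u, v] -> 0 <= f t) ->
  (forall t, t \in `[u, v] -> 0 <= E t) ->
  continuous G ->
  (forall t, t \in `]u, v[ -> is_derive t (1 : R) G (dG t)) ->
  (forall t, t \in `]u, v[ -> {for t, continuous dG}) ->
  {ae mu, forall t, t \in `]u, v[ -> f t + dG t <= E t} ->
  (\int[mu]_(t in `[u, v]) (f t)%:E + (G v - G u)%:E <=
   \int[mu]_(t in `[u, v]) (E t)%:E)%E.
Proof.
move=> uv mf mE f0 E0 cG DG cdG H.
have IE0 : (0 <= \int[mu]_(t in `[u, v]) (E t)%:E)%E.
  by apply: integral_ge0 => t tI; rewrite lee_fin E0.
case IE : (\int[mu]_(t in `[u, v]) (E t)%:E)%E IE0 => [C| |] // C0; last first.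
  by rewrite leey.
pose a n := u + n.+1%:R^-1; pose b n := v - n.+1%:R^-1.
pose F n : set R := [set` `[a n, b n]].
have Fsub n : F n `<=` [set` `]u, v[].
  move=> t; rewrite /F /= !in_itv/= => /andP[ta tb]; apply/andP; split.
    by apply: lt_le_trans ta; rewrite ltrDl invr_gt0.
  by apply: le_lt_trans tb _; rewrite ltrBlDr ltrDl invr_gt0.
have oc : [set` `]u, v[] `<=` [set` `[u, v]].
  by move=> t /=; rewrite !in_itv/= => /andP[/ltW -> /ltW ->].
have Fsubc n : F n `<=` [set` `[u, v]] by apply: subset_trans (Fsub n) oc.
have FU : \bigcup_n F n = [set` `]u, v[].
  apply/seteqP; split; first by move=> t [n _]; exact: Fsub.
  move=> t /= tI; have /andP[tu tv] : (u < t < v)%O by move: tI; rewrite in_itv.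
  have e0 : 0 < Num.min (t - u) (v - t) by rewrite lt_min !subr_gt0 tu.
  have [n _ /(_ _ (leqnn n))] := near_infty_natSinv_lt (PosNum e0).
  rewrite /= lt_min => /andP[n1 n2]; exists n => //.
  rewrite /F /= in_itv/= /a /b -lerBrDl (ltW n1)/= lerBrDr -lerBrDl.
  exact: ltW.
have cvg_inv : (n.+1%:R^-1 : R) @[n --> \oo] --> 0.
  exact: (@cvg_harmonic R).
have cvga : (G \o a) n @[n --> \oo] --> G u.
  apply: continuous_cvg; first exact: cG.
  by rewrite -[X in _ --> X]addr0; apply: cvgD => //; exact: cvg_cst.
have cvgb : (G \o b) n @[n --> \oo] --> G v.
  apply: continuous_cvg; first exact: cG.
  by rewrite -[X in _ --> X]subr0; apply: cvgB => //; exact: cvg_cst.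
have cvgI : (\int[mu]_(t in F n) (f t)%:E)%E @[n --> \oo] -->
    (\int[mu]_(t in `]u, v[) (f t)%:E)%E.
  rewrite -FU; apply: ge0_nondecreasing_set_cvg_integral.
  - move=> m n mn; apply/subsetPset => t; rewrite /F /= !in_itv/= /a /b.
    have : (n.+1%:R^-1 : R) <= m.+1%:R^-1.
      by rewrite lef_pV2 ?posrE// ler_nat ltnS.
    move: n.+1%:R^-1 m.+1%:R^-1 => p r h /andP[h1 h2].
    by apply/andP; split; lra.
  - by move=> n; exact: measurable_itv.
  - move=> n; apply/measurable_EFinP.
    by apply: measurable_funS mf => //; exact: Fsubc.
  - by move=> n t /Fsubc tI; rewrite lee_fin f0.
have cvgG : ((C - (G (b n) - G (a n)))%:E) @[n --> \oo] -->
    (C - (G v - G u))%:E.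
  apply: cvg_EFin; first exact: nearW.
  by apply: cvgB; [exact: cvg_cst|exact: cvgB].
have -> : (\int[mu]_(t in `[u, v]) (f t)%:E)%E =
    (\int[mu]_(t in `]u, v[) (f t)%:E)%E.
  apply: integral_itv_bndoo; apply/measurable_EFinP.
  exact: measurable_funS (measurable_itv _) oc mf.
suff : (\int[mu]_(t in `]u, v[) (f t)%:E <= (C - (G v - G u))%:E)%E.
  move=> h; apply: le_trans (leeD h (lexx _)) _.
  by rewrite -EFinD subrK.
rewrite -(cvg_lim _ cvgI)// -(cvg_lim _ cvgG)//.
apply: lee_lim; [by apply/cvg_ex; eexists; exact: cvgI
                |by apply/cvg_ex; eexists; exact: cvgG|].
have d0 : 0 < (v - u) / 2 by rewrite divr_gt0// subr_gt0.
have [N _ HN] := near_infty_natSinv_lt (PosNum d0).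
exists N => // n /= Nn.
have ab : a n < b n.
  have /= := HN n Nn.
  by rewrite /a /b; move: n.+1%:R^-1 => p; lra.
have mF : measurable (F n) by exact: measurable_itv.
have mI : measurable ([set` `[u, v]] : set R) by exact: measurable_itv.
have mfF : measurable_fun `[a n, b n] f := measurable_funS mI (@Fsubc n) mf.
have mEF : measurable_fun `[a n, b n] E := measurable_funS mI (@Fsubc n) mE.
have f0F t : t \in `[a n, b n] -> 0 <= f t by move=> /(@Fsubc n); exact: f0.
have E0F t : t \in `[a n, b n] -> 0 <= E t by move=> /(@Fsubc n); exact: E0.
have DGF t : t \in `[a n, b n] -> is_derive t (1 : R) G (dG t).
  by move=> /(@Fsub n); exact: DG.
have cdGF : {within `[a n, b n], continuous dG}.
  apply: continuous_in_subspaceT => t; rewrite inE => /(@Fsub n); exact: cdG.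
have HF : {ae mu, forall t, t \in `[a n, b n] -> f t + dG t <= E t}.
  have FF := ae_filter_ringOfSetsType mu.
  by apply: (@filterS _ _ FF _ _ _ H) => t h /(@Fsub n); exact: h.
have le1 := integral_le_compact ab mfF mEF f0F E0F DGF cdGF HF.
have le2 : (\int[mu]_(t in F n) (E t)%:E <= C%:E)%E.
  rewrite -IE; apply: ge0_subset_integral => //; exact/measurable_EFinP.
by have := le_trans le1 le2; rewrite -leeBrDr// -EFinB.
Qed.

End IntegralInequality.

(** * Continuity of the entropy integrand, partitions and intervals *)

Section Continuity.
Variable R : realType.

Lemma continuous_mul_ln : continuous (fun x : R => x * ln x).
Proof.
move=> x; have [x0|x0|->] := ltgtP x 0.
- have E : \forall y \near x, (cst 0 : R -> R) y = y * ln y.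
    near=> y; rewrite ln0 ?mulr0//; apply: ltW.
    by near: y; exact: lt_nbhsl.
  rewrite /continuous_at ln0 ?ltW// mulr0.
  by apply: cvg_trans; [exact: near_eq_cvg E|exact: cvg_cst].
- by apply: cvgM; [exact: cvg_id|exact: continuous_ln].
- rewrite /continuous_at mul0r.
  apply/cvgrPdist_le => e e0 /=.
  (* With [y = s^2] and [ln s^-1 <= s^-1] one gets [|y ln y| <= 2 s], so [y < (e / 2)^2] suffices;
     [y < 1] fixes the sign of the logarithm. *)
  have d0 : 0 < Num.min 1 ((e / 2) ^+ 2).
    by rewrite lt_min ltr01/= exprn_gt0// divr_gt0.
  near=> y.
  have yd : `|y| < Num.min 1 ((e / 2) ^+ 2).
    near: y; exists (Num.min 1 ((e / 2) ^+ 2)) => // z /=.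
    by rewrite sub0r normrN.
  rewrite sub0r normrN; have [y0|y0] := leP y 0.
    by rewrite ln0// mulr0 normr0 ltW.
  move: yd; rewrite gtr0_norm// lt_min => /andP[y1 ye].
  have sy0 : 0 < Num.sqrt y by rewrite sqrtr_gt0.
  have E : y = Num.sqrt y ^+ 2 by rewrite sqr_sqrtr// ltW.
  set s := Num.sqrt y in sy0 E.
  have s1 : s < e / 2.
    have e20 : 0 <= e / 2 by rewrite divr_ge0// ltW.
    by rewrite -(ltr_pXn2r (n := 2))// ?nnegrE ?(ltW sy0)// -E.
  have lE : ln y = - 2 * ln s^-1.
    by rewrite E lnXn// lnV ?posrE// mulrN mulNr opprK mulr_natl.
  rewrite normrM gtr0_norm// lE normrM normrN normr_nat ger0_norm; last first.
    rewrite ln_ge0// invf_ge1// -(ler_pXn2r (n := 2)) ?nnegrE ?(ltW sy0)//.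
    by rewrite -E expr1n ltW.
  apply: (@le_trans _ _ (y * (2 * s^-1))).
    by rewrite ler_wpM2l ?(ltW y0)// ler_wpM2l// ltW// ln_sublinear ?invr_gt0.
  have -> : y * (2 * s^-1) = 2 * s by rewrite {1}E; field; rewrite gt_eqF.
  by move: s1; rewrite ltr_pdivlMr// mulrC => /ltW.
Unshelve. all: by end_near. Qed.

Lemma continuous_fsum (I : finType) (f : I -> R -> R) (t : R) :
  (forall i, {for t, continuous (f i)}) ->
  {for t, continuous (fun s => \sum_i f i s)}.
Proof.
move=> cf; rewrite (_ : (fun s => _) = \sum_i f i); last first.
  by apply/funext => s; rewrite fct_sumE.
elim/big_ind : _ => [|g h cg ch|i _]; [exact: cst_continuous|exact: continuousD|exact: cf].
Qed.

Lemma C1_line_is_derive (f : R -> R) : C1_line f ->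
  forall t, is_derive t (1 : R) f (derive1 f t).
Proof.
by move=> [df _] t; rewrite derive1E; exact: derivableP.
Qed.

Lemma is_derive_C1_line (f df : R -> R) :
  (forall t, is_derive t (1 : R) f (df t)) -> continuous df -> C1_line f.
Proof.
move=> Df cdf; split; first by move=> t; case: (Df t).
rewrite (_ : derive1 f = df)//; apply/funext => t.
by rewrite derive1E (@derive_val _ _ _ _ _ _ _ (Df t)).
Qed.

Lemma C1_line_continuous (f : R -> R) : C1_line f -> continuous f.
Proof. by move=> /C1_line_is_derive Df t; exact: is_derive_continuous (Df t). Qed.

End Continuity.

Section Partition.
Variable R : realType.
Variables (n : nat) (s : nat -> R).
Hypothesis s_inc : forall i, (i < n)%N -> s i < s i.+1.

Lemma partition_ind (P : R -> R -> Prop) : (0 < n)%N ->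
  (forall i, (i < n)%N -> P (s i) (s i.+1)) ->
  (forall u v w, u < v -> v < w -> P u v -> P v w -> P u w) ->
  P (s 0%N) (s n).
Proof.
move=> n0 Pi Ptr.
have H m : (m < n)%N -> s 0%N < s m.+1 /\ P (s 0%N) (s m.+1).
  elim: m => [|m IH] mn; first by split; [exact: s_inc|exact: Pi].
  have [lt0m P0m] := IH (ltnW mn); split; first exact: lt_trans (s_inc mn).
  by apply: Ptr P0m (Pi _ mn) => //; exact: s_inc.
by case: n n0 H => // m _ /(_ m (leqnn _)) [].
Qed.

Lemma partition_locate t : s 0%N < t < s n -> (forall i, t <> s i) ->
  exists2 i, (i < n)%N & s i < t < s i.+1.
Proof.
move=> /andP[t0 tn] ti.
have : exists k, (k < n)%N && (t < s k.+1).
  case: n tn => [|m] tn; first by move: (lt_trans t0 tn); rewrite ltxx.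
  by exists m; rewrite leqnn.
move=> /ex_minnP[k /andP[kn tk] kmin]; exists k => //; rewrite tk andbT.
case: k kn tk kmin => [//|k] kn tk kmin.
rewrite lt_neqAle; apply/andP; split; first by apply/eqP => /esym/ti.
rewrite leNgt; apply/negP => tk'; have := kmin k; rewrite (ltnW kn) tk' => /(_ isT).
by rewrite ltnn.
Qed.

Lemma ae_not_breakpoint :
  {ae @lebesgue_measure R, forall t : R, forall i, t <> s i}.
Proof.
apply: ae_foralln => i; exists [set s i]; split.
- exact: measurable_set1.
- exact: lebesgue_measure_set1.
- by move=> t /= /contrapT.
Qed.

End Partition.

Section Intervals.
Variable R : realType.
Implicit Types (u v w : R) (f : R -> R).
Notation mu := (@lebesgue_measure R).

Lemma itv_cc_setU u v w : u <= v -> v <= w ->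
  [set` `[u, w]] = [set` `[u, v]] `|` [set` `]v, w]] :> set R.
Proof.
move=> uv vw; apply/seteqP; split=> t /=; rewrite !in_itv/=.
  by move=> /andP[ut tw]; case: (leP t v) => tv; [left|right]; rewrite ?ut.
by case=> /andP[h1 h2]; apply/andP; split; rewrite ?h1 ?h2//;
  [exact: le_trans h2 vw|exact: le_trans uv (ltW h1)].
Qed.

Lemma measurable_fun_itv_cat d (T : measurableType d) (f : R -> T) u v w :
  u <= v -> v <= w ->
  measurable_fun [set` `[u, v]] f -> measurable_fun [set` `[v, w]] f ->
  measurable_fun [set` `[u, w]] f.
Proof.
move=> uv vw m1 m2; rewrite (itv_cc_setU uv vw).
apply/measurable_funU; [exact: measurable_itv|exact: measurable_itv|split=> //].
apply: measurable_funS m2; first exact: measurable_itv.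
by move=> t /=; rewrite !in_itv/= => /andP[/ltW -> ->].
Qed.

Lemma ge0_integral_itv_cat f u v w : u <= v -> v <= w ->
  measurable_fun [set` `[u, w]] f -> (forall t, t \in `[u, w] -> 0 <= f t) ->
  (\int[mu]_(t in `[u, w]) (f t)%:E = \int[mu]_(t in `[u, v]) (f t)%:E
   + \int[mu]_(t in `[v, w]) (f t)%:E)%E.
Proof.
move=> uv vw mf f0; rewrite {1}(itv_cc_setU uv vw) ge0_integral_setU//=.
- congr (_ + _)%E; apply: integral_itv_obnd_cbnd; apply/measurable_EFinP.
  apply: measurable_funS mf; first exact: measurable_itv.
  move=> t /=; rewrite !in_itv/= => /andP[h1 ->]; rewrite andbT.
  exact: le_trans uv (ltW h1).
- by rewrite -(itv_cc_setU uv vw); exact/measurable_EFinP.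
- move=> t; rewrite -[X in X \/ _]/([set` `[u, v]] t) => tI; rewrite lee_fin f0//.
  by have : ([set` `[u, v]] `|` [set` `]v, w]]) t by []; rewrite -(itv_cc_setU uv vw).
- apply/disj_setPS => t [] /=; rewrite !in_itv/= => /andP[_ tv] /andP[vt _].
  by move: (le_lt_trans tv vt); rewrite ltxx.
Qed.

Lemma near_itv_oo u v t : u < t < v -> \forall s \near t, u <= s <= v.
Proof.
move=> /andP[ut tv]; near=> s; apply/andP; split; apply: ltW; near: s.
  exact: lt_nbhsr.
exact: lt_nbhsl.
Unshelve. all: by end_near. Qed.

End Intervals.

(** * Curves heated with an affine heat time *)

Section Reach.
Variables (R : realType) (X : finType) (Q : X -> X -> R) (pi : X -> R).
Variable kappa : R.
Notation mu := (@lebesgue_measure R).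

(** Every such [r] bounds [W^2] from above. Unlike the infimum, this relation is real valued and
    comes with a curve, so bounds can be heated and concatenated. *)
Definition reach (rho0 rho1 : X -> R) (r : R) : Prop :=
  exists rho psi, admissible Q pi rho0 rho1 rho psi /\
    (action Q pi rho psi <= r%:E)%E.

Hypothesis Q_ge0 : forall x y, 0 <= Q x y.
Hypothesis Q_irr : irreducible_rates Q.
Hypothesis pi_gt0 : forall x, 0 < pi x.
Hypothesis pi_sum1 : \sum_x pi x = 1.
Hypothesis Q_rev : reversible Q pi.
Hypothesis kappa_ge0 : 0 <= kappa.
Hypothesis bochnerQ : bochner_inequality Q pi kappa.

Lemma measurable_energy (D : set R) (rho psi : R -> X -> R) : measurable D ->
  (forall t x, D t -> 0 <= rho t x) ->
  (forall x, measurable_fun D (rho^~ x)) ->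
  (forall x, measurable_fun D (psi^~ x)) ->
  measurable_fun D (fun t => energy Q pi (@logmean R) (rho t) (psi t)).
Proof.
move=> mD r0 mr mp; apply: measurable_fsum => x; apply: measurable_fsum => y.
apply: measurable_funM; last exact: measurable_cst.
apply: measurable_funM; last exact: measurable_cst.
apply: measurable_funM; last first.
  by apply: measurable_logmean => // t; exact: r0.
by apply: measurable_funX; exact: measurable_funB.
Qed.

Lemma measurable_flux (D : set R) (rho psi : R -> X -> R) x : measurable D ->
  (forall t x, D t -> 0 <= rho t x) ->
  (forall x, measurable_fun D (rho^~ x)) ->
  (forall x, measurable_fun D (psi^~ x)) ->
  measurable_fun D (fun t => flux Q (rho t) (psi t) x).
Proof.
move=> mD r0 mr mp; apply: measurable_fsum => y.
apply: measurable_funM; last exact: measurable_cst.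
apply: measurable_funM; last first.
  by apply: measurable_logmean => // t; exact: r0.
exact: measurable_funB.
Qed.

Lemma piecewise_C1_measurable (rho : R -> X -> R) (x : X) : piecewise_C1 rho ->
  measurable_fun (`[0, 1] : set R) (rho^~ x).
Proof.
move=> [n [s [s0 s1 s_inc sg]]]; rewrite -s0 -s1.
apply: (partition_ind (P := fun u v => measurable_fun [set` `[u, v]] (rho^~ x))
  s_inc).
- by case: n s1 {s_inc sg} => // s1; move: s0 => /eqP; rewrite s1 oner_eq0.
- move=> i /sg[g [gC1 gE]].
  apply: (eq_measurable_fun (g^~ x)).
    by move=> t; rewrite inE => /gE ->.
  apply: measurable_funTS; apply: continuous_measurable_fun.
  exact: C1_line_continuous (gC1 x).
- by move=> u v w /ltW uv /ltW vw; exact: measurable_fun_itv_cat.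
Qed.

Section HeatCurve.
Variables a b : R.
Let tau t := a + (b - a) * t.

Let is_derive_tau t : is_derive t (1 : R) tau (b - a).
Proof.
have D := is_deriveD (is_derive_cst a t (1 : R))
  (is_deriveZ (b - a) (is_derive_id t (1 : R))).
by apply: is_derive_eq D _; rewrite add0r /GRing.scale/= mulr1.
Qed.

Let continuous_tau : continuous tau.
Proof. by move=> t; exact: is_derive_continuous (is_derive_tau t). Qed.

Let continuous_heat_tau (f : R -> X -> R) t x :
  (forall y, {for t, continuous (f^~ y)}) ->
  {for t, continuous (fun t => heat Q (tau t) (f t) x)}.
Proof.
move=> cf; apply: continuous_fsum => y; apply: continuousM; last exact: cf.
apply: (@continuous_comp _ _ _ tau (fun t => heat_kernel Q t x y)).
  exact: continuous_tau.
exact: is_derive_continuous (is_derive_heat_kernel Q_ge0 _ _ _).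
Qed.

Definition heat_curve_derivative (g : R -> X -> R) t x : R :=
  heat Q (tau t) (fun y => derive1 (g^~ y) t) x
  + (b - a) * lap Q (heat Q (tau t) (g t)) x.

Variable g : R -> X -> R.
Hypothesis gC1 : forall x, C1_line (g^~ x).

Lemma is_derive_heat_curve t x : is_derive t (1 : R)
  (fun t => heat Q (tau t) (g t) x) (heat_curve_derivative g t x).
Proof.
have D y : is_derive t (1 : R) (fun t => heat_kernel Q (tau t) x y * g t y)
  (heat_kernel Q (tau t) x y * derive1 (g^~ y) t +
   g t y * (lap Q (fun z => heat_kernel Q (tau t) z y) x * (b - a))).
  have Dk : is_derive t (1 : R) (fun t => heat_kernel Q (tau t) x y)
      (lap Q (fun z => heat_kernel Q (tau t) z y) x * (b - a)).
    exact: is_derive1_comp (is_derive_heat_kernel Q_ge0 (tau t) x y)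
      (is_derive_tau t).
  exact: is_deriveM Dk (C1_line_is_derive (gC1 y) t).
apply: is_derive_eq (is_derive_fsum D) _.
rewrite big_split/=; congr (_ + _).
by rewrite lap_heatE mulr_sumr; apply: eq_bigr => y _; ring.
Qed.

Lemma continuous_heat_curve_derivative x :
  continuous (fun t => heat_curve_derivative g t x).
Proof.
move=> t; rewrite /heat_curve_derivative; apply: cvgD.
  by apply: continuous_heat_tau => y; case: (gC1 y) => _ c; exact: c.
apply: cvgM; first exact: cst_continuous.
apply: continuous_fsum => y; apply: cvgM; first exact: cst_continuous.
by apply: cvgB; apply: continuous_heat_tau => z;
  exact: C1_line_continuous (gC1 z) _.
Qed.

Lemma C1_line_heat_curve x : C1_line (fun t => heat Q (tau t) (g t) x).
Proof.
apply: is_derive_C1_line (fun t => is_derive_heat_curve t x) _.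
exact: continuous_heat_curve_derivative.
Qed.

Lemma continuous_entropy_heat_curve :
  continuous (fun t => entropy pi (heat Q (tau t) (g t))).
Proof.
move=> t; apply: continuous_fsum => x.
apply: cvgM; first exact: cst_continuous.
apply: (@continuous_comp _ _ _ (fun t => heat Q (tau t) (g t) x)
  (fun y => y * ln y)); last exact: continuous_mul_ln.
exact: C1_line_continuous (C1_line_heat_curve x) _.
Qed.

Definition entropy_derivative t : R := \sum_x pi x *
  ((ln (heat Q (tau t) (g t) x) + 1) * heat_curve_derivative g t x).

Lemma is_derive_entropy_heat_curve t :
  (forall x, 0 < heat Q (tau t) (g t) x) ->
  is_derive t (1 : R) (fun t => entropy pi (heat Q (tau t) (g t)))
    (entropy_derivative t).
Proof.
move=> h0; apply: is_derive_fsum => x.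
have Dh := is_derive_heat_curve t x.
have Dl := is_derive1_comp (is_derive1_ln (h0 x)) Dh.
have D := is_deriveZ (pi x) (is_deriveM Dh Dl).
apply: is_derive_eq D _; rewrite /GRing.scale/=.
by field; rewrite gt_eqF.
Qed.

Lemma continuous_entropy_derivative t :
  (forall x, 0 < heat Q (tau t) (g t) x) ->
  {for t, continuous entropy_derivative}.
Proof.
move=> h0; apply: continuous_fsum => x.
apply: cvgM; first exact: cst_continuous.
apply: cvgM; last exact: continuous_heat_curve_derivative.
apply: cvgD; last exact: cst_continuous.
apply: (@continuous_comp _ _ _ (fun t => heat Q (tau t) (g t) x)
  (fun y => ln y)); last exact: continuous_ln.
exact: C1_line_continuous (C1_line_heat_curve x) _.
Qed.

End HeatCurve.

End Reach.

(** * Action along heated curves *)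

(** Infinite integrals are excluded here: [e] is finite by the first bound, and then so is [e'],
    after which only real arithmetic remains. *)
Lemma action_inequality (R : realType) (K r c : R) (e e' : \bar R) : 0 < K ->
  (2^-1%:E * e <= r%:E -> e' + (2 * c)%:E <= K%:E * e -> 0 <= e' -> 0 <= e ->
   2^-1%:E * e' <= (K * r - c)%:E)%E.
Proof.
move=> K0; case: e => [e| |] //; last first.
  by rewrite mulry gtr0_sg ?invr_gt0// mul1e leye_eq.
case: e' => [e'| |] //=.
rewrite -!EFinM -!EFinD !lee_fin => I1 I3 _ _.
have : K * (2^-1 * e) <= K * r by rewrite ler_wpM2l// ltW.
lra.
Qed.

Section HeatReach.
Variables (R : realType) (X : finType) (Q : X -> X -> R) (pi : X -> R).
Variable kappa : R.
Notation mu := (@lebesgue_measure R).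
Hypothesis Q_ge0 : forall x y, 0 <= Q x y.
Hypothesis Q_irr : irreducible_rates Q.
Hypothesis pi_gt0 : forall x, 0 < pi x.
Hypothesis pi_sum1 : \sum_x pi x = 1.
Hypothesis Q_rev : reversible Q pi.
Hypothesis kappa_ge0 : 0 <= kappa.
Hypothesis bochnerQ : bochner_inequality Q pi kappa.

Variables (a b : R) (a_ge0 : 0 <= a) (b_ge0 : 0 <= b) (ab_gt0 : 0 < a + b).
Variables (rho0 rho1 : X -> R) (rho psi : R -> X -> R).
Hypothesis adm : admissible Q pi rho0 rho1 rho psi.

Let tau (t : R) := a + (b - a) * t.
Let rhoh t := heat Q (tau t) (rho t).
Let psih t := heated_potential Q pi (rho t) (psi t) (tau t) (b - a).

Let tau_ge_min t : 0 <= t <= 1 -> Num.min a b <= tau t.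
Proof.
move=> /andP[t0 t1]; rewrite /tau.
have -> : a + (b - a) * t = (1 - t) * a + t * b by ring.
have -> : Num.min a b = (1 - t) * Num.min a b + t * Num.min a b by ring.
by apply: lerD; apply: ler_wpM2l; rewrite ?subr_ge0// ge_min lexx ?orbT.
Qed.

Let tau_ge0 t : 0 <= t <= 1 -> 0 <= tau t.
Proof. by move=> /tau_ge_min; apply: le_trans; rewrite le_min a_ge0. Qed.

Let tau_gt0 t : 0 < t < 1 -> 0 < tau t.
Proof.
move=> /andP[t0 t1]; rewrite /tau.
have -> : a + (b - a) * t = (1 - t) * a + t * b by ring.
have t1' : 0 < 1 - t by rewrite subr_gt0.
move: a_ge0; rewrite le_eqVlt => /predU1P[a0|a0].
  by rewrite -a0 mulr0 add0r mulr_gt0//; move: ab_gt0; rewrite -a0 add0r.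
by rewrite ltr_pwDl ?mulr_gt0 ?mulr_ge0// ltW.
Qed.

Let rho_ge0 t x : t \in `[0, 1] -> 0 <= rho t x.
Proof. by move=> tI; case: adm => _ /(_ t tI)[+ _]; exact. Qed.

Let rhoh_density t : t \in `[0, 1] -> density pi (rhoh t).
Proof.
move=> tI; apply: density_heat => //; first by apply: tau_ge0; move: tI; rewrite in_itv.
by case: adm => _ /(_ t tI).
Qed.

Let mrho x : measurable_fun (`[0, 1] : set R) (rho^~ x).
Proof. by case: adm => + _ _ _ _; exact: piecewise_C1_measurable. Qed.

Let mpsi x : measurable_fun (`[0, 1] : set R) (psi^~ x).
Proof. by case: adm. Qed.

Let mheat (f : R -> X -> R) x : (forall y, measurable_fun (`[0, 1] : set R) (f^~ y)) ->
  measurable_fun (`[0, 1] : set R) (fun t => heat Q (tau t) (f t) x).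
Proof.
move=> mf; apply: measurable_fsum => y; apply: measurable_funM => //.
apply: measurable_funTS; apply: continuous_measurable_fun => t.
apply: (@continuous_comp _ _ _ tau (fun t => heat_kernel Q t x y)).
  have D := is_deriveD (is_derive_cst a t (1 : R))
    (is_deriveZ (b - a) (is_derive_id t (1 : R))).
  exact: is_derive_continuous D.
exact: is_derive_continuous (is_derive_heat_kernel Q_ge0 _ _ _).
Qed.

Let mrhoh x : measurable_fun (`[0, 1] : set R) (rhoh^~ x).
Proof. exact: mheat. Qed.

Let mpsih x : measurable_fun (`[0, 1] : set R) (psih^~ x).
Proof.
have mI : measurable (`[0, 1] : set R) by exact: measurable_itv.
apply: measurable_funB.
  apply: measurable_potential => //.
    by move=> t y tI; have [h _] := rhoh_density tI; exact: h.
  move=> y; apply: mheat => z.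
  apply: measurableT_comp; first exact: oppr_measurable.
  by apply: measurable_flux => // t u tI; exact: rho_ge0.
apply: measurable_funM; first exact: measurable_cst.
apply: (measurableT_comp (f := @ln R)); first exact: measurable_ln.
exact: mrhoh.
Qed.

Let piecewise_rhoh : piecewise_C1 rhoh.
Proof.
case: adm => -[n [s [s0 s1 s_inc sg]]] _ _ _ _; exists n, s; split=> //.
move=> i /sg[g [gC1 gE]].
exists (fun t => heat Q (tau t) (g t)); split=> [x|t /gE]; last first.
  by rewrite /rhoh => ->.
exact: C1_line_heat_curve.
Qed.

Let derivative_rhoh (u v t : R) (g : R -> X -> R) :
  (forall x, C1_line (g^~ x)) -> (forall t, t \in `[u, v] -> rho t = g t) ->
  u < t < v ->
  (forall x, derive1 (rho^~ x) t + flux Q (rho t) (psi t) x = 0) ->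
  forall x, heat_curve_derivative Q a b g t x =
    heated_velocity Q (rho t) (psi t) (tau t) (b - a) x.
Proof.
move=> gC1 gE utv ce x; rewrite /heat_curve_derivative /heated_velocity.
have tI : t \in `[u, v] by case/andP: utv => h1 h2; rewrite in_itv/= !ltW.
rewrite -(gE t tI) -/(tau t); congr (_ + _); congr (heat Q _ _ x).
apply/funext => y; apply/eqP; rewrite -addr_eq0; apply/eqP.
rewrite -[RHS](ce y); congr (_ + _); rewrite !derive1E.
apply: near_eq_derive; have := near_itv_oo utv; apply: filterS => s sI.
by rewrite (gE s)// in_itv.
Qed.

Let derive1_rhoh (u v t : R) (g : R -> X -> R) :
  (forall x, C1_line (g^~ x)) -> (forall t, t \in `[u, v] -> rho t = g t) ->
  u < t < v ->
  forall x, derive1 (rhoh^~ x) t = heat_curve_derivative Q a b g t x.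
Proof.
move=> gC1 gE utv x; have D := is_derive_heat_curve Q_ge0 a b gC1 t x.
rewrite -(@derive_val _ _ _ _ _ _ _ D) derive1E.
apply: near_eq_derive; have := near_itv_oo utv; apply: filterS => s sI.
by rewrite /rhoh (gE s)// in_itv.
Qed.

Let admissible_rhoh :
  admissible Q pi (heat Q a rho0) (heat Q b rho1) rhoh psih.
Proof.
case: (adm) => -[n [s [s0 s1 s_inc sg]]] rd _ [r0 r1] ce.
split; [exact: piecewise_rhoh|exact: rhoh_density|exact: mpsih| |].
- split; first by rewrite /rhoh /tau mulr0 addr0 r0.
  by rewrite /rhoh /tau mulr1 addrC subrK r1.
- have FF := ae_filter_ringOfSetsType mu.
  (* Off the null set of break points the curve coincides near [t] with one [C^1] piece, whose
     derivative is known. *)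
  apply: (@filterS2 _ _ FF _ _ _ _ ce (ae_not_breakpoint s)) => t cet ts tI x.
  have t01 : 0 < t < 1 by move: tI; rewrite in_itv.
  have tI' : t \in `[0, 1] by case/andP: t01 => h1 h2; rewrite in_itv/= !ltW.
  have [i ile sti] := partition_locate (n := n) (s := s) (t := t) (ltac:(by rewrite s0 s1)) ts.
  have [g [gC1 gE]] := sg i ile.
  rewrite (derive1_rhoh gC1 gE sti) (derivative_rhoh gC1 gE sti (cet tI)).
  by apply: heated_continuity => //; [exact: rd|exact: tau_gt0].
Qed.

Let K := expR (- (2 * kappa) * Num.min a b).
Let En t := energy Q pi (@logmean R) (rho t) (psi t).
Let Enh t := energy Q pi (@logmean R) (rhoh t) (psih t).
Let H t := entropy pi (rhoh t).

Let mI : measurable (`[0, 1] : set R). Proof. exact: measurable_itv. Qed.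

Let mEn : measurable_fun (`[0, 1] : set R) En.
Proof. by apply: measurable_energy => // t x; exact: rho_ge0. Qed.

Let mEnh : measurable_fun (`[0, 1] : set R) Enh.
Proof.
apply: measurable_energy => // t x tI.
by have [h _] := rhoh_density tI; exact: h.
Qed.

Let En_ge0 t : 0 <= En t.
Proof. by apply: energy_ge0 => // x y; exact: logmean_ge0. Qed.

Let Enh_ge0 t : 0 <= Enh t.
Proof. by apply: energy_ge0 => // x y; exact: logmean_ge0. Qed.

Let KEn_ge0 t : 0 <= K * En t.
Proof. by apply: mulr_ge0 => //; exact: expR_ge0. Qed.

Let mKEn : measurable_fun (`[0, 1] : set R) (fun t => K * En t).
Proof. by apply: measurable_funM; [exact: measurable_cst|exact: mEn]. Qed.

Let pointwise_energy (u v t : R) (g : R -> X -> R) :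
  (forall x, C1_line (g^~ x)) -> (forall t, t \in `[u, v] -> rho t = g t) ->
  u < t < v -> 0 < t < 1 ->
  (forall x, derive1 (rho^~ x) t + flux Q (rho t) (psi t) x = 0) ->
  Enh t + 4 * (b - a) * entropy_derivative Q pi a b g t <= K * En t.
Proof.
move=> gC1 gE utv t01 ce.
have tI : t \in `[u, v] by case/andP: utv => h1 h2; rewrite in_itv/= !ltW.
have tI1 : t \in `[0, 1] by case/andP: t01 => h1 h2; rewrite in_itv/= !ltW.
have rd : density pi (rho t) by case: adm => _ /(_ t tI1).
have t0 := tau_gt0 t01.
have hv := derivative_rhoh gC1 gE utv ce.
have hc x := heated_continuity Q_ge0 Q_irr pi_gt0 pi_sum1 Q_rev (psi t) (b - a) rd t0 x.
have rh0 x : 0 <= rhoh t x.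
  by have [h _] := rhoh_density tI1; exact: h.
(* Mass is conserved, so the [+ 1] from differentiating [r ln r] disappears from the entropy
   derivative. *)
have S0 : \sum_x pi x * heated_velocity Q (rho t) (psi t) (tau t) (b - a) x = 0.
  transitivity (- \sum_x pi x * flux Q (rhoh t) (psih t) x); last first.
    by rewrite (sum_flux Q_rev (psih t) rh0) oppr0.
  rewrite -sumrN.
  apply: eq_bigr => x _; rewrite -mulrN; congr (_ * _).
  by apply/eqP; rewrite -addr_eq0; apply/eqP; exact: hc.
have -> : entropy_derivative Q pi a b g t = \sum_x pi x *
    (ln (rhoh t x) * heated_velocity Q (rho t) (psi t) (tau t) (b - a) x).
  rewrite -[RHS]addr0 -[X in _ = _ + X]S0 -big_split; apply: eq_bigr => x _ /=.
  by rewrite -mulrDr hv -(gE t tI) /rhoh /tau mulrDl mul1r.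
have := heated_energy Q_ge0 Q_irr pi_gt0 pi_sum1 Q_rev bochnerQ (psi t) (b - a) rd t0.
move=> /le_trans; apply; apply: ler_wpM2r; first exact: En_ge0.
rewrite ler_expR ler_wnM2l ?oppr_le0 ?mulr_ge0//; apply: tau_ge_min.
by case/andP: t01 => h1 h2; rewrite !ltW.
Qed.

(** The inequality is integrated on each [C^1] piece, where a single smooth extension is available,
    and the entropy increments telescope over the pieces. *)
Let integrated_energy :
  (\int[mu]_(t in `[0%R, 1%R]) (Enh t)%:E + (4 * (b - a) * (H 1 - H 0))%:E <=
   \int[mu]_(t in `[0%R, 1%R]) (K * En t)%:E)%E.
Proof.
case: (adm) => -[n [s [s0 s1 s_inc sg]]] rd _ _ ce.
pose P (u v : R) := 0 <= u -> v <= 1 ->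
  (\int[mu]_(t in `[u, v]) (Enh t)%:E + (4 * (b - a) * (H v - H u))%:E <=
   \int[mu]_(t in `[u, v]) (K * En t)%:E)%E.
have sub (u v : R) : 0 <= u -> v <= 1 -> [set` `[u, v]] `<=` [set` `[0, 1]].
  move=> u0 v1 t /=; rewrite !in_itv/= => /andP[ut tv].
  by rewrite (le_trans u0 ut) (le_trans tv v1).
suff : P (s 0%N) (s n) by rewrite s0 s1; apply.
apply: (partition_ind (P := P) s_inc).
- by case: n s1 {s_inc sg} => // s1; move: s0 => /eqP; rewrite s1 oner_eq0.
- move=> i ile; have [g [gC1 gE]] := sg i ile; have uv := s_inc i ile.
  move: uv gE; set u := s i; set v := s i.+1 => uv gE u0 v1.
  have inner t : t \in `]u, v[ -> 0 < t < 1.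
    rewrite in_itv/= => /andP[ut tv].
    by rewrite (le_lt_trans u0 ut) (lt_le_trans tv v1).
  have pos t : t \in `]u, v[ -> forall x, 0 < heat Q (a + (b - a) * t) (g t) x.
    move=> tI x; have t01 := inner t tI.
    have tI1 : t \in `[0, 1] by case/andP: t01 => h1 h2; rewrite in_itv/= !ltW.
    rewrite -(gE t); last by apply: subset_itv_oo_cc.
    exact: (heat_gt0 Q_ge0 Q_irr x (tau_gt0 t01) (rd t tI1)).
  pose G t := 4 * (b - a) * entropy pi (heat Q (a + (b - a) * t) (g t)).
  pose dG t := 4 * (b - a) * entropy_derivative Q pi a b g t.
  have -> : 4 * (b - a) * (H v - H u) = G v - G u.
    by rewrite /G /H /rhoh mulrBr !gE// in_itv/= lexx ltW.
  have D t : t \in `]u, v[ -> is_derive t (1 : R) G (dG t).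
    move=> tI; apply: is_deriveZ.
    exact: (is_derive_entropy_heat_curve pi Q_ge0 gC1 (pos t tI)).
  have cG : continuous G.
    move=> t; apply: cvgM; first exact: cst_continuous.
    exact: continuous_entropy_heat_curve.
  have cdG t : t \in `]u, v[ -> {for t, continuous dG}.
    move=> tI; apply: cvgM; first exact: cst_continuous.
    exact: (continuous_entropy_derivative Q_ge0 gC1 (pos t tI)).
  have m1 : measurable_fun `[u, v] Enh := measurable_funS mI (sub _ _ u0 v1) mEnh.
  have m2 : measurable_fun `[u, v] (fun t => K * En t) :=
    measurable_funS mI (sub _ _ u0 v1) mKEn.
  have AE : {ae mu, forall t, t \in `]u, v[ -> Enh t + dG t <= K * En t}.
    have FF := ae_filter_ringOfSetsType mu.
    apply: (@filterS _ _ FF _ _ _ ce) => t cet tI.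
    apply: (pointwise_energy gC1 gE); [by move: tI; rewrite in_itv|exact: inner|].
    by apply: cet; rewrite in_itv/=; exact: inner.
  exact: (integral_le_open uv m1 m2 (fun t _ => Enh_ge0 t)
    (fun t _ => KEn_ge0 t) cG D cdG AE).
- move=> u v w uv vw Puv Pvw u0 w1.
  have v0 : 0 <= v by rewrite (le_trans u0)// ltW.
  have v1 : v <= 1 by rewrite (le_trans _ w1)// ltW.
  have m1 := measurable_funS mI (sub _ _ u0 w1) mEnh.
  have m2 := measurable_funS mI (sub _ _ u0 w1) mKEn.
  rewrite (ge0_integral_itv_cat (ltW uv) (ltW vw) m1 (fun t _ => Enh_ge0 t)).
  rewrite (ge0_integral_itv_cat (ltW uv) (ltW vw) m2 (fun t _ => KEn_ge0 t)).
  apply: le_trans (leeD (Puv u0 v1) (Pvw v0 w1)).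
  rewrite [leRHS]addeACA -[in leRHS]EFinD -mulrDr.
  by have -> : H v - H u + (H w - H v) = H w - H u by ring.
Qed.

Lemma heat_reach_curve r : (action Q pi rho psi <= r%:E)%E ->
  reach Q pi (heat Q a rho0) (heat Q b rho1)
    (expR (- (2 * kappa) * Num.min a b) * r +
     2 * (b - a) * (entropy pi (heat Q a rho0) - entropy pi (heat Q b rho1))).
Proof.
move=> ar; exists rhoh, psih; split; first exact: admissible_rhoh.
have H0 : H 0 = entropy pi (heat Q a rho0).
  by case: adm => _ _ _ [r0 _] _; rewrite /H /rhoh /tau mulr0 addr0 r0.
have H1 : H 1 = entropy pi (heat Q b rho1).
  by case: adm => _ _ _ [_ r1] _; rewrite /H /rhoh /tau mulr1 addrC subrK r1.
rewrite -H0 -H1 -/K.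
have I1 : (2^-1%:E * \int[mu]_(t in `[0%R, 1%R]) (En t)%:E <= r%:E)%E := ar.
have I2 : (\int[mu]_(t in `[0%R, 1%R]) (K * En t)%:E =
    K%:E * \int[mu]_(t in `[0%R, 1%R]) (En t)%:E)%E.
  under eq_integral do rewrite EFinM.
  have m1 : measurable_fun (`[0, 1] : set R) (EFin \o En).
    by apply/measurable_EFinP; exact: mEn.
  have p1 t : [set` `[0%R, 1%R]] t -> (0 <= (En t)%:E)%E.
    by move=> _; rewrite lee_fin; exact: En_ge0.
  have K0 : (0 <= K%:E)%E by rewrite lee_fin expR_ge0.
  exact: (ge0_integralZl mu mI m1 p1 K0).
have I3 := integrated_energy; rewrite I2 in I3.
rewrite /action; change (2^-1%:E * \int[mu]_(t in `[0%R, 1%R]) (Enh t)%:E <=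
  (K * r + 2 * (b - a) * (H 0 - H 1))%:E)%E.
have J0 : (0 <= \int[mu]_(t in `[0%R, 1%R]) (Enh t)%:E)%E.
  by apply: integral_ge0 => t _; rewrite lee_fin; exact: Enh_ge0.
have J1 : (0 <= \int[mu]_(t in `[0%R, 1%R]) (En t)%:E)%E.
  by apply: integral_ge0 => t _; rewrite lee_fin; exact: En_ge0.
have K0 : 0 < K by exact: expR_gt0.
have -> : K * r + 2 * (b - a) * (H 0 - H 1) =
    K * r - 2 * (b - a) * (H 1 - H 0) by ring.
apply: (action_inequality K0 I1 _ J0 J1).
by have -> : 2 * (2 * (b - a) * (H 1 - H 0)) = 4 * (b - a) * (H 1 - H 0) by ring.
Qed.

End HeatReach.

(** * Reparametrization and concatenation *)

Section Affine.
Variables (R : realType) (c k : R).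
Notation mu := (@lebesgue_measure R).

Definition affine (t : R) : R := (t - c) / k.

Lemma continuous_affine : continuous affine.
Proof.
by move=> t; apply: cvgM; [apply: cvgB; [exact: cvg_id|exact: cvg_cst]|exact: cvg_cst].
Qed.

Lemma measurable_affine : measurable_fun [set: R] affine.
Proof. exact: continuous_measurable_fun continuous_affine. Qed.

Definition affine_mfun : measurableTypeR R -> measurableTypeR R := affine.


Hypothesis k_gt0 : 0 < k.

Lemma affine_le x t : (x <= affine t) = (c + k * x <= t).
Proof. by rewrite /affine ler_pdivlMr// lerBrDl mulrC. Qed.

Lemma affine_ge x t : (affine t <= x) = (t <= c + k * x).
Proof. by rewrite /affine ler_pdivrMr// lerBlDl mulrC. Qed.

Lemma affine_lt x t : (x < affine t) = (c + k * x < t).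
Proof. by rewrite !ltNge affine_ge. Qed.

Lemma affine_gt x t : (affine t < x) = (t < c + k * x).
Proof. by rewrite !ltNge affine_le. Qed.

(** The pushforward of Lebesgue measure, scaled by [k^-1], has the right value on half-open
    intervals, hence is Lebesgue measure by uniqueness. *)
Lemma lebesgue_measure_affine (A : set R) : measurable A ->
  (mu (affine @^-1` A) = k%:E * mu A)%E.
Proof.
have kV : 0 <= k^-1 by rewrite invr_ge0 ltW.
pose nuf : {measure set (measurableTypeR R) -> \bar R} :=
  mscale (NngNum kV) (pushforward mu affine_mfun).
pose nu := nuf measurable_affine.
move=> mA.
have -> : mu A = nu A.
  apply: lebesgue_measure_unique => //= _ [[a b]] _ <-.
  rewrite /nu /nuf /mscale /= /pushforward.
  have -> : affine @^-1` [set` `]a, b]] = [set` `](c + k * a), (c + k * b)]].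
    by apply/seteqP; split=> t /=; rewrite !in_itv/= affine_lt affine_ge.
  rewrite !lebesgue_measure_itv/= !lte_fin ltrD2l ltr_pM2l//.
  case: ifP => _; last by rewrite mule0.
  by rewrite -!EFinB -EFinM; congr EFin; field; rewrite gt_eqF.
rewrite /nu /nuf /mscale /= /pushforward muleA -EFinM mulfV ?gt_eqF//.
by rewrite mul1e.
Qed.

Lemma ge0_integral_affine (f : R -> R) :
  measurable_fun (`[0, 1] : set R) f -> (forall t, t \in `[0, 1] -> 0 <= f t) ->
  (\int[mu]_(t in `[c, (c + k)%R]) (f (affine t))%:E =
   k%:E * \int[mu]_(t in `[0%R, 1%R]) (f t)%:E)%E.
Proof.
move=> mf f0.
have kn : 0 <= k by exact: ltW.
have mI : measurable (`[0, 1] : set R) by exact: measurable_itv.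
have mEf : measurable_fun (`[0, 1] : set R) (EFin \o f) by apply/measurable_EFinP.
have f0' t : [set` `[0%R, 1%R]] t -> (0 <= (EFin \o f) t)%E.
  by move=> tI; rewrite lee_fin; exact: f0.
have -> : [set` `[c, c + k]] = affine @^-1` [set` `[0, 1]].
  by apply/seteqP; split=> t /=; rewrite !in_itv/= affine_le affine_ge mulr0 mulr1 addr0.
have f0'' : {in [set` `[0, 1]], forall t, (0 <= (EFin \o f) t)%E}.
  by move=> t; rewrite inE; exact: f0'.
pose m : {measure set (measurableTypeR R) -> \bar R} := mu.
pose nuf : {measure set (measurableTypeR R) -> \bar R} := pushforward m affine_mfun.
have E1 := @ge0_integral_pushforward _ _ (measurableTypeR R) (measurableTypeR R)
  R affine_mfun measurable_affine m _ _ mI mEf f0''.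
have E2 := @ge0_integral_mscale _ _ _ m _ mI (NngNum kn) _ mEf f0'.
transitivity (\int[pushforward m affine_mfun]_(t in [set` `[0%R, 1%R]]) (EFin \o f) t)%E.
  exact: (esym E1).
transitivity (\int[mscale (NngNum kn) m]_(t in [set` `[0%R, 1%R]]) (EFin \o f) t)%E.
  apply: (eq_measure_integral (m1 := nuf measurable_affine) (mscale (NngNum kn) m)).
  by move=> A mA _; exact: lebesgue_measure_affine.
exact: E2.
Qed.

Lemma ae_affine (P : R -> Prop) :
  {ae mu, forall t, P t} -> {ae mu, forall t, P (affine t)}.
Proof.
move=> [N [mN N0 PN]]; exists (affine @^-1` N); split.
- by rewrite -[X in measurable X]setTI; exact: measurable_affine.
- by apply: (eq_trans (lebesgue_measure_affine mN)); rewrite N0 mule0.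
- by move=> t Pt; exact: PN.
Qed.

Lemma is_derive_affine t : is_derive t (1 : R) affine k^-1.
Proof.
have D := is_deriveZ k^-1 (is_deriveB (is_derive_id t (1 : R))
  (is_derive_cst c t (1 : R))).
rewrite (_ : affine = k^-1 \*: (id - cst c)).
  by apply: is_derive_eq D _; rewrite subr0 /GRing.scale/= mulr1.
by apply/funext => s; rewrite /affine mulrC.
Qed.

Lemma C1_line_affine (f : R -> R) : C1_line f -> C1_line (f \o affine).
Proof.
move=> fC1; apply: (@is_derive_C1_line _ _ (fun t => derive1 f (affine t) * k^-1)).
  move=> t; apply: is_derive1_comp (is_derive_affine t).
  exact: C1_line_is_derive.
move=> t; apply: cvgM; last exact: cvg_cst.
apply: (@continuous_comp _ _ _ affine (derive1 f)); first exact: continuous_affine.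
by case: fC1 => _; exact.
Qed.

End Affine.

Section Reparametrization.
Variables (R : realType) (X : finType) (Q : X -> X -> R) (pi : X -> R).
Notation mu := (@lebesgue_measure R).
Hypothesis Q_ge0 : forall x y, 0 <= Q x y.
Hypothesis pi_gt0 : forall x, 0 < pi x.

Lemma energyZ th rho (a : R) psi :
  energy Q pi th rho (fun x => a * psi x) = a ^+ 2 * energy Q pi th rho psi.
Proof.
rewrite /energy mulr_sumr; apply: eq_bigr => x _.
by rewrite mulr_sumr; apply: eq_bigr => y _; ring.
Qed.

Lemma fluxZ rho (a : R) psi x :
  flux Q rho (fun y => a * psi y) x = a * flux Q rho psi x.
Proof. by rewrite /flux mulr_sumr; apply: eq_bigr => y _; ring. Qed.

Variables (c k : R) (k_gt0 : 0 < k).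
Variables (rho0 rho1 : X -> R) (rho psi : R -> X -> R).
Hypothesis adm : admissible Q pi rho0 rho1 rho psi.

Let phi := affine c k.
Let rhok t := rho (phi t).
Let psik t := (fun x => k^-1 * psi (phi t) x).

Lemma reparam_continuity : {ae mu, forall t, 0 < phi t < 1 -> forall x,
  derive1 (rhok^~ x) t + flux Q (rhok t) (psik t) x = 0}.
Proof.
case: adm => -[n [s [s0 s1 s_inc sg]]] _ _ _ ce.
have FF := ae_filter_ringOfSetsType mu.
have ce' : {ae mu, forall t, phi t \in `]0, 1[ -> forall x,
    derive1 (rho^~ x) (phi t) + flux Q (rho (phi t)) (psi (phi t)) x = 0}.
  exact: (@ae_affine _ _ _ k_gt0 (fun t => t \in `]0, 1[ -> forall x,
    derive1 (rho^~ x) t + flux Q (rho t) (psi t) x = 0)).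
have nb : {ae mu, forall t, forall i, phi t <> s i}.
  apply: (@ae_affine _ _ _ k_gt0 (fun t => forall i, t <> s i)).
  exact: ae_not_breakpoint.
apply: (@filterS2 _ _ FF _ _ _ _ ce' nb) => t cet ts t01 x.
have t01' : s 0%N < phi t < s n by rewrite s0 s1.
have [i ile sti] := partition_locate t01' ts.
have [g [gC1 gE]] := sg i ile.
have near1 : \forall u \near phi t, g u x = rho u x.
  have := near_itv_oo sti; apply: filterS => u uI.
  by rewrite gE// in_itv.
have near2 : \forall u \near t, g (phi u) x = rhok u x.
  exact: (continuous_affine near1).
rewrite /psik fluxZ.
have Dg := C1_line_is_derive (gC1 x) (phi t).
have D1 := near_eq_is_derive near1 Dg.
have D2 := near_eq_is_derive near2 (is_derive1_comp Dg (is_derive_affine c k t)).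
have E1 := @derive_val _ _ _ _ _ _ _ D1.
have E2 := @derive_val _ _ _ _ _ _ _ D2.
have := cet _ x; rewrite in_itv => /(_ t01).
rewrite !derive1E E1 E2 => H.
have -> : derive1 (g^~ x) (phi t) = - flux Q (rho (phi t)) (psi (phi t)) x.
  by apply/eqP; rewrite -addr_eq0; apply/eqP; exact: H.
by rewrite mulNr mulrC addNr.
Qed.

Lemma measurable_reparam (f : R -> R) : measurable_fun (`[0, 1] : set R) f ->
  measurable_fun (`[c, c + k] : set R) (fun t => f (phi t)).
Proof.
move=> mf; change (measurable_fun (`[c, c + k] : set R) (f \o phi)).
apply: (measurable_comp (F := (`[0, 1] : set R))) => //.
- move=> _ [t /= tI <-] /=; move: tI.
  by rewrite !in_itv/= affine_le// affine_ge// mulr0 mulr1 addr0.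
- by apply: measurable_funTS; exact: measurable_affine.
Qed.

Let En t := energy Q pi (@logmean R) (rho t) (psi t).

Let En_ge0 t : 0 <= En t.
Proof. by apply: energy_ge0 => // x y; exact: logmean_ge0. Qed.

Let mEn : measurable_fun (`[0, 1] : set R) En.
Proof.
case: adm => p d m _ _; apply: measurable_energy => //.
- by move=> t x tI; have [h _] := d t tI; exact: h.
- by move=> x; exact: piecewise_C1_measurable.
Qed.

Lemma measurable_reparam_energy : measurable_fun (`[c, c + k] : set R)
  (fun t => energy Q pi (@logmean R) (rhok t) (psik t)).
Proof.
have E t : energy Q pi (@logmean R) (rhok t) (psik t) = k^-1 ^+ 2 * En (phi t).
  exact: energyZ.
apply: (eq_measurable_fun (fun t => k^-1 ^+ 2 * En (phi t))).
  by move=> t _; exact: esym (E t).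
apply: measurable_funM; first exact: measurable_cst.
exact: (measurable_reparam mEn).
Qed.

(** Speeding up by [k^-1] multiplies the potential by [k^-1] and the quadratic energy by [k^-2]; the
    change of variables gives back one factor [k]. *)
Lemma reparam_action : (\int[mu]_(t in `[c, (c + k)%R])
    (energy Q pi (@logmean R) (rhok t) (psik t))%:E =
  k^-1%:E * \int[mu]_(t in `[0%R, 1%R]) (En t)%:E)%E.
Proof.
have E t : energy Q pi (@logmean R) (rhok t) (psik t) = k^-1 ^+ 2 * En (phi t).
  exact: energyZ.
transitivity (\int[mu]_(t in `[c, (c + k)%R]) (k^-1 ^+ 2 * En (phi t))%:E)%E.
  by apply: eq_integral => t _; congr EFin; exact: E.
have m2 : measurable_fun (`[0, 1] : set R) (fun t => k^-1 ^+ 2 * En t).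
  by apply: measurable_funM; [exact: measurable_cst|exact: mEn].
have p2 t : t \in `[0, 1] -> 0 <= k^-1 ^+ 2 * En t.
  by move=> _; apply: mulr_ge0; [exact: sqr_ge0|exact: En_ge0].
have E1 := ge0_integral_affine c k_gt0 m2 p2.
apply: (eq_trans E1).
under eq_integral do rewrite EFinM.
have mI : measurable (`[0, 1] : set R) by exact: measurable_itv.
have m1 : measurable_fun (`[0, 1] : set R) (EFin \o En).
  by apply/measurable_EFinP; exact: mEn.
have p1 t : [set` `[0%R, 1%R]] t -> (0 <= (En t)%:E)%E.
  by move=> _; rewrite lee_fin; exact: En_ge0.
have K0 : (0 <= (k^-1 ^+ 2)%:E)%E by rewrite lee_fin sqr_ge0.
have E2 := ge0_integralZl mu mI m1 p1 K0.
transitivity (k%:E * ((k^-1 ^+ 2)%:E * \int[mu]_(t in `[0%R, 1%R]) (En t)%:E))%E.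
  by congr (_ * _)%E; exact: E2.
rewrite muleA -EFinM; congr (_%:E * _)%E.
by field; rewrite gt_eqF.
Qed.

End Reparametrization.

Section Join.
Variables (R : realType) (X : finType) (Q : X -> X -> R) (pi : X -> R).
Notation mu := (@lebesgue_measure R).
Hypothesis Q_ge0 : forall x y, 0 <= Q x y.
Hypothesis pi_gt0 : forall x, 0 < pi x.

Variables (c : R) (c01 : 0 < c < 1).
Variables (x0 x1 x2 : X -> R) (rho1 rho2 psi1 psi2 : R -> X -> R).
Hypothesis adm1 : admissible Q pi x0 x1 rho1 psi1.
Hypothesis adm2 : admissible Q pi x1 x2 rho2 psi2.

Let c0 : 0 < c. Proof. by case/andP: c01. Qed.
Let c1 : 0 < 1 - c. Proof. by case/andP: c01 => _; rewrite subr_gt0. Qed.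
Let cc : c + (1 - c) = 1. Proof. by rewrite addrC subrK. Qed.

Let phi1 := affine 0 c.
Let phi2 := affine c (1 - c).

Definition join_curve t := if t <= c then rho1 (phi1 t) else rho2 (phi2 t).

Definition join_potential t := if t <= c then (fun x => c^-1 * psi1 (phi1 t) x)
  else (fun x => (1 - c)^-1 * psi2 (phi2 t) x).

Let phi1c : phi1 c = 1.
Proof. by rewrite /phi1 /affine subr0 divff ?gt_eqF. Qed.

Let phi2c : phi2 c = 0. Proof. by rewrite /phi2 /affine subrr mul0r. Qed.

Let ends1 : rho1 0 = x0 /\ rho1 1 = x1. Proof. by case: adm1. Qed.
Let ends2 : rho2 0 = x1 /\ rho2 1 = x2. Proof. by case: adm2. Qed.

Let join_right t : c <= t -> join_curve t = rho2 (phi2 t).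
Proof.
rewrite le_eqVlt /join_curve => /predU1P[<-|ct].
  by rewrite lexx phi1c phi2c; case: ends1 => _ ->; case: ends2 => ->.
by rewrite leNgt ct.
Qed.

Let phi1_itv t : (phi1 t \in `[0, 1]) = (t \in `[0, c]).
Proof. by rewrite !in_itv/= affine_le// affine_ge// mulr0 mulr1 !add0r. Qed.

Let phi2_itv t : (phi2 t \in `[0, 1]) = (t \in `[c, 1]).
Proof. by rewrite !in_itv/= affine_le// affine_ge// mulr0 mulr1 addr0 cc. Qed.

Let piecewise_join : piecewise_C1 join_curve.
Proof.
case: adm1 => -[n1 [s1 [s10 s11 s1i sg1]]] _ _ _ _.
case: adm2 => -[n2 [s2 [s20 s21 s2i sg2]]] _ _ _ _.
(* Both formulas give [c] at [i = n1], so the last node of the first curve is also the first node of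
   the second ([sR]). *)
pose s i := if (i <= n1)%N then c * s1 i else c + (1 - c) * s2 (i - n1)%N.
have sR i : (n1 <= i)%N -> s i = c + (1 - c) * s2 (i - n1)%N.
  rewrite leq_eqVlt => /predU1P[<-|ni]; last by rewrite /s leqNgt ni.
  by rewrite /s leqnn subnn s11 s20 mulr0 addr0 mulr1.
exists (n1 + n2)%N, s; split.
- by rewrite /s leq0n s10 mulr0.
- by rewrite sR ?leq_addr// addKn s21 mulr1 cc.
- move=> i ilt; have [i1|i1] := ltnP i n1.
    by rewrite /s (ltnW i1) i1 ltr_pM2l// s1i.
  rewrite !sR// ?(leq_trans i1)// ltrD2l ltr_pM2l// subSn// s2i//.
  by rewrite ltn_subLR.
- move=> i ilt; have [i1|i1] := ltnP i n1.
    have [g [gC1 gE]] := sg1 i i1.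
    exists (fun t => g (phi1 t)); split=> [x|t].
      exact: (C1_line_affine 0 c (gC1 x)).
    rewrite /s (ltnW i1) i1 in_itv/= => /andP[h1 h2].
    have tI : phi1 t \in `[s1 i, s1 i.+1].
      by rewrite in_itv/= affine_le// affine_ge// !add0r h1.
    rewrite -gE// /join_curve ifT//; apply: le_trans h2 _.
    rewrite -[leRHS]mulr1 ler_pM2l// -s11.
    have mono j : (j <= n1)%N -> s1 (n1 - j)%N <= s1 n1.
      elim: j => [|j IH] jn; first by rewrite subn0.
      apply: le_trans (IH (ltnW jn)); apply: ltW.
      have := s1i (n1 - j.+1)%N; rewrite (subnSK jn); apply.
      exact: leq_subr.
    by have := mono (n1 - i.+1)%N (leq_subr _ _); rewrite subKn.
  have i2 : (i - n1 < n2)%N by rewrite ltn_subLR.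
  have [g [gC1 gE]] := sg2 _ i2.
  exists (fun t => g (phi2 t)); split=> [x|t].
    exact: (C1_line_affine c (1 - c) (gC1 x)).
  rewrite !sR ?(leq_trans i1)// subSn// in_itv/= => /andP[h1 h2].
  have tI : phi2 t \in `[s2 (i - n1)%N, s2 (i - n1).+1].
    by rewrite in_itv/= affine_le// affine_ge// h1.
  rewrite -gE// join_right//; apply: le_trans h1; rewrite lerDl mulr_ge0 ?(ltW c1)//.
  have mono j : (j <= n2)%N -> 0 <= s2 j.
    elim: j => [|j IH] jn; first by rewrite s20.
    by apply: le_trans (IH (ltnW jn)) _; apply: ltW; exact: s2i.
  exact: mono (ltnW i2).
Qed.

Let itv01 t : t \in `[0, 1] -> t <= c -> t \in `[0, c].
Proof. by rewrite !in_itv/= => /andP[-> _] ->. Qed.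

Let itv01' t : t \in `[0, 1] -> c < t -> t \in `[c, 1].
Proof. by rewrite !in_itv/= => /andP[_ ->] /ltW ->. Qed.

Let density_join t : t \in `[0, 1] -> density pi (join_curve t).
Proof.
move=> tI; rewrite /join_curve; case: leP => tc.
  by case: adm1 => _ + _ _ _; apply; rewrite phi1_itv; exact: itv01.
by case: adm2 => _ + _ _ _; apply; rewrite phi2_itv; exact: itv01'.
Qed.

Let measurable_join x : measurable_fun (`[0, 1] : set R) (join_potential^~ x).
Proof.
have m1 := measurable_reparam (c := 0) c0 (let: And5 _ _ m _ _ := adm1 in m x).
have m2 := measurable_reparam (c := c) c1 (let: And5 _ _ m _ _ := adm2 in m x).
rewrite add0r in m1; rewrite cc in m2.
rewrite (_ : join_potential^~ x = (fun t => if t <= c then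
  c^-1 * psi1 (phi1 t) x else (1 - c)^-1 * psi2 (phi2 t) x)); last first.
  by apply/funext => t; rewrite /join_potential; case: ifP.
have mI : measurable (`[0, 1] : set R) by exact: measurable_itv.
have mb : measurable_fun (`[0, 1] : set R) (fun t => t <= c).
  by apply: measurable_fun_ler => //; exact: measurable_cst.
apply: measurable_fun_if => //.
- have : measurable_fun (`[0, c] : set R) (fun t => c^-1 * psi1 (phi1 t) x).
    by apply: measurable_funM; [exact: measurable_cst|exact: m1].
  apply: measurable_funS; first exact: measurable_itv.
  by move=> t [/= tI tc]; exact: itv01.
- have : measurable_fun (`[c, 1] : set R) (fun t => (1 - c)^-1 * psi2 (phi2 t) x).
    by apply: measurable_funM; [exact: measurable_cst|exact: m2].
  apply: measurable_funS; first exact: measurable_itv.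
  by move=> t [/= tI tc]; apply: itv01' => //; rewrite ltNge tc.
Qed.

Let continuity_join : {ae mu, forall t : R, t \in `]0, 1[ -> forall x,
  derive1 (join_curve^~ x) t
  + flux Q (join_curve t) (join_potential t) x = 0}.
Proof.
have ce1 := reparam_continuity 0 c0 adm1.
have ce2 := reparam_continuity c c1 adm2.
have FF := ae_filter_ringOfSetsType mu.
have nb := ae_not_breakpoint (fun=> c).
apply: (@filterS3 _ _ FF _ _ _ _ _ ce1 ce2 nb) => t h1 h2 /(_ 0%N)/eqP tc.
rewrite in_itv/= => /andP[t0 t1] x.
move: tc; rewrite neq_lt => /orP[tc|ct].
  have -> : derive1 (join_curve^~ x) t = derive1 (fun s => rho1 (phi1 s) x) t.
    rewrite !derive1E; apply: near_eq_derive.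
    by near=> s; rewrite /join_curve ifT//; apply: ltW; near: s; exact: lt_nbhsl.
  rewrite /join_curve /join_potential ltW//; apply: h1.
  by rewrite affine_lt// affine_gt// mulr0 mulr1 !add0r t0.
have -> : derive1 (join_curve^~ x) t = derive1 (fun s => rho2 (phi2 s) x) t.
  rewrite !derive1E; apply: near_eq_derive.
  by near=> s; rewrite join_right//; apply: ltW; near: s; exact: lt_nbhsr.
rewrite join_right ?ltW// /join_potential leNgt ct /=; apply: h2.
by rewrite affine_lt// affine_gt// mulr0 mulr1 addr0 cc ct.
Unshelve. all: by end_near. Qed.

Lemma admissible_join : admissible Q pi x0 x2 join_curve join_potential.
Proof.
split; [exact: piecewise_join|exact: density_join|exact: measurable_join|
  |exact: continuity_join].
split.
  rewrite /join_curve (ltW c0) /phi1 /affine subrr mul0r.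
  by case: ends1.
rewrite join_right; last by case/andP: c01 => _ /ltW.
by rewrite /phi2 /affine divff ?gt_eqF//; case: ends2.
Qed.

End Join.

Lemma join_inequality (R : realType) (a b r s : R) (e f : \bar R) :
  0 < a -> 0 < b ->
  (0 <= e -> 0 <= f -> 2^-1%:E * e <= r%:E -> 2^-1%:E * f <= s%:E ->
   2^-1%:E * (a^-1%:E * e + b^-1%:E * f) <= (r / a + s / b)%:E)%E.
Proof.
move=> a0 b0; case: e => [e| |] //; last first.
  by rewrite mulry gtr0_sg ?invr_gt0// mul1e leye_eq.
case: f => [f| |] //=; last first.
  by rewrite mulry gtr0_sg ?invr_gt0// mul1e leye_eq.
move=> _ _; rewrite -!EFinM !lee_fin => h1 h2.
by rewrite mulrDr lerD// mulrCA mulrC ler_pM2r ?invr_gt0.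
Qed.

Lemma young_absorb (R : realType) (m e e1 e2 f f1 g g1 : R) :
  e1 = e -> e1 = e2 -> f1 = f -> g1 = g ->
  2 * e2 <= f1 / m^-1 + m^-1 * g1 -> m * f <= e -> e <= g / m.
Proof.
by move=> <- -> <- <-; rewrite invrK [g1 / m]mulrC [f1 * m]mulrC; lra.
Qed.

Lemma C1_cst (R : realType) (v : R) : C1_line (fun=> v).
Proof.
have D t : is_derive t (1 : R) (fun=> v) 0 by exact: is_derive_cst.
by apply: (is_derive_C1_line D); exact: cst_continuous.
Qed.

(** * Concatenation bounds and finiteness of the action *)

Section ReachProperties.
Variables (R : realType) (X : finType) (Q : X -> X -> R) (pi : X -> R).
Variable kappa : R.
Notation mu := (@lebesgue_measure R).
Hypothesis Q_ge0 : forall x y, 0 <= Q x y.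
Hypothesis Q_irr : irreducible_rates Q.
Hypothesis pi_gt0 : forall x, 0 < pi x.
Hypothesis pi_sum1 : \sum_x pi x = 1.
Hypothesis Q_rev : reversible Q pi.
Hypothesis kappa_ge0 : 0 <= kappa.
Hypothesis bochnerQ : bochner_inequality Q pi kappa.

Let lm_energy_ge0 rho psi : 0 <= energy Q pi (@logmean R) rho psi.
Proof. by apply: energy_ge0 => // x y; exact: logmean_ge0. Qed.

Let measurable_admissible_energy x0 x1 rho psi :
  admissible Q pi x0 x1 rho psi -> measurable_fun (`[0, 1] : set R)
  (fun t => energy Q pi (@logmean R) (rho t) (psi t)).
Proof.
move=> [p d m _ _]; apply: measurable_energy => //.
- by move=> t x tI; have [h _] := d t tI; exact: h.
- by move=> x; exact: piecewise_C1_measurable.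
Qed.

Lemma reach_le x y r r' : r <= r' -> reach Q pi x y r -> reach Q pi x y r'.
Proof.
move=> rr [rho [psi [a h]]]; exists rho, psi; split=> //.
by apply: le_trans h _; rewrite lee_fin.
Qed.

Lemma reach_join c x y z r1 r2 : 0 < c < 1 ->
  reach Q pi x y r1 -> reach Q pi y z r2 ->
  reach Q pi x z (r1 / c + r2 / (1 - c)).
Proof.
move=> c01 [rho1 [psi1 [adm1 act1]]] [rho2 [psi2 [adm2 act2]]].
have adm := admissible_join c01 adm1 adm2.
exists (join_curve c rho1 rho2), (join_potential c psi1 psi2); split=> //.
have [c0 c1] : 0 < c /\ c < 1 by case/andP: c01.
have c1' : 0 < 1 - c by rewrite subr_gt0.
have cc : c + (1 - c) = 1 by rewrite addrC subrK.
pose E t := energy Q pi (@logmean R) (join_curve c rho1 rho2 t)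
  (join_potential c psi1 psi2 t).
have mE : measurable_fun (`[0, 1] : set R) E := measurable_admissible_energy adm.
have sub : [set` `[c, 1]] `<=` [set` `[0, 1]].
  by move=> t /=; rewrite !in_itv/= => /andP[h ->]; rewrite (le_trans (ltW c0) h).
have split := ge0_integral_itv_cat (ltW c0) (ltW c1) mE (fun t _ => lm_energy_ge0 _ _).
have A1 := reparam_action Q_ge0 pi_gt0 0 c0 adm1.
have A2 := reparam_action Q_ge0 pi_gt0 c c1' adm2.
have E1 : (\int[mu]_(t in `[0%R, c]) (E t)%:E = c^-1%:E *
    \int[mu]_(t in `[0%R, 1%R]) (energy Q pi (@logmean R) (rho1 t) (psi1 t))%:E)%E.
  rewrite -A1 add0r; apply: eq_integral => t; rewrite inE/= in_itv/= => /andP[_ tc].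
  by rewrite /E /join_curve /join_potential tc.
have E2 : (\int[mu]_(t in `[c, 1%R]) (E t)%:E = (1 - c)^-1%:E *
    \int[mu]_(t in `[0%R, 1%R]) (energy Q pi (@logmean R) (rho2 t) (psi2 t))%:E)%E.
  rewrite -A2 cc; apply: eq_integral_itv_bounded.
  - apply: measurable_funS mE; first exact: measurable_itv.
    by apply: subset_trans sub; exact: subset_itv_oo_cc.
  - have := measurable_reparam_energy (c := c) c1' adm2.
    rewrite cc; apply: measurable_funS; first exact: measurable_itv.
    exact: subset_itv_oo_cc.
  - move=> t; rewrite in_itv/= => /andP[ct _].
    by rewrite /E /join_curve /join_potential leNgt ct.
change (2^-1%:E * \int[mu]_(t in `[0%R, 1%R]) (E t)%:E <=
  (r1 / c + r2 / (1 - c))%:E)%E.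
rewrite split E1 E2.
have {}act1 : (2^-1%:E * \int[mu]_(t in `[0%R, 1%R])
  (energy Q pi (@logmean R) (rho1 t) (psi1 t))%:E <= r1%:E)%E := act1.
have {}act2 : (2^-1%:E * \int[mu]_(t in `[0%R, 1%R])
  (energy Q pi (@logmean R) (rho2 t) (psi2 t))%:E <= r2%:E)%E := act2.
by apply: join_inequality act1 act2 => //; apply: integral_ge0 => t _;
  rewrite lee_fin; exact: lm_energy_ge0.
Qed.

Lemma reach_chain N (x : nat -> X -> R) (r : nat -> R) :
  (forall i, (i <= N)%N -> reach Q pi (x i) (x i.+1) (r i)) ->
  reach Q pi (x 0%N) (x N.+1) (N.+1%:R * \sum_(i < N.+1) r i).
Proof.
elim: N => [|N IH] H.
  by rewrite big_ord1 mul1r; exact: H.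
have {}IH := IH (fun i h => H i (leqW h)).
have n0 : (0 : R) < N.+1%:R by rewrite ltr0n.
have n1 : (0 : R) < N.+2%:R by rewrite ltr0n.
(* With this cut all pieces last equally long, so each cost is multiplied by the number of
   pieces. *)
have c01 : 0 < (N.+1%:R / N.+2%:R : R) < 1.
  by rewrite divr_gt0//= ltr_pdivrMr// mul1r ltr_nat.
have := reach_join c01 IH (H N.+1 (leqnn _)).
apply: reach_le; rewrite [in leRHS]big_ord_recr/=.
have E : N.+2%:R = N.+1%:R + 1 :> R by rewrite -natr1.
move: n0 n1; rewrite E; set n : R := N.+1%:R; set S := \sum_(i < _) _ => n0 n1.
rewrite le_eqVlt; apply/orP; left; apply/eqP; field.
by rewrite !gt_eqF ?subr_gt0 ?ltrDl.
Qed.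

Lemma heat_reach a b x y r : 0 <= a -> 0 <= b -> 0 < a + b ->
  reach Q pi x y r ->
  reach Q pi (heat Q a x) (heat Q b y)
    (expR (- (2 * kappa) * Num.min a b) * r +
     2 * (b - a) * (entropy pi (heat Q a x) - entropy pi (heat Q b y))).
Proof.
by move=> a0 b0 ab [rho [psi [adm act]]];
  exact: (heat_reach_curve Q_ge0 Q_irr pi_gt0 pi_sum1 Q_rev kappa_ge0 bochnerQ
    a0 b0 ab adm act).
Qed.

Let piecewise_C1_C1 (rho : R -> X -> R) :
  (forall x, C1_line (rho^~ x)) -> piecewise_C1 rho.
Proof.
move=> rC1; exists 1%N, (fun i => i%:R); split=> //.
- by move=> i _; rewrite ltr_nat.
- by move=> i _; exists rho.
Qed.

Lemma reach_cst x : density pi x -> reach Q pi x x 0.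
Proof.
move=> xd; exists (fun=> x), (fun _ _ => 0); split.
  split=> //.
  - by apply: piecewise_C1_C1 => y; exact: C1_cst.
  - apply: aeW => t _ y; rewrite derive1_cst add0r big1// => z _.
    by rewrite subrr !mul0r.
rewrite /action (_ : (\int[mu]_(t in _) _)%E = 0%E) ?mule0//.
apply: integral0_eq => t _; congr EFin.
by apply: big1 => y _; apply: big1 => z _; rewrite subrr expr0n !mul0r.
Qed.

(** A bound uniform over the densities above [m]. The potentials [psi] and [chi] have the same flux,
    so [|psi|^2] at [rho] is the inner product of [psi] and [chi] at density 1. Young's inequality
    with weight [m^-1] bounds it, and [logmean >= m] absorbs the [psi] term. *)
Lemma energy_potential_le m rho V : 0 < m -> (forall x, m <= rho x) ->
  \sum_x pi x * V x = 0 ->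
  energy Q pi (@logmean R) rho (potential Q pi rho V) <=
  energy Q pi (@logmean R) (fun=> 1) (potential Q pi (fun=> 1) V) / m.
Proof.
move=> m0 mr V0; set psi := potential Q pi rho V.
set chi := potential Q pi (fun=> 1) V.
have r0 x : 0 < rho x by exact: lt_le_trans (mr x).
have P1 x : V x + flux Q rho psi x = 0 by exact: potentialP.
have P2 x : V x + flux Q (fun=> 1) chi x = 0 by exact: potentialP.
have B1 := flux_by_parts Q_rev psi psi (fun x => ltW (r0 x)).
have B2 := flux_by_parts Q_rev (rho := fun=> 1) psi chi (fun=> ler01).
have E : bilinear Q pi rho psi psi = bilinear Q pi (fun=> 1) psi chi.
  have h0 : - 2^-1 != 0 :> R by rewrite oppr_eq0 invr_eq0 pnatr_eq0.
  apply: (mulfI h0); apply: (eq_trans (esym B1)); apply: (eq_trans _ B2).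
  apply: eq_bigr => x _.
  have -> : flux Q rho psi x = flux Q (fun=> 1) chi x.
    by apply: (addrI (V x)); apply: etrans (P1 x) (esym (P2 x)).
  by [].
have mV : 0 < m^-1 by rewrite invr_gt0.
have Y := bilinear_young Q_ge0 pi_gt0 (fun=> 1) psi chi mV.
have L : m * energy Q pi (@logmean R) (fun=> 1) psi <= energy Q pi (@logmean R) rho psi.
  have -> : m * energy Q pi (@logmean R) (fun=> 1) psi =
      energy Q pi (fun _ _ => m) rho psi.
    rewrite /energy mulr_sumr; apply: eq_bigr => x _.
    rewrite mulr_sumr; apply: eq_bigr => y _.
    have -> : logmean (1 : R) 1 = 1 by exact: logmean_diag ltr01.
    by move: ((psi x - psi y) ^+ 2) (Q x y) (pi x) => w u v; ring.
  apply: (energy_le Q_ge0 pi_gt0) => x y.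
  exact: (logmean_ge_min m0 (mr x) (mr y)).
exact: (young_absorb (bilinear_energy Q pi rho psi) E
  (bilinear_energy Q pi (fun=> 1) psi) (bilinear_energy Q pi (fun=> 1) chi) Y L).
Qed.

Lemma reach_linear y0 y1 : (forall x, 0 < y0 x) -> (forall x, 0 < y1 x) ->
  density pi y0 -> density pi y1 -> exists r, reach Q pi y0 y1 r.
Proof.
move=> p0 p1 [_ d0] [_ d1].
have [m0 [m00 m0P]] := pos_lower_bound p0.
have [m1 [m10 m1P]] := pos_lower_bound p1.
pose m := Num.min m0 m1.
have m_gt0 : 0 < m by rewrite lt_min m00.
pose V x := y1 x - y0 x.
pose rho t x := y0 x + t * V x.
pose psi t := potential Q pi (rho t) V.
have V0 : \sum_x pi x * V x = 0.
  rewrite /V; under eq_bigr do rewrite mulrBr mulrC [pi _ * y0 _]mulrC.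
  by rewrite sumrB d0 d1 subrr.
have rm t x : t \in `[0, 1] -> m <= rho t x.
  rewrite in_itv/= => /andP[t0 t1].
  have -> : rho t x = (1 - t) * y0 x + t * y1 x by rewrite /rho /V; ring.
  have -> : m = (1 - t) * m + t * m by ring.
  by apply: lerD; apply: ler_wpM2l; rewrite ?subr_ge0// /m ge_min ?m0P ?m1P ?orbT.
have r0 t x : t \in `[0, 1] -> 0 < rho t x.
  by move=> tI; apply: lt_le_trans (rm t x tI).
have D x t : is_derive t (1 : R) (rho^~ x) (V x).
  have D0 := is_deriveD (is_derive_cst (y0 x) t (1 : R))
    (is_deriveZ (V x) (is_derive_id t (1 : R))).
  rewrite (_ : rho^~ x = cst (y0 x) + V x \*: id).
    by apply: is_derive_eq D0 _; rewrite add0r /GRing.scale/= mulr1.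
  by apply/funext => u; rewrite /rho mulrC.
have C1r x : C1_line (rho^~ x).
  by apply: (is_derive_C1_line (D x)); exact: cst_continuous.
set B := energy Q pi (@logmean R) (fun=> 1) (potential Q pi (fun=> 1) V) / m.
have mr x : measurable_fun (`[0, 1] : set R) (rho^~ x).
  by apply: measurable_funTS; apply: continuous_measurable_fun; exact: C1_line_continuous.
have mI : measurable (`[0, 1] : set R) by exact: measurable_itv.
have mpsi x : measurable_fun (`[0, 1] : set R) (psi^~ x).
  apply: measurable_potential => //.
    by move=> t y tI; apply: ltW; exact: r0.
exists (2^-1 * B), rho, psi; split.
  split=> //.
  - exact: piecewise_C1_C1.
  - move=> t tI; split=> [x|]; first by apply: ltW; exact: r0.
    rewrite /rho; under eq_bigr do rewrite mulrDl -mulrA [V _ * _]mulrC.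
    by rewrite big_split/= -mulr_sumr V0 mulr0 addr0.
  - split; apply/funext => x; first by rewrite /rho mul0r addr0.
    by rewrite /rho mul1r /V addrC subrK.
  - apply: aeW => t tI x.
    rewrite derive1E (@derive_val _ _ _ _ _ _ _ (D x t)).
    apply: (potentialP Q_ge0 Q_irr pi_gt0 pi_sum1 Q_rev) => // y.
    by apply: r0; apply: subset_itv_oo_cc.
have -> : (2^-1 * B)%:E = (2^-1%:E * \int[mu]_(t in `[0%R, 1%R]) B%:E)%E.
  have -> : (\int[mu]_(t in `[0%R, 1%R]) B%:E = B%:E * mu [set` `[0%R, 1%R]])%E.
    exact: integral_cst.
  rewrite lebesgue_measure_itv/= lte_fin ltr01 -EFinB subr0 mule1.
  by rewrite EFinM.
apply: lee_wpmul2l; first by rewrite lee_fin invr_ge0.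
apply: ge0_le_integral => //.
- by move=> t _; rewrite lee_fin; exact: lm_energy_ge0.
- apply/measurable_EFinP; apply: measurable_energy => // t x tI.
  by apply: ltW; exact: r0.
- move=> t tI; rewrite lee_fin.
  by apply: energy_potential_le => // x; exact: rm.
Qed.

(** Heating the constant curves at [x] and [y] joins each end point to a positive density at the
    price of an entropy difference; positive densities are joined by linear interpolation.
    Finiteness is what makes [W] real valued. *)
Lemma reach_finite x y : density pi x -> density pi y ->
  exists r, reach Q pi x y r.
Proof.
move=> xd yd.
have H0 z : heat Q 0 z = z by apply/funext => u; exact: heat0.
have p z u : density pi z -> 0 < heat Q 1 z u.
  by move=> zd; exact: (heat_gt0 Q_ge0 Q_irr u ltr01 zd).
have d z : density pi z -> density pi (heat Q 1 z).
  by move=> zd; apply: density_heat.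
have h1 := heat_reach (lexx 0) ler01 (ltr_wpDl (lexx 0) ltr01) (reach_cst xd).
have h2 := heat_reach ler01 (lexx 0) (ltr_wpDr (lexx 0) ltr01) (reach_cst yd).
rewrite H0 in h1; rewrite H0 in h2.
have [r hr] := reach_linear (p x ^~ xd) (p y ^~ yd) (d x xd) (d y yd).
have half : 0 < (2^-1 : R) < 1 by rewrite invr_gt0 ltr0n invf_lt1// ltr1n.
by eexists; exact: (reach_join half (reach_join half h1 hr) h2).
Qed.

End ReachProperties.

(** * Convexity of the entropy along geodesics *)

Lemma sum_ord_natr (R : realType) N :
  \sum_(i < N.+1) (i%:R : R) = N%:R * N.+1%:R / 2.
Proof.
elim: N => [|N IH]; first by rewrite big_ord_recr big_ord0 /= addr0 !mul0r.
by rewrite big_ord_recr/= IH -!natr1; field.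
Qed.

(** From [1 + x <= expR x]. The bound is affine in [x], so it can be summed over equally spaced heat
    times, and its slope tends to [- 1] with [c]. *)
Lemma expRN_le (R : realType) (x c : R) : 0 <= x <= c ->
  expR (- x) <= 1 - x / (1 + c).
Proof.
move=> /andP[x0 xc]; have p : 0 < 1 + x by rewrite ltr_wpDr.
have pc : 0 < 1 + c by apply: lt_le_trans p _; rewrite lerD2l.
rewrite expRN; apply: (@le_trans _ _ (1 + x)^-1).
  by rewrite lef_pV2 ?posrE ?expR_gt0// expR_ge1Dx.
rewrite (_ : (1 + x)^-1 = 1 - x / (1 + x)); last by field; rewrite gt_eqF.
by rewrite lerD2l lerN2 ler_wpM2l// lef_pV2 ?posrE// lerD2l.
Qed.

Lemma sum_expR_le (R : realType) (k h : R) N : 0 <= k -> 0 <= h ->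
  \sum_(i < N.+1) expR (- (2 * k) * (i%:R * (h / N.+1%:R)))
  <= N.+1%:R - k * h * N%:R / (1 + 2 * k * h).
Proof.
move=> k0 h0; have n0 : 0 < (N.+1%:R : R) by rewrite ltr0n.
have kh : 0 <= 2 * k * h by rewrite mulr_ge0// mulr_ge0.
have p : 0 < 1 + 2 * k * h by rewrite ltr_wpDr.
apply: (@le_trans _ _ (\sum_(i < N.+1)
    (1 - 2 * k * h / N.+1%:R / (1 + 2 * k * h) * i%:R))).
  apply: ler_sum => i _.
  have -> : - (2 * k) * (i%:R * (h / N.+1%:R)) = - (2 * k * h * (i%:R / N.+1%:R)).
    by ring.
  have -> : 2 * k * h / N.+1%:R / (1 + 2 * k * h) * i%:R
     = 2 * k * h * (i%:R / N.+1%:R) / (1 + 2 * k * h) by ring.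
  apply: expRN_le; rewrite mulr_ge0 ?divr_ge0//= ler_piMr//.
  by rewrite ler_pdivrMr// mul1r ler_nat ltnW// ltn_ord.
rewrite sumrB sumr_const card_ord -mulr_sumr sum_ord_natr lerD2l lerN2.
rewrite le_eqVlt; apply/orP; left; apply/eqP.
by field; rewrite !gt_eqF// ?ltr0n// ltrS.
Qed.

Section GeodesicConvexity.
Variables (R : realType) (X : finType) (Q : X -> X -> R) (pi : X -> R).
Variable kappa : R.
Hypothesis Q_ge0 : forall x y, 0 <= Q x y.
Hypothesis Q_irr : irreducible_rates Q.
Hypothesis pi_gt0 : forall x, 0 < pi x.
Hypothesis pi_sum1 : \sum_x pi x = 1.
Hypothesis Q_rev : reversible Q pi.
Hypothesis kappa_ge0 : 0 <= kappa.
Hypothesis bochnerQ : bochner_inequality Q pi kappa.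
Let H := entropy pi.

(** The heat time changes by [s] on every piece, so all entropy drops carry the same coefficient and
    telescope. A nonzero [s] prevents the heat time from vanishing at both ends of a piece. *)
Lemma heat_chain N (p : nat -> X -> R) (eta : nat -> R) s r : s != 0 ->
  (forall i, (i <= N)%N -> reach Q pi (p i) (p i.+1) r) ->
  (forall i, (i <= N.+1)%N -> 0 <= eta i) ->
  (forall i, (i <= N)%N -> eta i.+1 = eta i + s) ->
  reach Q pi (heat Q (eta 0%N) (p 0%N)) (heat Q (eta N.+1) (p N.+1))
    (N.+1%:R * (r * \sum_(i < N.+1)
       expR (- (2 * kappa) * Num.min (eta i) (eta i.+1)))
     + 2 * (N.+1%:R * s)
       * (H (heat Q (eta 0%N) (p 0%N)) - H (heat Q (eta N.+1) (p N.+1)))).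
Proof.
move=> s0 hr e0 es.
pose P i := heat Q (eta i) (p i).
pose f i := expR (- (2 * kappa) * Num.min (eta i) (eta i.+1)).
have st i : (i <= N)%N ->
    reach Q pi (P i) (P i.+1) (f i * r + 2 * s * (H (P i) - H (P i.+1))).
  move=> iN; have -> : s = eta i.+1 - eta i by rewrite es// addrC addKr.
  have a0 := e0 i (leqW iN); have b0 := e0 i.+1 iN.
  apply: heat_reach => //; last exact: hr.
  rewrite lt_neqAle addr_ge0// andbT eq_sym paddr_eq0//.
  apply/negP => /andP[/eqP ea /eqP eb]; move: (es i iN).
  by rewrite ea eb add0r => /esym/eqP; rewrite (negbTE s0).
apply: (reach_le _ (reach_chain Q_ge0 pi_gt0 st)).
rewrite big_split/= -mulr_suml -mulr_sumr.
have -> : \sum_(i < N.+1) (H (P i) - H (P i.+1)) = H (P 0%N) - H (P N.+1).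
  have := @telescope_sumr R 0 N.+1 (fun i => - H (P i)) isT.
  rewrite big_mkord opprK => e; rewrite addrC -e.
  by apply: eq_bigr => i _; rewrite opprK addrC.
rewrite le_eqVlt; apply/orP; left; apply/eqP.
by rewrite /P /f; ring.
Qed.


(* Average over the [N.+1] pieces of the bound
   [exp (- 2 kappa s) <= 1 - 2 kappa s / (1 + 2 kappa h)] at the heat times
   [s = i h / N.+1]. *)
Definition tent_factor N (h : R) :=
  1 - kappa * h * N%:R / (N.+1%:R * (1 + 2 * kappa * h)).

(** A geodesic of squared length [w] costs [w / N.+1^2] per piece and chaining multiplies by [N.+1];
    the remaining [N.+1] sits in the sum [E] of the contraction factors. The error part is
    simplified by [tent_factor <= 1]. *)
Lemma tent_cost_le N (w e h E : R) : 0 <= w -> 0 < e -> 0 < h ->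
  E <= N.+1%:R - kappa * h * N%:R / (1 + 2 * kappa * h) ->
  N.+1%:R * ((w / N.+1%:R ^+ 2 + e) * E)
  <= w * tent_factor N h + N.+1%:R ^+ 2 * e.
Proof.
move=> w0 e0 h0; have n0 : 0 < (N.+1%:R : R) by rewrite ltr0n.
have kh : 0 <= kappa * h by rewrite mulr_ge0// ltW.
have p : 0 < 1 + 2 * kappa * h by rewrite -mulrA ltr_wpDr// mulr_ge0.
have -> : N.+1%:R - kappa * h * N%:R / (1 + 2 * kappa * h)
    = N.+1%:R * tent_factor N h.
  rewrite /tent_factor; move: (N%:R) (N.+1%:R) n0 => m n n0.
  by field; rewrite (gt_eqF p) (gt_eqF n0).
have S1 : tent_factor N h <= 1.
  rewrite /tent_factor gerBl; apply: divr_ge0; apply: mulr_ge0 => //.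
  exact: ltW.
move=> hE; have r0 : 0 <= w / N.+1%:R ^+ 2 + e.
  by rewrite addr_ge0 ?(ltW e0)// divr_ge0// exprn_ge0// ltW.
apply: (@le_trans _ _ (N.+1%:R * ((w / N.+1%:R ^+ 2 + e) * (N.+1%:R * tent_factor N h)))).
  by rewrite ler_pM2l// ler_wpM2l.
have -> : N.+1%:R * ((w / N.+1%:R ^+ 2 + e) * (N.+1%:R * tent_factor N h))
    = w * tent_factor N h + N.+1%:R ^+ 2 * e * tent_factor N h.
  by move: (tent_factor _ _) (N.+1%:R) n0 => S n n0; field; rewrite (gt_eqF n0).
rewrite lerD2l ler_piMr// mulr_ge0 ?(ltW e0)// exprn_ge0// ltW//.
Qed.

Variables (rho : R -> X -> R) (D : R).
Hypothesis D_ge0 : 0 <= D.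
Hypothesis geodesic_reach : forall s u e : R, 0 <= s <= 1 -> 0 <= u <= 1 -> 0 < e ->
  reach Q pi (rho s) (rho u) ((u - s) ^+ 2 * D + e).

Let subdivision (u v : R) N i : R := u + i%:R * ((v - u) / N.+1%:R).

Let subdivision_itv (u v : R) N i : 0 <= u <= 1 -> 0 <= v <= 1 -> (i <= N.+1)%N ->
  0 <= subdivision u v N i <= 1.
Proof.
move=> /andP[u0 u1] /andP[v0 v1] iN.
have n0 : 0 < (N.+1%:R : R) by rewrite ltr0n.
set a : R := i%:R / N.+1%:R.
have a0 : 0 <= a by rewrite divr_ge0.
have a1 : 0 <= 1 - a by rewrite subr_ge0 ler_pdivrMr// mul1r ler_nat.
have -> : subdivision u v N i = (1 - a) * u + a * v.
  rewrite /subdivision /a; move: (i%:R) (N.+1%:R) n0 => m n n0.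
  by field; rewrite gt_eqF.
rewrite addr_ge0 ?mulr_ge0//=.
rewrite [leRHS](_ : 1 = (1 - a) * 1 + a * 1); last by ring.
by apply: lerD; apply: ler_wpM2l.
Qed.

Let geodesic_heat_chain (u v : R) N (e : R) (eta : nat -> R) (s h E : R) :
  0 <= u <= 1 -> 0 <= v <= 1 -> 0 < e -> 0 < h -> s != 0 ->
  (forall i, (i <= N.+1)%N -> 0 <= eta i) ->
  (forall i, (i <= N)%N -> eta i.+1 = eta i + s) ->
  \sum_(i < N.+1) expR (- (2 * kappa) * Num.min (eta i) (eta i.+1)) = E ->
  E <= N.+1%:R - kappa * h * N%:R / (1 + 2 * kappa * h) ->
  reach Q pi (heat Q (eta 0%N) (rho u)) (heat Q (eta N.+1) (rho v))
    ((v - u) ^+ 2 * D * tent_factor N h + N.+1%:R ^+ 2 * e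
     + 2 * (N.+1%:R * s)
       * (H (heat Q (eta 0%N) (rho u)) - H (heat Q (eta N.+1) (rho v)))).
Proof.
move=> uI vI e0 h0 s0 eta0 etas <- hE.
have n0 : (N.+1%:R : R) != 0 by rewrite pnatr_eq0.
have hr i : (i <= N)%N ->
    reach Q pi (rho (subdivision u v N i)) (rho (subdivision u v N i.+1))
      ((v - u) ^+ 2 * D / N.+1%:R ^+ 2 + e).
  move=> iN; have -> : (v - u) ^+ 2 * D / N.+1%:R ^+ 2
      = (subdivision u v N i.+1 - subdivision u v N i) ^+ 2 * D.
    rewrite /subdivision -[i.+1%:R]natr1.
    by move: (i%:R) (N.+1%:R) n0 => m n n0; field.
  apply: (geodesic_reach _ _ e0); apply: subdivision_itv => //.
  exact: leqW.
have := @heat_chain N (fun i => rho (subdivision u v N i)) eta s _ s0 hr eta0 etas.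
have -> : subdivision u v N 0 = u by rewrite /subdivision mul0r addr0.
have -> : subdivision u v N N.+1 = v.
  by rewrite /subdivision mulrC divfK// addrC subrK.
apply: reach_le; rewrite lerD2r.
by apply: (tent_cost_le _ e0 h0 hE); rewrite mulr_ge0// sqr_ge0.
Qed.

Lemma geodesic_reach_heat (u v : R) N (e h : R) : 0 <= u <= 1 -> 0 <= v <= 1 ->
  0 < e -> 0 < h ->
  reach Q pi (rho u) (heat Q h (rho v))
    ((v - u) ^+ 2 * D * tent_factor N h + N.+1%:R ^+ 2 * e
     + 2 * h * (H (rho u) - H (heat Q h (rho v)))).
Proof.
move=> uI vI e0 h0; have n0 : 0 < (N.+1%:R : R) by rewrite ltr0n.
have H0 z : heat Q 0 z = z by apply/funext => y; exact: heat0.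
pose eta i : R := i%:R * (h / N.+1%:R).
have etaS i : eta i.+1 = eta i + h / N.+1%:R by rewrite /eta -natr1 mulrDl mul1r.
have s0 : 0 < h / N.+1%:R by rewrite divr_gt0.
have := @geodesic_heat_chain u v N e eta (h / N.+1%:R) h _ uI vI e0 h0
  (lt0r_neq0 s0) _ (fun i _ => etaS i) erefl.
have hN : N.+1%:R * (h / N.+1%:R) = h by rewrite mulrC divfK// gt_eqF.
have -> : eta 0%N = 0 by rewrite /eta mul0r.
rewrite [eta N.+1]hN hN H0.
apply=> [i _|]; first by apply: mulr_ge0 => //; exact: ltW.
rewrite (eq_bigr (fun i : 'I_N.+1 =>
    expR (- (2 * kappa) * (i%:R * (h / N.+1%:R))))).
  by apply: sum_expR_le => //; exact: ltW.
by move=> i _; rewrite min_l// ler_pM2r// ler_nat.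
Qed.

(* Here the heat time decreases along the curve, so that the right half of the
   tent needs no reversal of curves. *)
Lemma heat_reach_geodesic (u v : R) N (e h : R) : 0 <= u <= 1 -> 0 <= v <= 1 ->
  0 < e -> 0 < h ->
  reach Q pi (heat Q h (rho u)) (rho v)
    ((v - u) ^+ 2 * D * tent_factor N h + N.+1%:R ^+ 2 * e
     + 2 * h * (H (rho v) - H (heat Q h (rho u)))).
Proof.
move=> uI vI e0 h0; have n0 : 0 < (N.+1%:R : R) by rewrite ltr0n.
have H0 z : heat Q 0 z = z by apply/funext => y; exact: heat0.
pose eta i : R := (N.+1 - i)%:R * (h / N.+1%:R).
have etaS i : (i <= N)%N -> eta i.+1 = eta i + - (h / N.+1%:R).
  by move=> iN; rewrite /eta subSS subSn// -[(N - i).+1%:R]natr1 mulrDl mul1r addrK.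
have s0 : 0 < h / N.+1%:R by rewrite divr_gt0.
have s1 : - (h / N.+1%:R) != 0 by rewrite oppr_eq0 (gt_eqF s0).
have := @geodesic_heat_chain u v N e eta _ h _ uI vI e0 h0 s1 _ etaS erefl.
have -> : 2 * (N.+1%:R * - (h / N.+1%:R)) = - (2 * h) :> R.
  by move: (N.+1%:R) n0 => n n0; field; rewrite gt_eqF.
have -> : eta 0%N = h by rewrite /eta subn0 mulrC divfK// gt_eqF.
have -> : eta N.+1 = 0 by rewrite /eta subnn mul0r.
rewrite H0 mulNr -mulrN opprB.
apply=> [i _|]; first by apply: mulr_ge0 => //; exact: ltW.
(* The smaller heat time is now at the right end of each piece; reversing the order of the pieces
   gives the sum bounded by [sum_expR_le]. *)
rewrite (reindex_inj rev_ord_inj)/=.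
rewrite (eq_bigr (fun i : 'I_N.+1 =>
    expR (- (2 * kappa) * (i%:R * (h / N.+1%:R))))).
  by apply: sum_expR_le => //; exact: ltW.
move=> i _; have iN : (i <= N)%N by rewrite -ltnS.
have e1 : eta (N - i)%N = i.+1%:R * (h / N.+1%:R).
  by rewrite /eta subSn ?leq_subr// subKn.
have e2 : eta (N - i).+1 = i%:R * (h / N.+1%:R) by rewrite /eta subSS subKn.
by rewrite subSS e1 e2 min_r// ler_pM2r// ler_nat.
Qed.

End GeodesicConvexity.

Lemma archimedean_le (R : realType) (k m : R) :
  (forall N : nat, k * N%:R <= m * N.+1%:R) -> k <= m.
Proof.
move=> h; rewrite leNgt; apply/negP => mk.
have m0 : 0 <= m by have := h 0%N; rewrite mulr0 mulr1.
have d0 : 0 < k - m by rewrite subr_gt0.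
have := archi_boundP (divr_ge0 m0 (ltW d0)); set N := Num.bound _.
rewrite ltr_pdivrMr// => hN; have := h N; rewrite -natr1.
move: (N%:R) hN => x; lra.
Qed.

Lemma tent_bound (R : realType) (t D S n2 e b0 b1 : R) : 0 < t < 1 ->
  (t ^+ 2 * D * S + n2 * e + b0) / t
  + ((1 - t) ^+ 2 * D * S + n2 * e + b1) / (1 - t)
  = D * S + (b0 / t + b1 / (1 - t)) + n2 * (t^-1 + (1 - t)^-1) * e.
Proof.
move=> /andP[t0 t1]; have t1' : 0 < 1 - t by rewrite subr_gt0.
by field; rewrite (gt_eqF t0) (gt_eqF t1').
Qed.

Section GeodesicEntropy.
Variables (R : realType) (X : finType) (Q : X -> X -> R) (pi : X -> R).
Variable kappa : R.
Hypothesis Q_ge0 : forall x y, 0 <= Q x y.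
Hypothesis Q_irr : irreducible_rates Q.
Hypothesis pi_gt0 : forall x, 0 < pi x.
Hypothesis pi_sum1 : \sum_x pi x = 1.
Hypothesis Q_rev : reversible Q pi.
Hypothesis kappa_ge0 : 0 <= kappa.
Hypothesis bochnerQ : bochner_inequality Q pi kappa.
Variables (rho : R -> X -> R) (D : R).
Hypothesis D_ge0 : 0 <= D.
Hypothesis geodesic_reach : forall s u e : R, 0 <= s <= 1 -> 0 <= u <= 1 ->
  0 < e -> reach Q pi (rho s) (rho u) ((u - s) ^+ 2 * D + e).
Hypothesis geodesic_min : forall r, reach Q pi (rho 0) (rho 1) r -> D <= r.
Let H := entropy pi.
Let Hh (t h : R) := H (heat Q h (rho t)).
Let gap (t h : R) := (H (rho 0) - Hh t h) / t + (H (rho 1) - Hh t h) / (1 - t).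

(** Two halves joined at time [t]: their squared lengths [t^2 D] and [(1 - t)^2 D], divided by their
    durations, add up to [D] again, while the entropy terms become [gap]. The joined curve is a
    competitor for the minimal [D]. *)
Let tent_epsilon (t h e : R) N : 0 < t < 1 -> 0 < h -> 0 < e ->
  D <= D * tent_factor kappa N h + 2 * h * gap t h
       + N.+1%:R ^+ 2 * (t^-1 + (1 - t)^-1) * e.
Proof.
move=> tI h0 e0; have /andP[t0 t1] := tI.
have I0 : 0 <= (0 : R) <= 1 by rewrite lexx ler01.
have I1 : 0 <= (1 : R) <= 1 by rewrite ler01 lexx.
have It : 0 <= t <= 1 by rewrite !ltW.
have L := geodesic_reach_heat Q_ge0 Q_irr pi_gt0 pi_sum1 Q_rev kappa_ge0
  bochnerQ D_ge0 geodesic_reach N I0 It e0 h0.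
have M := heat_reach_geodesic Q_ge0 Q_irr pi_gt0 pi_sum1 Q_rev kappa_ge0
  bochnerQ D_ge0 geodesic_reach N It I1 e0 h0.
have J := geodesic_min (reach_join Q_ge0 pi_gt0 tI L M).
apply: le_trans J _; rewrite subr0 tent_bound// lerD2r lerD2l.
by rewrite /gap [in leRHS]mulrDr !mulrA.
Qed.

(** At fixed [h], the error [e] is sent to 0 for each [N], then [D] cancels and a factor [h] is
    divided out, and finally [N] tends to infinity. *)
Let tent_large_h (t h : R) : 0 < t < 1 -> 0 < h ->
  D * kappa <= 2 * gap t h * (1 + 2 * kappa * h).
Proof.
move=> tI h0; have /andP[t0 t1] := tI.
have p : 0 < 1 + 2 * kappa * h.
  by rewrite ltr_wpDr// mulr_ge0 ?(ltW h0)// mulr_ge0.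
apply: archimedean_le => N.
have n0 : 0 < (N.+1%:R : R) by rewrite ltr0n.
have C0 : 0 < N.+1%:R ^+ 2 * (t^-1 + (1 - t)^-1).
  by rewrite mulr_gt0 ?exprn_gt0// addr_gt0// invr_gt0// subr_gt0.
have : D <= D * tent_factor kappa N h + 2 * h * gap t h.
  apply/ler_addgt0Pr => e e0.
  have := tent_epsilon N tI h0 (divr_gt0 e0 C0).
  by rewrite [_ * (e / _)]mulrC divfK// gt_eqF.
have -> : D * tent_factor kappa N h =
    D - h / (N.+1%:R * (1 + 2 * kappa * h)) * (D * kappa * N%:R).
  rewrite /tent_factor; move: (N%:R) (N.+1%:R) n0 => m n n0.
  by field; rewrite (gt_eqF p) (gt_eqF n0).
rewrite -addrA lerDl addrC subr_ge0.
have -> : 2 * h * gap t h = h / (N.+1%:R * (1 + 2 * kappa * h))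
    * (2 * gap t h * (1 + 2 * kappa * h) * N.+1%:R).
  move: (N.+1%:R) (gap t h) n0 => n g n0.
  by field; rewrite (gt_eqF p) (gt_eqF n0).
by rewrite ler_pM2l// divr_gt0// mulr_gt0.
Qed.

Lemma geodesic_entropy_le t : 0 <= t <= 1 ->
  H (rho t) <= (1 - t) * H (rho 0) + t * H (rho 1)
               - kappa / 2 * t * (1 - t) * D.
Proof.
move=> /andP[t0 t1].
have [->|tn0] := eqVneq t 0; first by rewrite subr0 mulr0 !mul0r mul1r addr0 subr0.
have [->|tn1] := eqVneq t 1; first by rewrite subrr mulr0 !mul0r mul1r add0r subr0.
have tI : 0 < t < 1 by rewrite !lt_neqAle t0 t1 tn1 eq_sym tn0.
have {t0 t1 tn0 tn1} /andP[t0 t1] := tI.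
have H0 z : heat Q 0 z = z by apply/funext => u; exact: heat0.
pose F h := 2 * gap t h * (1 + 2 * kappa * h).
have cH : continuous (Hh t).
  have := @continuous_entropy_heat_curve R X Q pi Q_ge0 0 1 (fun=> rho t)
    (fun x => C1_cst (rho t x)).
  rewrite (_ : (fun h : R => entropy pi (heat Q ((fun u => 0 + (1 - 0) * u) h) (rho t))) = Hh t)//.
  by apply/funext => h; rewrite subr0 mul1r add0r.
have cF : continuous F.
  move=> h; apply: cvgM; last first.
    apply: cvgD; first exact: cvg_cst.
    by apply: cvgM; [exact: cvg_cst|exact: cvg_id].
  apply: cvgM; first exact: cvg_cst.
  by apply: cvgD; (apply: cvgM; last exact: cvg_cst); apply: cvgB;
    [exact: cvg_cst|exact: cH|exact: cvg_cst|exact: cH].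
have F0 : F h @[h --> 0^'+] --> F 0 by apply: cvg_at_right_filter; exact: cF.
(* The bound holds for every positive [h], and the entropy of the heated density is continuous at
   [h = 0], so it passes to the limit. *)
have nF : \forall h \near 0^'+, D * kappa <= F h.
  near=> h; exact: tent_large_h.
have := limr_ge (cvgP _ F0) nF => /(_ _); rewrite (cvg_lim _ F0)// /F mulr0 addr0 mulr1 /gap /Hh H0.
move: (H (rho t)) (H (rho 0)) (H (rho 1)) => a b c.
rewrite -(ler_pM2l (mulr_gt0 t0 (_ : 0 < 1 - t))) ?subr_gt0//.
have -> : t * (1 - t) * (2 * ((b - a) / t + (c - a) / (1 - t)))
    = 2 * ((1 - t) * b + t * c - a).
  by field; rewrite (gt_eqF t0) subr_eq0 (gt_eqF t1).
have -> : kappa / 2 * t * (1 - t) * D = t * (1 - t) * (D * kappa) / 2 by field.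
move: (t * (1 - t) * (D * kappa)) ((1 - t) * b) (t * c) => x y z.
lra.
Unshelve. all: by end_near.
Qed.

End GeodesicEntropy.

(** * The distance as an infimum, and the curvature bound *)

Section TransportDistance.
Variables (R : realType) (X : finType) (Q : X -> X -> R) (pi : X -> R).
Variable kappa : R.
Hypothesis Q_ge0 : forall x y, 0 <= Q x y.
Hypothesis Q_irr : irreducible_rates Q.
Hypothesis pi_gt0 : forall x, 0 < pi x.
Hypothesis pi_sum1 : \sum_x pi x = 1.
Hypothesis Q_rev : reversible Q pi.
Hypothesis kappa_ge0 : 0 <= kappa.
Hypothesis bochnerQ : bochner_inequality Q pi kappa.

Lemma action_ge0 (rho psi : R -> X -> R) : (0 <= action Q pi rho psi)%E.
Proof.
apply: mule_ge0; first by rewrite lee_fin invr_ge0.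
apply: integral_ge0 => t _; rewrite lee_fin.
by apply: energy_ge0 => // x y; exact: logmean_ge0.
Qed.

(** Here [d] is the squared distance. The infimum may fail to be attained, so only values strictly
    above [d] are claimed to be reached; this is the source of the errors [e]. *)
Lemma W_reach x y : density pi x -> density pi y ->
  exists2 d : R, 0 <= d /\ W Q pi x y = (Num.sqrt d)%:E &
    (forall r, reach Q pi x y r -> d <= r) /\
    (forall r, d < r -> reach Q pi x y r).
Proof.
move=> xd yd; rewrite /W; set A := [set a | _].
have A0 : (0 <= ereal_inf A)%E.
  by apply: le_ereal_inf_tmp => _ [rho [psi [_ ->]]]; exact: action_ge0.
have low r : reach Q pi x y r -> (ereal_inf A <= r%:E)%E.
  move=> [rho [psi [adm act]]]; apply: ge_ereal_inf.
  by exists (action Q pi rho psi) => //; exists rho, psi.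
have [r0 hr0] := reach_finite Q_ge0 Q_irr pi_gt0 pi_sum1 Q_rev kappa_ge0
  bochnerQ xd yd.
have Afin : ereal_inf A \is a fin_num.
  by rewrite ge0_fin_numE//; apply: le_lt_trans (low _ hr0) (ltry _).
exists (fine (ereal_inf A)); first split.
- exact: fine_ge0.
- by rewrite -[in LHS](fineK Afin).
split=> [r hr|r hr]; first by rewrite -lee_fin fineK//; exact: low.
have : (ereal_inf A < r%:E)%E by rewrite -(fineK Afin) lte_fin.
move=> /ereal_inf_lt[_ [rho [psi [adm ->]]] /ltW act].
by exists rho, psi.
Qed.

Lemma ricci_of_bochner : Ric_ge Q pi kappa.
Proof.
move=> rho [rhod rhoW] t; rewrite in_itv => tI.
have i0 : (0 : R) \in `[0, 1] by rewrite in_itv/= lexx ler01.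
have i1 : (1 : R) \in `[0, 1] by rewrite in_itv/= lexx ler01.
have [D [D0 WD] [Dmin _]] := W_reach (rhod _ i0) (rhod _ i1).
have geo s u e : 0 <= s <= 1 -> 0 <= u <= 1 -> 0 < e ->
    reach Q pi (rho s) (rho u) ((u - s) ^+ 2 * D + e).
  move=> sI uI e0.
  have {}sI : s \in `[0, 1] by rewrite in_itv.
  have {}uI : u \in `[0, 1] by rewrite in_itv.
  have [d [d0 Wd] [_ dr]] := W_reach (rhod _ sI) (rhod _ uI).
  have := rhoW s u sI uI; rewrite Wd WD -EFinM => -[ed].
  (* Constant speed gives [d = (s - u)^2 D] after squaring, which lies strictly below the claimed
     cost because [e > 0]. *)
  apply: dr; rewrite -[d]sqr_sqrtr// ed exprMn sqr_sqrtr// real_normK ?num_real//.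
  by rewrite -[(s - u) ^+ 2]sqrrN opprB ltrDl.
have := geodesic_entropy_le Q_ge0 Q_irr pi_gt0 pi_sum1 Q_rev kappa_ge0
  bochnerQ D0 geo Dmin tI.
by rewrite WD expe2 -EFinM -expr2 sqr_sqrtr// -EFinM -EFinB lee_fin.
Qed.

End TransportDistance.

(** Some point has positive mass since the total is 1, and detailed balance propagates positivity
    along a path of positive rates. *)
Lemma reversible_gt0 (R : realType) (X : finType) (Q : X -> X -> R)
    (pi : X -> R) : (forall x y, 0 <= Q x y) -> irreducible_rates Q ->
  probability_measure_on pi -> reversible Q pi -> forall x, 0 < pi x.
Proof.
move=> Q0 irr [pi0 pi1] rev x.
have [x0 px0] : exists x0, 0 < pi x0.
  apply: contrapT => /forallNP h; have : \sum_y pi y = 0.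
    apply: big1 => y _; apply/eqP; rewrite eq_le pi0 leNgt.
    by apply/andP; split=> //; apply/negP; exact: h.
  by rewrite pi1 => /eqP; rewrite oner_eq0.
have /connectP[p] := irr x0 x; elim: p x0 px0 => [|y p IH] x0 px0 /=.
  by move=> _ ->.
move=> /andP[Qxy hp]; apply: IH hp.
have := mulr_gt0 Qxy px0; rewrite rev => h.
by rewrite lt_def pi0 andbT; apply: contraL h => /eqP ->; rewrite mulr0 ltxx.
Qed.

Theorem theorem1p1 (R : realType) (X : finType) (G : {set {perm X}})
  (c : X -> {perm X} -> R) (pi : X -> R) (lambda : R)
  (G_inv : forall d, d \in G -> d^-1%g \in G)
  (c_ge0 : forall x d, d \in G -> 0 <= c x d)
  (irr : irreducible_rates (rates G c))
  (pi_prob : probability_measure_on pi)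
  (pi_rev : reversible (rates G c) pi)
  (c_rev : forall x d, d \in G -> c x d * pi x = c (d x) d^-1%g * pi (d x))
  (G_comm : forall x d e, d \in G -> e \in G -> d (e x) = e (d x))
  (lambda_min : is_minimum
     [set r | exists x d, [/\ d \in G, 0 < c x d
                            & r = curvature_term G c pi x d]] lambda)
  (lambda_ge0 : 0 <= lambda) :
  Ric_ge (rates G c) pi (2 * lambda).
Proof.
have Q_ge0 x y : 0 <= rates G c x y.
  rewrite /rates; case: eqP => // _; apply: sumr_ge0 => d /andP[dG _].
  exact: c_ge0.
have pi_gt0 := reversible_gt0 Q_ge0 irr pi_prob pi_rev.
have [_ pi_sum1] := pi_prob.
apply: ricci_of_bochner => //; first exact: mulr_ge0.
move=> th th1 rho psi thm rho0.
have lambda_lb x d : d \in G -> 0 < c x d -> lambda <= curvature_term G c pi x d.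
  by move=> dG cd; apply: lambda_min.2; exists x, d.
have := bochner_rates G_inv c_ge0 pi_gt0 c_rev G_comm lambda_lb lambda_ge0
  thm psi rho0.
(* Edge reversal produced the constant [4 * lambda], which is [2 * kappa] for
   [kappa = 2 * lambda]. *)
have -> : 2 * (2 * lambda) = 4 * lambda by rewrite mulrA -natrM.
have E f : generator G c f = lap (rates G c) f.
  by apply/funext => x; rewrite generatorE.
by rewrite !E.
Qed.
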